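(* Let $K$ be an imaginary quadratic field and $\tau\in K\cap\mathbb{H}$. Then $T_1(\tau)$ and $T_2(\tau)$ are algebraic units.
   Context: $q=e^{2\pi i\tau}$, $(a;q)_\infty=\prod_{n\ge0}(1-aq^n)$. Define $T_1(\tau)=\dfrac{(-q;q^5)_\infty(-q^4;q^5)_\infty-(q;q^5)_\infty(q^4;q^5)_\infty}{(-q;q^5)_\infty(-q^4;q^5)_\infty+(q;q^5)_\infty(q^4;q^5)_\infty}$ and $T_2(\tau)=\dfrac{(-q^2;q^5)_\infty(-q^3;q^5)_\infty-(q^2;q^5)_\infty(q^3;q^5)_\infty}{(-q^2;q^5)_\infty(-q^3;q^5)_\infty+(q^2;q^5)_\infty(q^3;q^5)_\infty}$. *)

(* Defs.v *)
From Stdlib Require Import Reals List ZArith.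
From Coquelicot Require Import Coquelicot.
Open Scope R_scope.

(* q = e^{2 pi i tau}, written out: e^{-2 pi Im tau} (cos(2 pi Re tau) + i sin(2 pi Re tau)) *)
Definition qnome (tau : C) : C :=
  Cmult (RtoC (exp (- (2 * PI * Im tau))))
        (cos (2 * PI * Re tau), sin (2 * PI * Re tau)).

Fixpoint qpoch_partial (a q : C) (N : nat) : C :=
  match N with
  | O => RtoC 1
  | S N' => Cmult (qpoch_partial a q N') (Cminus (RtoC 1) (Cmult a (Cpow q N')))
  end.

Definition qpoch_inf (a q : C) : C :=
  (real (Lim_seq (fun N => Re (qpoch_partial a q N))),
   real (Lim_seq (fun N => Im (qpoch_partial a q N)))).

Definition T1 (tau : C) : C :=
  let q := qnome tau in
  let q5 := Cpow q 5 in
  let P := Cmult (qpoch_inf (Copp q) q5) (qpoch_inf (Copp (Cpow q 4)) q5) in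
  let M := Cmult (qpoch_inf q q5) (qpoch_inf (Cpow q 4) q5) in
  Cdiv (Cminus P M) (Cplus P M).

Definition T2 (tau : C) : C :=
  let q := qnome tau in
  let q5 := Cpow q 5 in
  let P := Cmult (qpoch_inf (Copp (Cpow q 2)) q5) (qpoch_inf (Copp (Cpow q 3)) q5) in
  let M := Cmult (qpoch_inf (Cpow q 2) q5) (qpoch_inf (Cpow q 3) q5) in
  Cdiv (Cminus P M) (Cplus P M).

(* evaluation of an integer polynomial, coefficients listed from degree 0 up *)
Definition Zpoly_eval (l : list Z) (z : C) : C :=
  fold_right (fun a acc => Cplus (RtoC (IZR a)) (Cmult z acc)) (RtoC 0) l.

Definition is_algebraic_integer (z : C) : Prop :=
  exists l : list Z, Zpoly_eval (l ++ (1%Z :: nil)) z = RtoC 0.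

Definition is_algebraic_unit (z : C) : Prop :=
  z <> RtoC 0 /\ is_algebraic_integer z /\ is_algebraic_integer (Cinv z).

(* tau lies in some imaginary quadratic field and in the upper half plane:
   Im tau > 0 and tau is a root of a degree-2 integer polynomial
   (a non-real number generates an imaginary quadratic field iff it has degree 2 over Q). *)
Definition in_imag_quadratic_upper (tau : C) : Prop :=
  0 < Im tau /\
  exists a b c : Z, a <> 0%Z /\
    Cplus (Cplus (Cmult (RtoC (IZR a)) (Cmult tau tau)) (Cmult (RtoC (IZR b)) tau))
          (RtoC (IZR c)) = RtoC 0.

(* Main.v *)
(** With u = q^i and Q = q^5, Jacobi's triple product turns P and M in T_i = (P - M)/(P + M) into the theta series
    sum_n (+-1)^n Q^(n(n-1)/2) u^n, so that T_i is the quotient of its odd by its even part. As a function of u this quotient is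
    sqrt(k) sn, and u = q^i is a 5-torsion point: the addition formulas make T_i a root of a polynomial of degree 25 over
    Z[beta] with leading and constant coefficients +-1, where beta = 4 (k + 1/k). Moreover y = beta + 8 satisfies
    (y^2 - 16 y + 256)^3 = j y^2 (y - 16)^2 with j = j(10 tau), so everything reduces to the integrality of j at CM points.

    If tau is fixed by an integral matrix of nonsquare determinant n, it is a zero of the product of j(tau) - j(M tau) over
    the M of determinant n in Hermite form. This product is a modular function whose expansion in e^(pi i tau / n) has algebraic
    integer coefficients and a unit as leading coefficient, hence a polynomial in j of the same kind. Working over all
    algebraic integers avoids Galois descent to Z: only the leading coefficient matters. The q-expansion principle rests on
    Cauchy's estimates and Schwarz's lemma, modularity of j on the inversion formula for theta series. *)
Require Import Defs.
From Stdlib Require Import Reals List ZArith.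
From Stdlib Require Import Permutation Lra Lia Classical ClassicalEpsilon FunctionalExtensionality.
From Coquelicot Require Import Coquelicot.
From mathcomp Require all_boot all_algebra boolp.
Open Scope C_scope.

(** * Algebraic integers *)

(** Integrals and holomorphy never enter: Poisson summation and Cauchy's estimates are both obtained
    from averages over N equally spaced nodes, followed by dominated convergence as N grows. That
    T_i is a unit, and not merely integral, comes from a symmetry: U -> -U inverts [Oo / Ee], so the
    torsion polynomial is antipalindromic and 1/T_i is a root of it as well. The duplication formula
    involves the modulus k only through beta, which is integral as soon as 16/lambda is; the degree
    25 is the number of 5-torsion points. Determinants are required to be nonsquare because a
    Hermite form with a = d gives j(M tau) a pole of the same order as j(tau): the leading terms
    could cancel, or leave a coefficient that is not a unit. Enough such determinants exist at a CM
    point because multiplication by a tau + k on the lattice Z tau + Z fixes tau for every integer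
    k. The constant in theta inversion is left implicit: j is homogeneous of degree 0 in the fourth
    powers of the theta constants. *)

Module AlgebraicIntegers.
Import HB.structures mathcomp.boot.all_boot mathcomp.algebra.all_algebra.
Import GRing.Theory.

(* MathComp's [integralOver] wants a field structure on the complex numbers; it is declared on a copy of [C]. *)
Definition CC : Type := (R * R)%type.

HB.instance Definition _ := boolp.gen_eqMixin CC.
HB.instance Definition _ := boolp.gen_choiceMixin CC.
Fact CC_addNr : left_inverse (RtoC 0 : CC) Copp Cplus.
Proof. by move=> x; rewrite Cplus_comm Cplus_opp_r. Qed.
HB.instance Definition _ := GRing.isZmodule.Build CC
  Cplus_assoc Cplus_comm Cplus_0_l CC_addNr.

Fact CC_mulDl : left_distributive (Cmult : CC -> CC -> CC) Cplus.
Proof. move=> x y z; exact: Cmult_plus_distr_r. Qed.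
Fact CC_1nz : (RtoC 1 : CC) != 0%R.
Proof. by apply/eqP=> -[]; apply: R1_neq_R0. Qed.
HB.instance Definition _ := GRing.Zmodule_isComNzRing.Build CC
  Cmult_assoc Cmult_comm Cmult_1_l CC_mulDl CC_1nz.

Definition CC_inv (x : CC) : CC := if x == 0%R then (0%R : CC) else (Cinv x : CC).
Fact CC_mulVx (x : CC) : x != 0%R -> (CC_inv x * x = 1)%R.
Proof.
by rewrite /CC_inv; case: eqP => // x0 _; apply: Cinv_l.
Qed.
Fact CC_inv0 : CC_inv 0%R = 0%R.
Proof. by rewrite /CC_inv eqxx. Qed.
HB.instance Definition _ := GRing.ComNzRing_isField.Build CC CC_mulVx CC_inv0.

Definition Zint (a : Z) : int :=
  match a with Z0 => 0%R | Zpos p => Posz (Pos.to_nat p) | Zneg p => (- Posz (Pos.to_nat p))%R end.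

Lemma natr_INR n : (n%:R : CC)%R = RtoC (INR n).
Proof.
elim: n => [|n IH] //.
by rewrite S_INR RtoC_plus -IH -addn1 natrD.
Qed.
Lemma Zint_IZR a : ((Zint a)%:~R : CC)%R = RtoC (IZR a).
Proof.
case: a => [|p|p] //=.
  by rewrite -pmulrn natr_INR INR_IZR_INZ positive_nat_Z.
rewrite rmorphN /= -pmulrn natr_INR INR_IZR_INZ positive_nat_Z.
by rewrite -Pos2Z.opp_pos opp_IZR RtoC_opp.
Qed.
Lemma Zint_surj (m : int) : exists a, Zint a = m.
Proof.
case: m => n.
  exists (Z.of_nat n); case: n => [|n] //=; by rewrite SuccNat2Pos.id_succ.
exists (Z.opp (Z.of_nat n.+1)); rewrite /= SuccNat2Pos.id_succ; by [].
Qed.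

Notation alg := (integralOver (intr : int -> CC)).

Lemma Zpoly_eval_Poly (l : seq Z) (z : CC) :
  Zpoly_eval l z = (map_poly intr (Poly (map Zint l))).[z]%R.
Proof.
elim: l => [|a l IH] /=; first by rewrite map_poly0 horner0.
rewrite cons_poly_def rmorphD rmorphM /= map_polyX map_polyC /= hornerMXaddC.
by rewrite -IH Zint_IZR [RHS]addrC [X in (_ + X = _)%C]Cmult_comm.
Qed.

(** Gives access to the closure of integral elements under ring operations. In the converse
    direction integer coefficients are pulled back along a section of [Zint], after the leading 1
    has been split off. *)
Lemma algebraic_integerP (z : CC) : is_algebraic_integer z <-> alg z.
Proof.
split=> [[l Hl]|[p p1 Hp]].
  exists (Poly (map Zint (l ++ [:: Zpos xH]))).
    rewrite map_cat /= cats1 monicE.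
    have H : polyseq (Poly (rcons (map Zint l) (Zint (Zpos xH)))) = rcons (map Zint l) (Zint (Zpos xH)).
      by rewrite (@PolyK _ 0%R) // last_rcons.
    by rewrite lead_coefE H size_rcons nth_rcons size_map /= ltnn eqxx.
  by apply/rootP; rewrite -Zpoly_eval_Poly; exact: Hl.
have [f Hf] : exists f : int -> Z, forall m, Zint (f m) = m.
  exists (fun m => sval (boolp.cid (Zint_surj m))) => m; by case: boolp.cid.
exists (map f (take (size p).-1 p)).
rewrite Zpoly_eval_Poly map_cat -map_comp.
have -> : map Zint [:: Zpos xH] = [:: lead_coef p] by rewrite (monicP p1).
rewrite (eq_map (g := id)) ?map_id; last by move=> m /=.
suff -> : take (size p).-1 p ++ [:: lead_coef p] = p by rewrite polyseqK; exact: (rootP Hp).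
have Hs : (0 < size p)%N by rewrite lt0n size_poly_eq0 monic_neq0.
by rewrite cats1 lead_coefE -take_nth ?prednK ?take_size.
Qed.

Local Notation algint := is_algebraic_integer.
Lemma algint_plus x y : algint x -> algint y -> algint (Cplus x y).
Proof. by rewrite !algebraic_integerP; apply: integral_add. Qed.
Lemma algint_minus x y : algint x -> algint y -> algint (Cminus x y).
Proof. by rewrite !algebraic_integerP; apply: integral_sub. Qed.
Lemma algint_mult x y : algint x -> algint y -> algint (Cmult x y).
Proof. by rewrite !algebraic_integerP; apply: integral_mul. Qed.
Lemma algint_IZR (a : Z) : algint (RtoC (IZR a)).
Proof. rewrite algebraic_integerP -Zint_IZR; exact: integral_id. Qed.
(** Transitivity of integrality, which allows coefficients to range over all algebraic integers. The
    base value 1 of the fold is the leading coefficient, so [l] lists only the lower ones. *)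
Lemma algint_root (l : list CC) (z : CC) : List.Forall algint l ->
  List.fold_right (fun a acc => Cplus a (Cmult z acc)) (RtoC 1) l = RtoC 0 -> algint z.
Proof.
move=> Hl Hz; rewrite algebraic_integerP.
pose p : {poly CC} := Poly (rcons l (1%R : CC)).
have E : polyseq p = rcons l (1%R : CC).
  rewrite (@PolyK _ 0%R) // last_rcons; exact: CC_1nz.
apply: (@integral_root_monic _ _ _ _ p).
- by rewrite monicE lead_coefE E size_rcons nth_rcons ltnn eqxx.
- apply/rootP; apply: etrans Hz; rewrite /p {E Hl p}; elim: l => [|a l IH] /=.
    by rewrite cons_poly_def mul0r add0r hornerC.
  by rewrite cons_poly_def hornerMXaddC IH [LHS]addrC [X in (_ + X)%R]mulrC.
- move=> c; rewrite E mem_rcons inE => /orP[/eqP->|].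
    exact: (integral1 (intr : {rmorphism int -> CC})).
  move=> cl; rewrite -algebraic_integerP; elim: Hl cl => // a l' Ha _ IH.
  by rewrite inE => /orP[/eqP->|].
Qed.
End AlgebraicIntegers.
Import AlgebraicIntegers.
Local Notation algint := is_algebraic_integer.

(** * Unconditional summation *)

Definition eq_dec_of {I : Type} (x y : I) : {x = y} + {x <> y} :=
  excluded_middle_informative (x = y).

Section Summation.
Context {I : Type}.
Implicit Types (f : I -> C) (L : list I).

Definition lsum f L : C := fold_right (fun i a => f i + a) 0 L.
Definition rsum (g : I -> R) L : R := fold_right (fun i a => (g i + a)%R) 0%R L.
(** Boundedness of the finite absolute sums, rather than existence of a limit, makes comparison and
    restriction immediate for every index type. *)
Definition summable f := exists B, forall L, NoDup L -> (rsum (fun i => Cmod (f i)) L <= B)%R.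
(** Convergence along the directed set of finite subsets: no enumeration of the integers or of pairs
    has to be fixed. *)
Definition hsum f s := forall eps, (0 < eps)%R -> exists L0, forall L,
  NoDup L -> incl L0 L -> (Cmod (lsum f L - s) < eps)%R.
(* Meaningful only when [f] is summable, see [csum_hsum]. *)
Definition csum f : C := epsilon (inhabits (RtoC 0)) (hsum f).

Lemma lsum_app f L L' : lsum f (L ++ L') = lsum f L + lsum f L'.
Proof. induction L as [|a L IH]; simpl; [|rewrite IH]; ring. Qed.
Lemma rsum_app (g : I -> R) L L' : rsum g (L ++ L') = (rsum g L + rsum g L')%R.
Proof. induction L as [|a L IH]; simpl; [|rewrite IH]; ring. Qed.
Lemma rsum_nonneg (g : I -> R) L : (forall i, 0 <= g i)%R -> (0 <= rsum g L)%R.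
Proof. intros Hg; induction L as [|a L IH]; simpl; [lra|]; specialize (Hg a); lra. Qed.
Lemma rsum_le (g h : I -> R) L : (forall i, In i L -> g i <= h i)%R -> (rsum g L <= rsum h L)%R.
Proof.
induction L as [|a L IH]; simpl; intros H; [lra|].
pose proof (H a (or_introl eq_refl)); assert (rsum g L <= rsum h L)%R by (apply IH; auto); lra.
Qed.
Lemma lsum_ext (f g : I -> C) L : (forall i, In i L -> f i = g i) -> lsum f L = lsum g L.
Proof.
induction L as [|a L IH]; simpl; intros H; [easy|].
rewrite H, IH; auto.
Qed.
Lemma lsum_zero f L : (forall i, In i L -> f i = 0) -> lsum f L = 0.
Proof.
intros H; induction L as [|a L IH]; simpl; [easy|]. rewrite H, IH; simpl; auto; try ring.
intros; apply H; simpl; auto.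
Qed.
Lemma rsum_const (c : R) L : rsum (fun _ => c) L = (INR (length L) * c)%R.
Proof. induction L as [|a L IH]; [simpl; ring|]. simpl length; rewrite S_INR; simpl; rewrite IH; ring. Qed.
Lemma lsum_plus (f g : I -> C) L : lsum (fun i => f i + g i) L = lsum f L + lsum g L.
Proof. induction L as [|a L IH]; simpl; [|rewrite IH]; ring. Qed.
Lemma lsum_scal c f L : lsum (fun i => c * f i) L = c * lsum f L.
Proof. induction L as [|a L IH]; simpl; [|rewrite IH]; ring. Qed.
Lemma rsum_scal c (g : I -> R) L : rsum (fun i => c * g i)%R L = (c * rsum g L)%R.
Proof. induction L as [|a L IH]; simpl; [|rewrite IH]; ring. Qed.
Lemma rsum_plus (g h : I -> R) L : rsum (fun i => g i + h i)%R L = (rsum g L + rsum h L)%R.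
Proof. induction L as [|a L IH]; simpl; [|rewrite IH]; ring. Qed.
Lemma Cmod_le_sub x y : (Cmod x <= Cmod y + Cmod (y - x))%R.
Proof.
replace x with (y + - (y - x)) at 1 by ring.
eapply Rle_trans; [apply Cmod_triangle|]; rewrite Cmod_opp; lra.
Qed.
Lemma Cmod_lsum f L : (Cmod (lsum f L) <= rsum (fun i => Cmod (f i)) L)%R.
Proof.
induction L as [|a L IH]; simpl; [rewrite Cmod_0; lra|].
eapply Rle_trans; [apply Cmod_triangle|]; lra.
Qed.
Lemma rsum_incl (g : I -> R) L L' : (forall i, 0 <= g i)%R -> NoDup L -> incl L L' -> (rsum g L <= rsum g L')%R.
Proof.
intros Hg HL; revert L'; induction HL as [|a L Ha HL IH]; intros L' H.
  now apply rsum_nonneg.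
destruct (in_split a L') as (l1 & l2 & ->); [apply H; simpl; auto|].
rewrite rsum_app; simpl.
enough (rsum g L <= rsum g (l1 ++ l2))%R by (rewrite rsum_app in *; lra).
apply IH; intros i Hi.
assert (In i (l1 ++ a :: l2)) by (apply H; simpl; auto).
rewrite in_app_iff in *; simpl in *; intuition congruence.
Qed.
Definition nodupc L := nodup eq_dec_of L.
Lemma NoDup_nodupc L : NoDup (nodupc L). Proof. apply NoDup_nodup. Qed.
Lemma In_nodupc L i : In i (nodupc L) <-> In i L. Proof. apply nodup_In. Qed.
Definition diffl L L' := filter (fun i => if in_dec eq_dec_of i L' then false else true) L.
Lemma In_diffl L L' i : In i (diffl L L') <-> In i L /\ ~ In i L'.
Proof. unfold diffl; rewrite filter_In; destruct in_dec; intuition discriminate. Qed.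
Lemma NoDup_diffl L L' : NoDup L -> NoDup (diffl L L').
Proof. apply NoDup_filter. Qed.
Lemma incl_nodupc_l L L' : incl L (nodupc (L ++ L')).
Proof. intros i Hi; apply In_nodupc, in_or_app; auto. Qed.
Lemma incl_nodupc_r L L' : incl L' (nodupc (L ++ L')).
Proof. intros i Hi; apply In_nodupc, in_or_app; auto. Qed.
Lemma lsum_incl f L L0 : NoDup L -> NoDup L0 -> incl L0 L -> lsum f L = lsum f L0 + lsum f (diffl L L0).
Proof.
intros HL HL0 H. rewrite <- lsum_app.
assert (HP : Permutation L (L0 ++ diffl L L0)).
{ apply NoDup_Permutation; auto.
  - apply NoDup_app; auto using NoDup_diffl. intros i; rewrite In_diffl; tauto.
  - intros i; rewrite in_app_iff, In_diffl.
    destruct (classic (In i L0)); firstorder. }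
clear -HP. induction HP; simpl; auto; [now rewrite IHHP| ring | congruence].
Qed.

Lemma hsum_unique f s s' : hsum f s -> hsum f s' -> s = s'.
Proof.
intros H H'. apply NNPP; intros Hne.
assert (Hd : (0 < Cmod (s - s'))%R).
{ apply Cmod_gt_0; intros E; apply Hne. replace s with (s - s' + s') by ring; rewrite E; ring. }
destruct (H (Cmod (s - s') / 2)%R) as [L0 H0]; [lra|].
destruct (H' (Cmod (s - s') / 2)%R) as [L1 H1]; [lra|].
specialize (H0 _ (NoDup_nodupc _) (incl_nodupc_l L0 L1)).
specialize (H1 _ (NoDup_nodupc _) (incl_nodupc_r L0 L1)).
set (S := lsum f _) in *. pose proof (Cmod_le_sub (s - s') (S - s')) as H2.
replace (S - s' - (s - s')) with (S - s) in H2 by ring. lra.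
Qed.
Lemma hsum_csum f s : hsum f s -> csum f = s.
Proof.
intros H; apply (hsum_unique f); auto. unfold csum; apply epsilon_spec; eauto.
Qed.

Lemma nonneg_tail (g : I -> R) B : (forall i, 0 <= g i)%R ->
  (forall L, NoDup L -> (rsum g L <= B)%R) ->
  exists S, (forall L, NoDup L -> (rsum g L <= S)%R) /\
  forall eps, (0 < eps)%R -> exists L0, NoDup L0 /\ forall L, NoDup L -> incl L0 L -> (S - eps < rsum g L)%R.
Proof.
intros Hg HB.
destruct (completeness (fun x => exists L, NoDup L /\ x = rsum g L)) as [S [HS1 HS2]].
- exists B; intros x (L & HL & ->); auto.
- exists 0%R, nil; split; [constructor|reflexivity].
- exists S; split; [intros L HL; apply HS1; eauto|].
  intros eps He. apply NNPP; intros Hn.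
  assert (S <= S - eps)%R; [|lra].
  apply HS2; intros x (L & HL & ->). apply Rnot_lt_le; intros Hl.
  apply Hn; exists L; split; auto; intros L' HL' Hi.
  pose proof (rsum_incl g L L' Hg HL Hi); lra.
Qed.

Lemma summable_tail f : summable f -> forall eps, (0 < eps)%R -> exists L0, NoDup L0 /\
  forall L, NoDup L -> (forall i, In i L -> ~ In i L0) -> (rsum (fun i => Cmod (f i)) L < eps)%R.
Proof.
intros [B HB] eps He.
destruct (nonneg_tail (fun i => Cmod (f i)) B) as (S & HS1 & HS2); auto using Cmod_ge_0.
destruct (HS2 eps He) as (L0 & HL0 & H).
exists L0; split; auto; intros L HL Hd.
pose proof (H L0 HL0 (incl_refl _)).
assert (NoDup (L ++ L0)) by (apply NoDup_app; auto).
pose proof (HS1 _ H1). rewrite rsum_app in H2. lra.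
Qed.

Lemma hsum_ext (f g : I -> C) s : (forall i, f i = g i) -> hsum f s -> hsum g s.
Proof. intros H; replace g with f; auto; now apply functional_extensionality. Qed.
Lemma hsum_plus (f g : I -> C) s t : hsum f s -> hsum g t -> hsum (fun i => f i + g i) (s + t).
Proof.
intros Hf Hg eps He.
destruct (Hf (eps / 2)%R) as [L0 H0]; [lra|].
destruct (Hg (eps / 2)%R) as [L1 H1]; [lra|].
exists (L0 ++ L1); intros L HL Hi.
apply incl_app_inv in Hi as [Hi0 Hi1].
specialize (H0 L HL Hi0); specialize (H1 L HL Hi1).
rewrite lsum_plus.
replace (lsum f L + lsum g L - (s + t)) with ((lsum f L - s) + (lsum g L - t)) by ring.
eapply Rle_lt_trans; [apply Cmod_triangle|]; lra.
Qed.
Lemma hsum_scal c f s : hsum f s -> hsum (fun i => c * f i) (c * s).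
Proof.
intros Hf eps He.
pose proof (Cmod_ge_0 c).
destruct (Hf (eps / (Cmod c + 1))%R) as [L0 H0]; [apply Rdiv_lt_0_compat; lra|].
exists L0; intros L HL Hi. specialize (H0 L HL Hi).
rewrite lsum_scal. replace (c * lsum f L - c * s) with (c * (lsum f L - s)) by ring.
rewrite Cmod_mult.
apply Rle_lt_trans with (Cmod c * (eps / (Cmod c + 1)))%R.
  apply Rmult_le_compat_l; lra.
replace eps with ((Cmod c + 1) * (eps / (Cmod c + 1)))%R at 2 by (field; lra).
apply Rmult_lt_compat_r; [apply Rdiv_lt_0_compat|]; lra.
Qed.
Lemma hsum_nonneg (g : I -> R) B : (forall i, 0 <= g i)%R ->
  (forall L, NoDup L -> (rsum g L <= B)%R) -> exists s, hsum (fun i => RtoC (g i)) s.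
Proof.
intros Hg HB. destruct (nonneg_tail g B Hg HB) as (S & H1 & H2).
exists (RtoC S); intros eps He. destruct (H2 eps He) as (L0 & HL0 & H).
exists L0; intros L HL Hi. specialize (H L HL Hi). specialize (H1 L HL).
replace (lsum (fun i => RtoC (g i)) L) with (RtoC (rsum g L)).
- rewrite <- RtoC_minus, Cmod_R. apply Rabs_def1; lra.
- clear; induction L; simpl; auto. now rewrite RtoC_plus, IHL.
Qed.
(** The positive and negative parts of the real and imaginary parts are dominated by the modulus,
    and nonnegative families are summed by a supremum. *)
Lemma csum_hsum f : summable f -> hsum f (csum f).
Proof.
intros [B HB].
enough (exists s, hsum f s) by (unfold csum; apply epsilon_spec; auto).
assert (P : forall g : I -> R, (forall i, 0 <= g i <= Cmod (f i))%R -> exists s, hsum (fun i => RtoC (g i)) s).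
{ intros g Hg; apply (hsum_nonneg g B); [intros; apply Hg|].
  intros L HL; eapply Rle_trans; [|apply (HB L HL)].
  apply rsum_le; intros; apply Hg. }
assert (M : forall i, (Rabs (Re (f i)) <= Cmod (f i) /\ Rabs (Im (f i)) <= Cmod (f i))%R).
{ intros i; pose proof (Rmax_Cmod (f i)).
  pose proof (Rmax_l (Rabs (fst (f i))) (Rabs (snd (f i)))).
  pose proof (Rmax_r (Rabs (fst (f i))) (Rabs (snd (f i)))).
  unfold Re, Im; lra. }
assert (B0 : forall x y, (Rabs x <= y)%R -> (0 <= Rmax 0 x <= y)%R).
{ intros x y H; split; [apply Rmax_l|]. apply Rmax_lub; pose proof (Rle_abs x); pose proof (Rabs_pos x); lra. }
destruct (P (fun i => Rmax 0 (Re (f i)))) as [s1 H1]; [intros i; apply B0, M|].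
destruct (P (fun i => Rmax 0 (- Re (f i)))) as [s2 H2]; [intros i; apply B0; rewrite Rabs_Ropp; apply M|].
destruct (P (fun i => Rmax 0 (Im (f i)))) as [s3 H3]; [intros i; apply B0, M|].
destruct (P (fun i => Rmax 0 (- Im (f i)))) as [s4 H4]; [intros i; apply B0; rewrite Rabs_Ropp; apply M|].
exists ((s1 + (-1) * s2) + Ci * (s3 + (-1) * s4)).
eapply hsum_ext; [|apply hsum_plus; [apply hsum_plus; [exact H1|apply hsum_scal; exact H2]|
  apply hsum_scal, hsum_plus; [exact H3|apply hsum_scal; exact H4]]].
intros i; simpl. destruct (f i) as [x y]; unfold Re, Im, Ci; simpl.
apply injective_projections; simpl; unfold Rmax; repeat destruct Rle_dec; lra.
Qed.

Lemma summable_le f (h : I -> C) : (forall i, Cmod (f i) <= Cmod (h i))%R -> summable h -> summable f.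
Proof.
intros H [B HB]; exists B; intros L HL. eapply Rle_trans; [|apply (HB L HL)].
apply rsum_le; auto.
Qed.
Lemma summable_plus (f g : I -> C) : summable f -> summable g -> summable (fun i => f i + g i).
Proof.
intros [B HB] [B' HB']; exists (B + B')%R; intros L HL.
eapply Rle_trans; [apply (rsum_le _ (fun i => Cmod (f i) + Cmod (g i))%R)|].
  intros; apply Cmod_triangle.
rewrite rsum_plus; specialize (HB L HL); specialize (HB' L HL); lra.
Qed.
Lemma summable_scal c f : summable f -> summable (fun i => c * f i).
Proof.
intros [B HB]; exists (Cmod c * B)%R; intros L HL.
eapply Rle_trans; [apply (rsum_le _ (fun i => Cmod c * Cmod (f i))%R)|].
  intros; rewrite Cmod_mult; lra.
rewrite rsum_scal; apply Rmult_le_compat_l; auto using Cmod_ge_0.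
Qed.
Lemma csum_plus (f g : I -> C) : summable f -> summable g -> csum (fun i => f i + g i) = csum f + csum g.
Proof. intros; apply hsum_csum, hsum_plus; now apply csum_hsum. Qed.
Lemma csum_scal c f : summable f -> csum (fun i => c * f i) = c * csum f.
Proof. intros; apply hsum_csum, hsum_scal; now apply csum_hsum. Qed.
Lemma csum_ext (f g : I -> C) : (forall i, f i = g i) -> csum f = csum g.
Proof. intros H; replace g with f; auto; now apply functional_extensionality. Qed.
Lemma summable_ext (f g : I -> C) : (forall i, f i = g i) -> summable f -> summable g.
Proof. intros H; replace g with f; auto; now apply functional_extensionality. Qed.
Lemma hsum_Cmod f s B : hsum f s ->
  (forall L, NoDup L -> (rsum (fun i => Cmod (f i)) L <= B)%R) -> (Cmod s <= B)%R.
Proof.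
intros Hs HB. apply Rnot_lt_le; intros Hl.
destruct (Hs (Cmod s - B)%R) as [L0 H]; [lra|].
specialize (H (nodupc L0) (NoDup_nodupc _) (fun i => proj2 (In_nodupc L0 i))).
pose proof (HB _ (NoDup_nodupc L0)). pose proof (Cmod_lsum f (nodupc L0)).
pose proof (Cmod_le_sub s (lsum f (nodupc L0))). lra.
Qed.
Lemma csum_Cmod f B :
  (forall L, NoDup L -> (rsum (fun i => Cmod (f i)) L <= B)%R) -> (Cmod (csum f) <= B)%R.
Proof. intros HB. apply (hsum_Cmod f); auto. apply csum_hsum; now exists B. Qed.
Lemma hsum_finite f L : NoDup L -> (forall i, ~ In i L -> f i = 0) -> hsum f (lsum f L).
Proof.
intros HL Hf eps He; exists L; intros L' HL' Hi.
rewrite (lsum_incl f L' L), (lsum_zero f (diffl L' L)); auto.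
  replace (lsum f L + 0 - lsum f L) with (RtoC 0) by ring; now rewrite Cmod_0.
intros i; rewrite In_diffl; intros []; auto.
Qed.
Lemma summable_finite f L : NoDup L -> (forall i, ~ In i L -> f i = 0) -> summable f.
Proof.
intros HL Hf; exists (rsum (fun i => Cmod (f i)) L); intros L' HL'.
apply Rle_trans with (rsum (fun i => Cmod (f i)) (filter (fun i => if in_dec eq_dec_of i L then true else false) L')).
- clear HL'; induction L' as [|a L' IH]; simpl; [lra|].
  destruct in_dec; simpl; [lra|]. rewrite Hf, Cmod_0; auto; lra.
- apply rsum_incl; auto using NoDup_filter, Cmod_ge_0.
  intros i; rewrite filter_In; destruct in_dec; intuition discriminate.
Qed.
Lemma csum_0 : csum (fun _ : I => RtoC 0) = 0.
Proof. apply hsum_csum. exact (hsum_finite _ nil (NoDup_nil _) (fun _ _ => eq_refl)). Qed.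
Lemma csum_single f k : (forall i, i <> k -> f i = 0) -> summable f /\ csum f = f k.
Proof.
intros Hf. assert (N1 : NoDup (k :: nil)) by (constructor; auto; constructor).
assert (Z : forall i, ~ In i (k :: nil) -> f i = 0) by (intros i Hi; apply Hf; intros ->; apply Hi; simpl; auto).
split; [exact (summable_finite _ _ N1 Z)|]. rewrite (hsum_csum _ _ (hsum_finite _ _ N1 Z)); simpl; ring.
Qed.
Lemma csum_partial f : summable f -> forall eps, (0 < eps)%R -> exists L0, NoDup L0 /\
  forall L, NoDup L -> incl L0 L -> (Cmod (lsum f L - csum f) < eps)%R.
Proof.
intros Hf eps He. destruct (csum_hsum f Hf eps He) as [L0 H].
exists (nodupc L0); split; [apply NoDup_nodupc|]; intros L HL Hi; apply H; auto.
intros i Hx; apply Hi, In_nodupc; auto.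
Qed.

Definition Clim (u : nat -> C) (l : C) :=
  forall eps, (0 < eps)%R -> exists N, forall n, (N <= n)%nat -> (Cmod (u n - l) < eps)%R.

(** Tannery's theorem: outside a finite list the dominating family contributes less than eps/3, to
    the terms as well as to the limit, and on the list convergence is termwise. *)
Lemma dominated_convergence (F : nat -> I -> C) f (G : I -> C) :
  summable G -> (forall n i, Cmod (F n i) <= Cmod (G i))%R ->
  (forall i, Clim (fun n => F n i) (f i)) ->
  Clim (fun n => csum (F n)) (csum f).
Proof.
intros HG HF Hl.
assert (Hf : forall i, (Cmod (f i) <= Cmod (G i))%R).
{ intros i; apply Rnot_lt_le; intros Hx.
  destruct (Hl i (Cmod (f i) - Cmod (G i))%R) as [N HN]; [lra|].
  specialize (HN N (le_n _)); specialize (HF N i).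
  pose proof (Cmod_le_sub (f i) (F N i)); lra. }
intros eps He.
destruct (summable_tail G HG (eps / 3)%R) as (L0 & HL0 & Ht); [lra|].
assert (Hu : exists N, forall n, (N <= n)%nat -> (Cmod (lsum (F n) L0 - lsum f L0) < eps / 3)%R).
{ clear Ht HL0. assert (0 < eps/3)%R by lra. revert H; generalize (eps/3)%R; clear eps He.
  induction L0 as [|a L IH]; intros eps He; simpl.
  - exists O; intros; replace (0 - 0) with (RtoC 0) by ring; now rewrite Cmod_0.
  - destruct (IH (eps/2)%R) as [N1 H1]; [lra|].
    destruct (Hl a (eps/2)%R) as [N2 H2]; [lra|].
    exists (N1 + N2)%nat; intros n Hn.
    specialize (H1 n ltac:(lia)); specialize (H2 n ltac:(lia)).
    replace (F n a + lsum (F n) L - (f a + lsum f L)) with ((F n a - f a) + (lsum (F n) L - lsum f L)) by ring.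
    eapply Rle_lt_trans; [apply Cmod_triangle|]; lra. }
assert (T : forall h : I -> C, (forall i, Cmod (h i) <= Cmod (G i))%R ->
   (Cmod (csum h - lsum h L0) <= eps / 3)%R).
{ intros h Hh.
  assert (Hs : summable h) by (eapply summable_le; eauto).
  apply Rnot_lt_le; intros Hx.
  destruct (csum_partial h Hs (Cmod (csum h - lsum h L0) - eps / 3)%R) as (L1 & HL1 & H1); [lra|].
  specialize (H1 _ (NoDup_nodupc _) (incl_nodupc_r L0 L1)).
  rewrite (lsum_incl h _ L0) in H1; auto using NoDup_nodupc, incl_nodupc_l.
  set (D := diffl _ L0) in *.
  assert (rsum (fun i => Cmod (G i)) D < eps / 3)%R.
  { apply Ht; [apply NoDup_diffl, NoDup_nodupc|]. intros i; unfold D; rewrite In_diffl; tauto. }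
  assert (Cmod (lsum h D) <= rsum (fun i => Cmod (G i)) D)%R.
  { eapply Rle_trans; [apply Cmod_lsum|]. apply rsum_le; auto. }
  pose proof (Cmod_le_sub (csum h - lsum h L0) (lsum h D)) as H2.
  replace (lsum h D - (csum h - lsum h L0)) with (lsum h L0 + lsum h D - csum h) in H2 by ring. lra. }
destruct Hu as [N HN]; exists N; intros n Hn; specialize (HN n Hn).
pose proof (T (F n) (HF n)); pose proof (T f Hf).
replace (csum (F n) - csum f) with
  ((csum (F n) - lsum (F n) L0) + ((lsum (F n) L0 - lsum f L0) + - (csum f - lsum f L0))) by ring.
eapply Rle_lt_trans; [apply Cmod_triangle|].
assert (Cmod (lsum (F n) L0 - lsum f L0 + - (csum f - lsum f L0)) <=
  Cmod (lsum (F n) L0 - lsum f L0) + Cmod (csum f - lsum f L0))%R; [|lra].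
eapply Rle_trans; [apply Cmod_triangle|]; rewrite Cmod_opp; lra.
Qed.
End Summation.

(** * Reindexing, iterated sums and sums over fibres *)

Lemma lsum_map {I J} (f : J -> C) (phi : I -> J) L : lsum f (map phi L) = lsum (fun i => f (phi i)) L.
Proof. induction L as [|a L IH]; simpl; congruence. Qed.
Lemma rsum_map {I J} (f : J -> R) (phi : I -> J) L : rsum f (map phi L) = rsum (fun i => f (phi i)) L.
Proof. induction L as [|a L IH]; simpl; congruence. Qed.

Lemma summable_inj {I J} (f : J -> C) (phi : I -> J) :
  (forall i i', phi i = phi i' -> i = i') -> summable f -> summable (fun i => f (phi i)).
Proof.
intros Hi [B HB]; exists B; intros L HL.
rewrite <- (rsum_map (fun j => Cmod (f j))). apply HB.
apply FinFun.Injective_map_NoDup; auto.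
Qed.

Section Reindex.
Context {I J : Type} (f : J -> C) (phi : I -> J).
Hypothesis phi_inj : forall i i', phi i = phi i' -> i = i'.
Hypothesis supp : forall j, (exists i, j = phi i) \/ f j = 0.

Let psi (j : J) : list I :=
  match excluded_middle_informative (exists i, j = phi i) with
  | left H => proj1_sig (constructive_indefinite_description _ H) :: nil
  | right _ => nil end.
Let psi_spec j i : In i (psi j) <-> j = phi i.
Proof.
unfold psi; destruct excluded_middle_informative as [H|H].
- destruct constructive_indefinite_description as [i0 E]; simpl; split.
  + intros [->|[]]; auto.
  + intros E'; left; apply phi_inj; congruence.
- split; [intros []|]. intros E; exfalso; eauto.
Qed.

Let pull (M : list J) := flat_map psi M.
Let in_pull M i : In i (pull M) <-> In (phi i) M.
Proof.
unfold pull; rewrite in_flat_map; split.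
- intros (j & Hj & H); apply psi_spec in H; now subst.
- intros H; exists (phi i); split; auto; now apply psi_spec.
Qed.

(** Up to vanishing terms a finite list in [J] is the image of a finite list in [I]; [psi] lists the
    at most one preimage of an index. *)
Lemma summable_reindex : summable (fun i => f (phi i)) -> summable f.
Proof.
intros [B HB]; exists B; intros M HM.
apply Rle_trans with (rsum (fun j => Cmod (f j)) (map phi (nodupc (pull M)))).
- assert (H : forall j, In j M -> f j <> 0 -> In j (map phi (nodupc (pull M)))).
  { intros j Hj Hn. destruct (supp j) as [[i ->]|]; [|easy]. apply in_map, In_nodupc, in_pull; auto. }
  revert H; generalize (map phi (nodupc (pull M))) as K; induction HM as [|a M Ha HM IH]; intros K H.
    apply rsum_nonneg; intros; apply Cmod_ge_0.
  simpl. destruct (classic (f a = 0)) as [E|E].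
  + rewrite E, Cmod_0, Rplus_0_l; apply IH; intros; apply H; simpl; auto.
  + destruct (in_split a K) as (k1 & k2 & ->); [apply H; simpl; auto|].
    assert (rsum (fun j => Cmod (f j)) M <= rsum (fun j => Cmod (f j)) (k1 ++ k2))%R.
    { apply IH; intros j Hj Hn. specialize (H j (or_intror Hj) Hn).
      rewrite in_app_iff in *; simpl in *; intuition congruence. }
    rewrite rsum_app in *; simpl; lra.
- rewrite rsum_map; apply HB, NoDup_nodupc.
Qed.

Lemma hsum_reindex s : hsum f s -> hsum (fun i => f (phi i)) s.
Proof.
intros Hs eps He; destruct (Hs eps He) as [M0 H0].
exists (pull M0); intros L HL Hi.
pose (K := map phi L ++ diffl (nodupc M0) (map phi L)).
assert (HK : NoDup K).
{ apply NoDup_app.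
  - apply FinFun.Injective_map_NoDup; auto.
  - apply NoDup_diffl, NoDup_nodupc.
  - intros j Hj; rewrite In_diffl; tauto. }
specialize (H0 K HK). unfold K in H0; rewrite lsum_app, (lsum_zero f (diffl _ _)), lsum_map in H0.
- rewrite Cplus_0_r in H0; apply H0.
  intros j Hj. rewrite in_app_iff, In_diffl, In_nodupc. destruct (classic (In j (map phi L))); auto.
- intros j; rewrite In_diffl, In_nodupc; intros [H1 H2].
  destruct (supp j) as [[i ->]|]; auto. exfalso; apply H2, in_map, Hi, in_pull; auto.
Qed.

Lemma csum_reindex : summable (fun i => f (phi i)) -> csum (fun i => f (phi i)) = csum f.
Proof. intros H; apply hsum_csum, hsum_reindex, csum_hsum, summable_reindex, H. Qed.
End Reindex.

Lemma NoDup_list_prod {I J} (L : list I) (K : list J) : NoDup L -> NoDup K -> NoDup (list_prod L K).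
Proof.
intros HL HK; induction HL as [|a L Ha HL IH]; simpl; [constructor|].
apply NoDup_app; auto.
- apply FinFun.Injective_map_NoDup; auto. intros ? ? E; now inversion E.
- intros p Hp Hp'. apply in_map_iff in Hp as (b & <- & _). apply in_prod_iff in Hp'; tauto.
Qed.

Section Fubini.
Context {I J : Type} (f : I * J -> C) (Hf : summable f).
Let fr i := csum (fun j => f (i, j)).

Lemma summable_row i : summable (fun j => f (i, j)).
Proof. apply (summable_inj f (fun j => (i, j))); auto. intros ? ? E; now inversion E. Qed.

Let lsum_prod L K : lsum f (list_prod L K) = lsum (fun i => lsum (fun j => f (i, j)) K) L.
Proof. induction L as [|a L IH]; simpl; auto. now rewrite lsum_app, lsum_map, IH. Qed.
Let rsum_prod (g : I * J -> R) L K : rsum g (list_prod L K) = rsum (fun i => rsum (fun j => g (i, j)) K) L.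
Proof. induction L as [|a L IH]; simpl; auto. now rewrite rsum_app, rsum_map, IH. Qed.

Let rows_close L eps : (0 < eps)%R -> exists K0, NoDup K0 /\ forall K, NoDup K -> incl K0 K ->
  (rsum (fun i => Cmod (lsum (fun j => f (i, j)) K - fr i)) L < eps)%R.
Proof.
revert eps; induction L as [|a L IH]; intros eps He.
  exists nil; split; [constructor|]; simpl; auto.
destruct (IH (eps/2)%R) as (K1 & HK1 & H1); [lra|].
destruct (csum_partial _ (summable_row a) (eps/2)%R) as (K2 & HK2 & H2); [lra|].
exists (nodupc (K1 ++ K2)); split; [apply NoDup_nodupc|]; intros K HK Hi; simpl.
specialize (H1 K HK (incl_tran (incl_nodupc_l _ _) Hi)).
specialize (H2 K HK (incl_tran (incl_nodupc_r _ _) Hi)). unfold fr at 1; lra.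
Qed.

Lemma summable_csum_row : summable fr.
Proof.
(* Truncating the rows to a finite [K] changes them by a total of less than 1, hence the bound
   [B + 1]. *)
destruct Hf as [B HB]; exists (B + 1)%R; intros L HL.
destruct (rows_close L 1%R) as (K & HK & H); [lra|]. specialize (H K HK (incl_refl _)).
specialize (HB _ (NoDup_list_prod L K HL HK)). rewrite rsum_prod in HB.
enough (rsum (fun i => Cmod (fr i)) L <= rsum (fun i => rsum (fun j => Cmod (f (i, j))) K) L +
  rsum (fun i => Cmod (lsum (fun j => f (i, j)) K - fr i)) L)%R by lra.
rewrite <- rsum_plus; apply rsum_le; intros i _.
pose proof (Cmod_lsum (fun j => f (i, j)) K).
pose proof (Cmod_le_sub (fr i) (lsum (fun j => f (i, j)) K)); lra.
Qed.

(** A finite rectangle is chosen that contains all significant pairs and is wide enough for its rows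
    to be close to the full row sums, with small total error. *)
Lemma csum_fubini : csum fr = csum f.
Proof.
apply hsum_csum; intros eps He.
destruct (csum_partial f Hf (eps/2)%R) as (P0 & HP0 & H0); [lra|].
exists (map fst P0); intros L HL Hi.
destruct (rows_close L (eps/2)%R) as (K0 & HK0 & HK); [lra|].
pose (K := nodupc (K0 ++ map snd P0)).
specialize (HK K (NoDup_nodupc _) (incl_nodupc_l _ _)).
specialize (H0 (list_prod L K) (NoDup_list_prod L K HL (NoDup_nodupc _))).
assert (incl P0 (list_prod L K)).
{ intros [i j] Hx; apply in_prod; [apply Hi; now apply (in_map fst _ (i, j))|].
  apply incl_nodupc_r; now apply (in_map snd _ (i, j)). }
specialize (H0 H). rewrite lsum_prod in H0.
set (S := lsum (fun i => lsum (fun j => f (i, j)) K) L) in *.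
assert (Cmod (S - lsum fr L) < eps/2)%R.
{ eapply Rle_lt_trans; [|exact HK].
  replace (S - lsum fr L) with (lsum (fun i => lsum (fun j => f (i, j)) K + (-1) * fr i) L).
  - eapply Rle_trans; [apply Cmod_lsum|]. apply rsum_le; intros i _. right; f_equal; ring.
  - rewrite lsum_plus, lsum_scal; unfold S; ring. }
pose proof (Cmod_le_sub (lsum fr L - csum f) (S - csum f)) as H2.
replace (S - csum f - (lsum fr L - csum f)) with (S - lsum fr L) in H2 by ring. lra.
Qed.
End Fubini.

Lemma summable_mult {I J} (f : I -> C) (g : J -> C) :
  summable f -> summable g -> summable (fun p => f (fst p) * g (snd p)).
Proof.
intros [B HB] [B' HB'].
assert (H0 : (0 <= B)%R) by (apply (HB nil); constructor).
assert (H0' : (0 <= B')%R) by (apply (HB' nil); constructor).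
exists (B * B')%R; intros L HL.
pose (L1 := nodupc (map fst L)); pose (L2 := nodupc (map snd L)).
apply Rle_trans with (rsum (fun p => Cmod (f (fst p) * g (snd p))) (list_prod L1 L2)).
- apply rsum_incl; auto; [intros; apply Cmod_ge_0|].
  intros [i j] Hx; apply in_prod; apply In_nodupc; [now apply (in_map fst _ (i, j))|now apply (in_map snd _ (i, j))].
- assert (HL1 := HB L1 (NoDup_nodupc _)). assert (HL2 := HB' L2 (NoDup_nodupc _)).
  replace (rsum _ (list_prod L1 L2)) with (rsum (fun i => Cmod (f i)) L1 * rsum (fun j => Cmod (g j)) L2)%R.
  + apply Rmult_le_compat; auto; apply rsum_nonneg; intros; apply Cmod_ge_0.
  + generalize L1 as l1; generalize L2 as l2; clear; intros l2 l1.
    induction l1 as [|a l1 IH]; simpl; [ring|].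
    rewrite rsum_app, rsum_map, <- IH; simpl.
    rewrite Rmult_plus_distr_r; f_equal.
    rewrite <- rsum_scal. f_equal; apply functional_extensionality; intros; now rewrite Cmod_mult.
Qed.
Lemma csum_mult {I J} (f : I -> C) (g : J -> C) : summable f -> summable g ->
  csum (fun p => f (fst p) * g (snd p)) = csum f * csum g.
Proof.
intros Hf Hg. rewrite <- (csum_fubini _ (summable_mult f g Hf Hg)); simpl.
rewrite (csum_ext _ (fun i => csum g * f i)).
- rewrite csum_scal; auto; ring.
- intros i; rewrite csum_scal; auto; ring.
Qed.

Lemma csum_split {I J K} (f : I -> C) (phi : J -> I) (psi : K -> I) :
  (forall j j', phi j = phi j' -> j = j') -> (forall k k', psi k = psi k' -> k = k') ->
  (forall j k, phi j <> psi k) -> (forall i, (exists j, i = phi j) \/ exists k, i = psi k) -> summable f ->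
  csum f = csum (fun j => f (phi j)) + csum (fun k => f (psi k)).
Proof.
intros Hphi Hpsi Hd Hc Hf.
pose (on := fun (P : I -> Prop) i => if excluded_middle_informative (P i) then f i else 0).
pose (P := fun i => exists j, i = phi j). pose (Q := fun i => ~ P i).
assert (Hs : forall R, summable (on R)).
{ intros R. apply (summable_le _ f); auto. intros i; unfold on.
  destruct excluded_middle_informative; rewrite ?Cmod_0; [lra|apply Cmod_ge_0]. }
rewrite (csum_ext f (fun i => on P i + on Q i)), csum_plus by (auto; intros i; unfold on, Q;
  do 2 destruct excluded_middle_informative; tauto || ring).
f_equal.
- rewrite <- (csum_reindex (on P) phi); auto using summable_inj.
  + apply csum_ext; intros j; unfold on. destruct excluded_middle_informative as [|H]; auto. exfalso; apply H; exists j; auto.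
  + intros i; unfold on. destruct excluded_middle_informative; auto.
- rewrite <- (csum_reindex (on Q) psi); auto using summable_inj.
  + apply csum_ext; intros k; unfold on. destruct excluded_middle_informative as [|H]; auto.
    exfalso; apply H; intros [j E]. now apply (Hd j k).
  + intros i; unfold on. destruct excluded_middle_informative as [H|]; auto. destruct (Hc i); auto. contradiction.
Qed.

Section Fibres.
Context {I K : Type} (pi : I -> K) (f : I -> C) (Hf : summable f).
(** Extension by zero places the graph of [pi] inside the product of [K] and [I], so that grouping
    by fibres is an instance of Fubini. It serves for Cauchy products and for collecting equal
    powers in theta series. *)
Definition on_fibre (k : K) (i : I) : C := if excluded_middle_informative (pi i = k) then f i else 0.
Let F (p : K * I) := on_fibre (fst p) (snd p).
Let HF : summable F.
Proof.
apply (summable_reindex F (fun i => (pi i, i))).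
- intros ? ? E; now inversion E.
- intros [k i]; unfold F, on_fibre; simpl. destruct excluded_middle_informative as [<-|]; eauto.
- apply (summable_ext f); auto. intros i; unfold F, on_fibre; simpl.
  destruct excluded_middle_informative; easy.
Qed.
Lemma summable_fibres : summable (fun k => csum (on_fibre k)).
Proof. exact (summable_csum_row F HF). Qed.
Lemma csum_fibres : csum (fun k => csum (on_fibre k)) = csum f.
Proof.
transitivity (csum F); [exact (csum_fubini F HF)|].
symmetry; etransitivity; [|apply (csum_reindex F (fun i => (pi i, i)))].
- apply csum_ext; intros i; unfold F, on_fibre; simpl; destruct excluded_middle_informative; easy.
- intros ? ? E; now inversion E.
- intros [k i]; unfold F, on_fibre; simpl. destruct excluded_middle_informative as [<-|]; eauto.
- apply (summable_ext f); auto. intros i; unfold F, on_fibre; simpl.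
  destruct excluded_middle_informative; easy.
Qed.
End Fibres.

(** * Theta series *)

Definition cexp (z : C) : C := RtoC (exp (Re z)) * (cos (Im z), sin (Im z)).

Lemma cexp_plus z w : cexp (z + w) = cexp z * cexp w.
Proof.
unfold cexp; destruct z as [a b], w as [c d]; unfold Re, Im; simpl.
rewrite exp_plus, cos_plus, sin_plus.
apply injective_projections; simpl; ring.
Qed.
Lemma cexp_0 : cexp 0 = 1.
Proof. unfold cexp; simpl; rewrite exp_0, cos_0, sin_0; apply injective_projections; simpl; ring. Qed.
Lemma Cmod_cexp z : Cmod (cexp z) = exp (Re z).
Proof.
unfold cexp; rewrite Cmod_mult, Cmod_R, Rabs_pos_eq by (left; apply exp_pos).
replace (Cmod (cos (Im z), sin (Im z))) with 1%R; [ring|].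
unfold Cmod; simpl fst; simpl snd. rewrite <- sqrt_1; f_equal.
pose proof (sin2_cos2 (Im z)); unfold Rsqr in *; lra.
Qed.
Lemma cexp_neq0 z : cexp z <> 0.
Proof. apply Cmod_gt_0; rewrite Cmod_cexp; apply exp_pos. Qed.
Lemma cexp_opp z : cexp (- z) = / cexp z.
Proof.
rewrite <- (Cmult_1_l (/ cexp z)), <- cexp_0. replace (RtoC 0) with (- z + z) by ring.
rewrite cexp_plus; field; apply cexp_neq0.
Qed.
Lemma cexp_nat n z : cexp (RtoC (INR n) * z) = cexp z ^ n.
Proof.
induction n as [|n IH]; [simpl INR; rewrite Cmult_0_l; apply cexp_0|].
rewrite S_INR, RtoC_plus, Cpow_S, <- IH, <- cexp_plus; f_equal; ring.
Qed.
Definition PiI : C := RtoC PI * Ci.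
Lemma cexp_PiI : cexp PiI = - (1).
Proof.
unfold cexp, PiI; apply injective_projections; simpl;
 replace (PI * 0 - 0 * 1)%R with 0%R by ring; replace (PI * 1 + 0 * 0)%R with PI by ring;
 rewrite exp_0, cos_PI, sin_PI; ring.
Qed.
Lemma cexp_2PiI : cexp (2 * PiI) = 1.
Proof. replace (2 * PiI) with (PiI + PiI) by ring. rewrite cexp_plus, cexp_PiI; ring. Qed.
Lemma cexp_Z n z : cexp z = 1 -> cexp (RtoC (IZR n) * z) = 1.
Proof.
intros Hz. assert (P : forall p : nat, cexp (RtoC (INR p) * z) = 1).
{ intros p; rewrite cexp_nat, Hz; apply Cpow_1_l. }
destruct n as [|p|p].
- rewrite Cmult_0_l; apply cexp_0.
- rewrite <- (positive_nat_Z p), <- INR_IZR_INZ; apply P.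
- rewrite <- Pos2Z.opp_pos, opp_IZR, RtoC_opp, <- (positive_nat_Z p), <- INR_IZR_INZ.
  replace (- INR (Pos.to_nat p) * z) with (- (INR (Pos.to_nat p) * z)) by ring.
  rewrite cexp_opp, P; field; apply C1_nz.
Qed.
Lemma cexp_period n z : cexp (z + RtoC (IZR n) * (2 * PiI)) = cexp z.
Proof. rewrite cexp_plus, cexp_Z; [ring | apply cexp_2PiI]. Qed.

Lemma Re_plus z w : Re (z + w) = (Re z + Re w)%R. Proof. reflexivity. Qed.
Lemma Im_plus z w : Im (z + w) = (Im z + Im w)%R. Proof. reflexivity. Qed.
Lemma Re_minus z w : Re (z - w) = (Re z - Re w)%R. Proof. reflexivity. Qed.

(** * Geometric series and limits of sequences *)

Lemma rsum_seq_geom r N : (0 <= r < 1)%R -> (rsum (fun k => r ^ k) (seq 0 N) <= / (1 - r))%R.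
Proof.
intros Hr.
assert (E : forall N s, (rsum (fun k => r ^ k) (seq s N) * (1 - r) = r ^ s - r ^ (s + N))%R).
{ clear N; induction N as [|N IH]; intros s; simpl; [rewrite Nat.add_0_r; ring|].
  rewrite Rmult_plus_distr_r, IH. replace (s + S N)%nat with (S s + N)%nat by lia. simpl; ring. }
apply (Rmult_le_reg_r (1 - r)); [lra|]. rewrite E, Rinv_l by lra. simpl.
pose proof (pow_le r N ltac:(lra)); lra.
Qed.
Lemma incl_seq (L : list nat) : exists N, incl L (seq 0 N).
Proof.
exists (S (list_max L)); intros i Hi. apply in_seq; split; [intros; lia|]. simpl.
pose proof (proj1 (list_max_le L (list_max L)) (le_n _)) as H.
rewrite Forall_forall in H; specialize (H i Hi); lia.
Qed.
Lemma summable_nat_bound (f : nat -> C) B :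
  (forall N, rsum (fun k => Cmod (f k)) (seq 0 N) <= B)%R -> 
  forall L, NoDup L -> (rsum (fun k => Cmod (f k)) L <= B)%R.
Proof.
intros H L HL; destruct (incl_seq L) as [N HN].
eapply Rle_trans; [|apply (H N)]. apply rsum_incl; auto; intros; apply Cmod_ge_0.
Qed.
Lemma geom_bound x : (Cmod x < 1)%R ->
  forall L, NoDup L -> (rsum (fun k => Cmod (x ^ k)) L <= / (1 - Cmod x))%R.
Proof.
intros Hx; apply summable_nat_bound; intros N.
eapply Rle_trans; [|apply (rsum_seq_geom (Cmod x) N)]; [|split; auto; apply Cmod_ge_0].
apply rsum_le; intros; rewrite Cmod_pow; lra.
Qed.
Lemma summable_geom x : (Cmod x < 1)%R -> summable (fun k => x ^ k).
Proof. intros Hx; eexists; apply (geom_bound x Hx). Qed.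
Lemma csum_nat_lim (f : nat -> C) : summable f -> Clim (fun N => lsum f (seq 0 N)) (csum f).
Proof.
intros Hf eps He. destruct (csum_partial f Hf eps He) as (L0 & _ & H).
destruct (incl_seq L0) as [N HN]. exists N; intros n Hn. apply H; [apply seq_NoDup|].
intros i Hi. apply HN in Hi. apply in_seq in Hi; apply in_seq; lia.
Qed.
Lemma Clim_unique u l l' : Clim u l -> Clim u l' -> l = l'.
Proof.
intros H H'; apply NNPP; intros Hne.
assert (Hd : (0 < Cmod (l - l'))%R).
{ apply Cmod_gt_0; intros E; apply Hne. replace l with (l - l' + l') by ring; rewrite E; ring. }
destruct (H (Cmod (l - l') / 2)%R) as [N1 H1]; [lra|].
destruct (H' (Cmod (l - l') / 2)%R) as [N2 H2]; [lra|].
specialize (H1 (N1 + N2)%nat ltac:(lia)); specialize (H2 (N1 + N2)%nat ltac:(lia)).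
set (x := u _) in *. pose proof (Cmod_le_sub (l - l') (x - l')) as H3.
replace (x - l' - (l - l')) with (x - l) in H3 by ring. lra.
Qed.
Lemma Clim_plus u v l m : Clim u l -> Clim v m -> Clim (fun n => u n + v n) (l + m).
Proof.
intros H H' eps He.
destruct (H (eps / 2)%R) as [N1 H1]; [lra|].
destruct (H' (eps / 2)%R) as [N2 H2]; [lra|].
exists (N1 + N2)%nat; intros n Hn.
specialize (H1 n ltac:(lia)); specialize (H2 n ltac:(lia)).
replace (u n + v n - (l + m)) with ((u n - l) + (v n - m)) by ring.
eapply Rle_lt_trans; [apply Cmod_triangle|]; lra.
Qed.
Lemma Clim_const c : Clim (fun _ => c) c.
Proof. intros eps He; exists O; intros; replace (c - c) with (RtoC 0) by ring; now rewrite Cmod_0. Qed.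
Lemma Clim_scal c u l : Clim u l -> Clim (fun n => c * u n) (c * l).
Proof.
intros H eps He. pose proof (Cmod_ge_0 c).
destruct (H (eps / (Cmod c + 1))%R) as [N HN]; [apply Rdiv_lt_0_compat; lra|].
exists N; intros n Hn; specialize (HN n Hn).
replace (c * u n - c * l) with (c * (u n - l)) by ring. rewrite Cmod_mult.
apply Rle_lt_trans with (Cmod c * (eps / (Cmod c + 1)))%R; [apply Rmult_le_compat_l; lra|].
replace eps with ((Cmod c + 1) * (eps / (Cmod c + 1)))%R at 2 by (field; lra).
apply Rmult_lt_compat_r; [apply Rdiv_lt_0_compat|]; lra.
Qed.
Lemma Clim_bounded u l : Clim u l -> exists B, forall n, (Cmod (u n) <= B)%R.
Proof.
intros H; destruct (H 1%R) as [N HN]; [lra|].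
assert (E : exists B, forall n, (n < N)%nat -> (Cmod (u n) <= B)%R).
{ clear HN; induction N as [|N [B HB]]; [exists 0%R; lia|].
  exists (Rmax B (Cmod (u N))); intros n Hn.
  destruct (Nat.eq_dec n N) as [->|]; [apply Rmax_r|].
  eapply Rle_trans; [apply HB; lia|apply Rmax_l]. }
destruct E as [B HB]. exists (Rmax B (Cmod l + 1)); intros n.
destruct (lt_dec n N) as [Hn|Hn]; [eapply Rle_trans; [now apply HB|apply Rmax_l]|].
eapply Rle_trans; [|apply Rmax_r]. specialize (HN n ltac:(lia)).
replace (u n) with ((u n - l) + l) by ring. eapply Rle_trans; [apply Cmod_triangle|]; lra.
Qed.
Lemma Clim_mult u v l m : Clim u l -> Clim v m -> Clim (fun n => u n * v n) (l * m).
Proof.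
intros H H'. destruct (Clim_bounded v m H') as [B HB].
intros eps He. pose proof (Cmod_ge_0 l).
assert (HB0 : (0 <= B)%R) by (eapply Rle_trans; [apply Cmod_ge_0|apply (HB O)]).
destruct (H (eps / 2 / (B + 1))%R) as [N1 H1]; [apply Rdiv_lt_0_compat; lra|].
destruct (H' (eps / 2 / (Cmod l + 1))%R) as [N2 H2]; [apply Rdiv_lt_0_compat; lra|].
exists (N1 + N2)%nat; intros n Hn.
specialize (H1 n ltac:(lia)); specialize (H2 n ltac:(lia)).
replace (u n * v n - l * m) with ((u n - l) * v n + l * (v n - m)) by ring.
eapply Rle_lt_trans; [apply Cmod_triangle|]; rewrite !Cmod_mult.
assert (Cmod (u n - l) * Cmod (v n) < eps / 2)%R.
{ apply Rle_lt_trans with (Cmod (u n - l) * B)%R; [apply Rmult_le_compat_l; auto using Cmod_ge_0|].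
  apply Rle_lt_trans with (eps / 2 / (B + 1) * B)%R; [apply Rmult_le_compat_r; lra|].
  replace (eps / 2)%R with (eps / 2 / (B + 1) * (B + 1))%R at 2 by (field; lra).
  apply Rmult_lt_compat_l; [apply Rdiv_lt_0_compat|]; lra. }
assert (Cmod l * Cmod (v n - m) <= eps / 2)%R; [|lra].
apply Rle_trans with (Cmod l * (eps / 2 / (Cmod l + 1)))%R; [apply Rmult_le_compat_l; lra|].
replace (eps / 2)%R with ((Cmod l + 1) * (eps / 2 / (Cmod l + 1)))%R at 2 by (field; lra).
apply Rmult_le_compat_r; [left; apply Rdiv_lt_0_compat|]; lra.
Qed.
Lemma Clim_ext u v l : (forall n, u n = v n) -> Clim u l -> Clim v l.
Proof. intros H; replace v with u; auto; now apply functional_extensionality. Qed.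
Lemma Clim_sub (phi : nat -> nat) u l : (forall n, (n <= phi n)%nat) -> Clim u l -> Clim (fun n => u (phi n)) l.
Proof.
intros Hp H eps He; destruct (H eps He) as [N HN]; exists N; intros n Hn; apply HN.
specialize (Hp n); lia.
Qed.
Lemma Clim_pow0 x : (Cmod x < 1)%R -> Clim (fun n => x ^ n) 0.
Proof.
intros Hx eps He.
destruct (pow_lt_1_zero (Cmod x)) with (y := eps) as [N HN]; auto.
  rewrite Rabs_pos_eq; auto using Cmod_ge_0.
exists N; intros n Hn. replace (x ^ n - 0) with (x ^ n) by ring.
specialize (HN n Hn). rewrite Rabs_pos_eq in HN; [|apply pow_le, Cmod_ge_0]. now rewrite Cmod_pow.
Qed.
Lemma Cmult_cancel_r (c a b : C) : c <> 0 -> a * c = b * c -> a = b.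
Proof.
intros Hc H. transitivity (a * c * / c); [field; auto|]. rewrite H; field; auto.
Qed.
Lemma lsum_geom z N : (z - 1) * lsum (fun i => z ^ i) (seq 0 N) = z ^ N - 1.
Proof.
induction N as [|N IH]; [simpl; ring|]. rewrite seq_S, lsum_app, Cmult_plus_distr_l, IH. simpl; ring.
Qed.
Lemma csum_geom x : (Cmod x < 1)%R -> csum (fun k => x ^ k) = / (1 - x).
Proof.
intros Hx.
assert (H1x : 1 - x <> 0).
{ intros E. assert (x = 1) by (replace x with (1 - (1 - x)) by ring; rewrite E; ring).
  subst x; rewrite Cmod_1 in Hx; lra. }
apply (Clim_unique (fun N => lsum (fun k => x ^ k) (seq 0 N))); [apply csum_nat_lim, summable_geom, Hx|].
apply (Clim_ext (fun N => / (1 - x) + (- / (1 - x)) * x ^ N)).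
- intros N. apply (Cmult_cancel_r (1 - x)); auto.
  transitivity (- (x ^ N - 1)); [field; auto|]. rewrite <- lsum_geom; ring.
- enough (Clim (fun N => / (1 - x) + - / (1 - x) * x ^ N) (/ (1 - x) + (- / (1 - x)) * 0))
    by (rewrite Cmult_0_r, Cplus_0_r in H; exact H).
  apply Clim_plus; [apply Clim_const|]. apply Clim_scal, Clim_pow0, Hx.
Qed.

Lemma summable_Z (f : Z -> C) : summable (fun n => f (Z.of_nat n)) ->
  summable (fun n => f (- 1 - Z.of_nat n)%Z) -> summable f.
Proof.
intros H1 H2.
apply (summable_ext (fun n => (if Z_le_dec 0 n then f n else 0) + (if Z_le_dec 0 n then RtoC 0 else f n))).
  intros n; destruct Z_le_dec; ring.
apply summable_plus.
- apply (summable_reindex _ Z.of_nat); [intros; lia| |].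
  + intros j; destruct (Z_le_dec 0 j); auto. left; exists (Z.to_nat j); lia.
  + eapply summable_ext; [|exact H1]. intros i; cbv beta; destruct Z_le_dec; auto; lia.
- apply (summable_reindex _ (fun n => -1 - Z.of_nat n)%Z); [intros; lia| |].
  + intros j; destruct (Z_le_dec 0 j); auto. left; exists (Z.to_nat (-1-j)); lia.
  + eapply summable_ext; [|exact H2]. intros i; cbv beta; destruct Z_le_dec; auto; lia.
Qed.
Lemma exp_nat n x : exp (INR n * x) = (exp x ^ n)%R.
Proof.
induction n as [|n IH]; [simpl; now rewrite Rmult_0_l, exp_0|].
rewrite S_INR, Rmult_plus_distr_r, exp_plus, IH, Rmult_1_l; simpl; ring.
Qed.
Lemma exp_neg1_lt1 : (0 < exp (-1) < 1)%R.
Proof. split; [apply exp_pos|]. rewrite <- exp_0; apply exp_increasing; lra. Qed.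
Lemma summable_exp_abs : summable (fun n : Z => RtoC (exp (- Rabs (IZR n)))).
Proof.
assert (G : summable (fun k : nat => (RtoC (exp (-1))) ^ k)).
{ apply summable_geom; rewrite Cmod_R, Rabs_pos_eq; apply exp_neg1_lt1 || left; apply exp_neg1_lt1. }
apply summable_Z; eapply summable_le; try apply G; intros n; cbv beta; rewrite <- RtoC_pow, <- exp_nat;
 rewrite !Cmod_R, !(Rabs_pos_eq (exp _)) by (left; apply exp_pos).
- rewrite Rabs_pos_eq, INR_IZR_INZ; [|apply IZR_le; lia]. right; f_equal; ring.
- rewrite minus_IZR, Rabs_left1, INR_IZR_INZ.
  + destruct (Rle_lt_or_eq_dec (- - (-1 - IZR (Z.of_nat n))) (IZR (Z.of_nat n) * -1)) as [H| ->]; [lra| |lra].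
    left; apply exp_increasing; lra.
  + pose proof (IZR_le 0 (Z.of_nat n) ltac:(lia)); lra.
Qed.

(** The general term of Jacobi's theta series with nome e^A and variable e^B. The logarithms are the
    parameters, so that fractional powers of the nome need no choice of branch. *)
Definition thterm (A B : C) (n : Z) : C := cexp (RtoC (IZR n * IZR n) * A + RtoC (IZR n) * B).
Definition Theta (A B : C) : C := csum (thterm A B).

Lemma Re_scal_R (r : R) z : Re (RtoC r * z) = (r * Re z)%R.
Proof. destruct z; unfold Re; simpl; ring. Qed.
Lemma Im_scal_R (r : R) z : Im (RtoC r * z) = (r * Im z)%R.
Proof. destruct z; unfold Im; simpl; ring. Qed.
Definition chi (x : R) : C := cexp (RtoC x * (2 * PiI)).
Lemma chi_add x y : chi (x + y) = chi x * chi y.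
Proof. unfold chi. rewrite <- cexp_plus, RtoC_plus. f_equal; ring. Qed.
Lemma chi_IZR n : chi (IZR n) = 1.
Proof. apply cexp_Z, cexp_2PiI. Qed.
Lemma Cmod_chi x : Cmod (chi x) = 1%R.
Proof. unfold chi. rewrite Cmod_cexp, Re_scal_R. unfold PiI; simpl. rewrite <- exp_0; f_equal; ring. Qed.
Lemma chi_pow x n : chi x ^ n = chi (INR n * x).
Proof. unfold chi. rewrite <- cexp_nat, RtoC_mult. f_equal; ring. Qed.

(** Completing the square in |t|. The extra 1 in [Rabs b + 1] leaves -|t| over, so that Gaussian
    terms are dominated by [exp (- Rabs t)]. *)
Lemma gauss_le a b t : (a < 0)%R -> (t * t * a + t * b <= - Rabs t + (Rabs b + 1) * (Rabs b + 1) / (-4 * a))%R.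
Proof.
intros Ha.
assert (H1 : (t * b <= Rabs t * Rabs b)%R) by (rewrite <- Rabs_mult; apply Rle_abs).
assert (H2 : (t * t = Rabs t * Rabs t)%R) by (rewrite <- Rabs_mult, Rabs_pos_eq; auto; nra).
set (u := Rabs t) in *; set (v := Rabs b) in *.
assert (H : (0 <= (2 * a * u + (v + 1)) * (2 * a * u + (v + 1)) / (-4 * a))%R) by (apply Rdiv_le_0_compat; [apply Rle_0_sqr|lra]).
replace ((2 * a * u + (v + 1)) * (2 * a * u + (v + 1)) / (-4 * a))%R
  with (- (u * u * a) - u * (v + 1) + (v + 1) * (v + 1) / (-4 * a))%R in H by (field; lra).
set (W := ((v + 1) * (v + 1) / (-4 * a))%R) in *; clearbody W. rewrite H2. nra.
Qed.
Lemma summable_thterm A B : (Re A < 0)%R -> summable (thterm A B).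
Proof.
intros HA.
pose (K := ((Rabs (Re B) + 1) * (Rabs (Re B) + 1) / (-4 * Re A))%R).
apply (summable_le _ (fun n => RtoC (exp K) * RtoC (exp (- Rabs (IZR n))))).
- intros n. unfold thterm; rewrite Cmod_cexp, Cmod_mult, !Cmod_R, !(Rabs_pos_eq (exp _)) by (left; apply exp_pos).
  rewrite <- exp_plus, Re_plus, !Re_scal_R.
  pose proof (gauss_le (Re A) (Re B) (IZR n) HA) as H.
  fold K in H.
  destruct (Rle_lt_or_eq_dec _ _ H) as [H'|H'].
  + left; apply exp_increasing; lra.
  + rewrite H'; right; f_equal; ring.
- apply summable_scal, summable_exp_abs.
Qed.

Lemma Theta_even A B : (Re A < 0)%R -> Theta A (- B) = Theta A B.
Proof.
intros HA; unfold Theta.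
rewrite <- (csum_reindex (thterm A B) Z.opp).
- apply csum_ext; intros n; unfold thterm; rewrite opp_IZR; f_equal.
  rewrite !RtoC_mult, RtoC_opp; ring.
- intros; lia.
- intros j; left; exists (- j)%Z; lia.
- apply (summable_inj (thterm A B) Z.opp); [intros; lia|]. now apply summable_thterm.
Qed.
Lemma Theta_shift A B : (Re A < 0)%R -> Theta A B = cexp (A + B) * Theta A (B + 2 * A).
Proof.
intros HA; unfold Theta.
rewrite <- (csum_reindex (thterm A B) (fun n => n + 1)%Z).
- rewrite <- csum_scal by now apply summable_thterm.
  apply csum_ext; intros n; unfold thterm; rewrite <- cexp_plus; f_equal.
  rewrite plus_IZR, !RtoC_mult, !RtoC_plus; ring.
- intros; lia.
- intros j; left; exists (j - 1)%Z; lia.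
- apply (summable_inj (thterm A B) (fun n => n + 1)%Z); [intros; lia|]. now apply summable_thterm.
Qed.
Lemma Theta_period A B : Theta A (B + 2 * PiI) = Theta A B.
Proof.
unfold Theta; apply csum_ext; intros n; unfold thterm.
rewrite <- (cexp_period n (_ + _ * B)); f_equal; ring.
Qed.
(** Since n^2 and n have the same parity, adding pi i to [A] or to [B] changes the sign of the same
    terms. *)
Lemma Theta_APi A B : Theta (A + PiI) B = Theta A (B + PiI).
Proof.
unfold Theta; apply csum_ext; intros n; unfold thterm.
destruct (Z.Even_or_Odd (n * n - n)) as [[k Hk]|[k Hk]].
2:{ exfalso. destruct (Z.Even_or_Odd n) as [[m ->]|[m ->]]; lia. }
rewrite <- (cexp_period k (_ + _ * (B + PiI))); f_equal.
assert (E : (IZR n * IZR n = IZR n + 2 * IZR k)%R).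
{ apply (f_equal IZR) in Hk. rewrite minus_IZR, !mult_IZR in Hk; lra. }
rewrite E, !RtoC_plus, !RtoC_mult; ring.
Qed.

(** The substitution (n, m) = (r + s, r - s) or (r + s + 1, r - s), according to the parity of n +
    m, diagonalises n^2 + m^2. The addition, duplication and Landen formulas below are instances,
    combined with shifts and periods. *)
Lemma Theta_mult A B B' : (Re A < 0)%R ->
  Theta A B * Theta A B' =
  Theta (2 * A) (B + B') * Theta (2 * A) (B - B') +
  cexp (A + B) * (Theta (2 * A) (2 * A + (B + B')) * Theta (2 * A) (2 * A + (B - B'))).
Proof.
intros HA. assert (HA2 : (Re (2 * A) < 0)%R) by (rewrite Re_scal_R; lra).
unfold Theta. rewrite <- !csum_mult by now apply summable_thterm.
pose (f := fun p : Z * Z => thterm A B (fst p) * thterm A B' (snd p)).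
assert (Hf : summable f) by (apply summable_mult; now apply summable_thterm).
change (csum f = csum (fun p => thterm (2 * A) (B + B') (fst p) * thterm (2 * A) (B - B') (snd p)) +
  cexp (A + B) * csum (fun p => thterm (2 * A) (2 * A + (B + B')) (fst p) * thterm (2 * A) (2 * A + (B - B')) (snd p))).
rewrite (csum_split f (fun p => (fst p + snd p, fst p - snd p)%Z) (fun p => (fst p + snd p + 1, fst p - snd p)%Z)); auto.
- rewrite <- csum_scal by (apply summable_mult; now apply summable_thterm).
  f_equal; apply csum_ext; intros [r s]; unfold f, thterm; simpl; rewrite <- !cexp_plus; f_equal;
  rewrite !plus_IZR, minus_IZR, !RtoC_mult, !RtoC_plus, RtoC_minus; ring.
- intros [r s] [r' s'] E; injection E; intros; f_equal; lia.
- intros [r s] [r' s'] E; injection E; intros; f_equal; lia.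
- intros [r s] [r' s'] E; injection E; lia.
- intros [n m]. destruct (Z.Even_or_Odd (n + m)) as [[k Hk]|[k Hk]]; [left; exists (k, n - k)%Z|right; exists (k, n - k - 1)%Z];
  simpl; f_equal; lia.
Qed.

(** * The 5-torsion equation *)

Lemma cexp_split z w v : z = w + v -> cexp z = cexp w * cexp v.
Proof. intros ->; apply cexp_plus. Qed.

Lemma RtoC_neq_0 (r : R) : r <> 0%R -> RtoC r <> 0.
Proof. intros H E; apply H; now apply RtoC_inj in E. Qed.

Section ThetaIdentities.
Variable V : C.
Hypothesis HV : (Re V < 0)%R.
Let HV2 : (Re (2 * V) < 0)%R. Proof. rewrite Re_scal_R; lra. Qed.
Let HV4 : (Re (2 * (2 * V)) < 0)%R. Proof. rewrite !Re_scal_R; lra. Qed.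

(* With u = e^U and Q = e^V, [Ee] and [Oo] are the even and odd parts of sum_n Q^(n(n-1)/2) u^n; [He], [Ho] those of
   sum_n Q^(n^2) u^(2n); [Fe], [Fo] are [Ee], [Oo] at (u^2, Q^2); [S0], [S1] are the alternating companions of [Ee], [Oo].
   In classical terms [Oo / Ee] is sqrt(k) sn. *)
Definition Ee U := Theta (2 * V) (2 * U - V).
Definition Oo U := cexp U * Theta (2 * V) (2 * U + V).
Definition S0 U := Theta (2 * V) (2 * U + PiI).
Definition S1 U := cexp U * Theta (2 * V) (2 * V + 2 * U + PiI).
Definition Fe U := Theta (2 * (2 * V)) (4 * U - 2 * V).
Definition Fo U := cexp (2 * U) * Theta (2 * (2 * V)) (4 * U + 2 * V).
Definition He U := Theta (2 * (2 * V)) (4 * U).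
Definition Ho U := cexp (V + 2 * U) * Theta (2 * (2 * V)) (4 * V + 4 * U).

Lemma Fe_alt a : Fe a = cexp (2 * V + 4 * a) * Theta (2 * (2 * V)) (4 * a + 6 * V).
Proof.
unfold Fe; rewrite Theta_shift by auto. f_equal; [f_equal; ring|f_equal; ring].
Qed.
Lemma He_alt b : He b = cexp (4 * V + 4 * b) * Theta (2 * (2 * V)) (4 * b + 8 * V).
Proof. unfold He; rewrite Theta_shift by auto. f_equal; [f_equal; ring|f_equal; ring]. Qed.

Lemma Ee_mult a b : Ee (a + b) * Ee (a - b) = Fe a * He b + Fo a * Ho b.
Proof.
unfold Ee; rewrite Theta_mult by auto. unfold Fe, He, Fo, Ho.
replace (2 * (a + b) - V + (2 * (a - b) - V)) with (4 * a - 2 * V) by ring.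
replace (2 * (a + b) - V - (2 * (a - b) - V)) with (4 * b) by ring.
replace (2 * (2 * V) + (4 * a - 2 * V)) with (4 * a + 2 * V) by ring.
replace (2 * (2 * V) + 4 * b) with (4 * V + 4 * b) by ring.
rewrite (cexp_split (2 * V + (2 * (a + b) - V)) (2 * a) (V + 2 * b)) by ring.
ring.
Qed.
Lemma Oo_mult a b : Oo (a + b) * Oo (a - b) = Fo a * He b + Fe a * Ho b.
Proof.
unfold Oo. transitivity (cexp (2 * a) * (Theta (2 * V) (2 * (a + b) + V) * Theta (2 * V) (2 * (a - b) + V))).
{ rewrite (cexp_split (2 * a) (a + b) (a - b)) by ring; ring. }
rewrite Theta_mult by auto. rewrite Fe_alt. unfold He, Fo, Ho.
replace (2 * (a + b) + V + (2 * (a - b) + V)) with (4 * a + 2 * V) by ring.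
replace (2 * (a + b) + V - (2 * (a - b) + V)) with (4 * b) by ring.
replace (2 * (2 * V) + (4 * a + 2 * V)) with (4 * a + 6 * V) by ring.
replace (2 * (2 * V) + 4 * b) with (4 * V + 4 * b) by ring.
rewrite (cexp_split (2 * V + (2 * (a + b) + V)) (2 * V + 2 * a) (V + 2 * b)) by ring.
rewrite (cexp_split (2 * V + 4 * a) (2 * V + 2 * a) (2 * a)) by ring.
ring.
Qed.
Lemma S0_sqr b : S0 b * S0 b = He b * He 0 - Ho b * Ho 0.
Proof.
unfold S0; rewrite Theta_mult by auto. unfold He, Ho.
replace (2 * b + PiI + (2 * b + PiI)) with (4 * b + 2 * PiI) by ring.
replace (2 * b + PiI - (2 * b + PiI)) with (4 * 0) by ring.
replace (2 * (2 * V) + (4 * b + 2 * PiI)) with (4 * V + 4 * b + 2 * PiI) by ring.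
replace (2 * (2 * V) + 4 * 0) with (4 * V + 4 * 0) by ring.
rewrite !Theta_period.
rewrite (cexp_split (2 * V + (2 * b + PiI)) ((V + 2 * b) + (V + 2 * 0)) PiI), cexp_PiI by ring.
rewrite cexp_plus; ring.
Qed.
Lemma S1_sqr b : cexp V * (S1 b * S1 b) = Ho b * He 0 - He b * Ho 0.
Proof.
unfold S1.
transitivity (cexp (V + 2 * b) * (Theta (2 * V) (2 * V + 2 * b + PiI) * Theta (2 * V) (2 * V + 2 * b + PiI))).
{ rewrite (cexp_split (V + 2 * b) V (b + b)), (cexp_plus b) by ring; ring. }
rewrite Theta_mult by auto. rewrite (He_alt b). unfold He, Ho.
replace (2 * V + 2 * b + PiI + (2 * V + 2 * b + PiI)) with (4 * V + 4 * b + 2 * PiI) by ring.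
replace (2 * V + 2 * b + PiI - (2 * V + 2 * b + PiI)) with (4 * 0) by ring.
replace (2 * (2 * V) + (4 * V + 4 * b + 2 * PiI)) with (4 * b + 8 * V + 2 * PiI) by ring.
replace (2 * (2 * V) + 4 * 0) with (4 * V + 4 * 0) by ring.
rewrite !Theta_period.
replace (2 * V + (2 * V + 2 * b + PiI)) with ((4 * V + 2 * b) + PiI) by ring.
replace (V + 2 * 0) with V by ring.
rewrite (cexp_split (4 * V + 4 * b) ((4 * V + 2 * b)) (2 * b)) by ring.
rewrite !cexp_plus, cexp_PiI; ring.
Qed.
Lemma FeFo_diff a : Fe a * Fe a - Fo a * Fo a = - (cexp (2 * a) * S1 (2 * a) * S0 0).
Proof.
unfold S0, S1.
transitivity (- (cexp (4 * a) * (Theta (2 * V) (2 * V + 2 * (2 * a) + PiI) * Theta (2 * V) (2 * 0 + PiI)))).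
2:{ rewrite (cexp_split (4 * a) (2 * a) (2 * a)) by ring; ring. }
rewrite Theta_mult by auto. rewrite Fe_alt; unfold Fo.
replace (2 * V + 2 * (2 * a) + PiI + (2 * 0 + PiI)) with (4 * a + 2 * V + 2 * PiI) by ring.
replace (2 * V + 2 * (2 * a) + PiI - (2 * 0 + PiI)) with (4 * a + 2 * V) by ring.
replace (2 * (2 * V) + (4 * a + 2 * V + 2 * PiI)) with (4 * a + 6 * V + 2 * PiI) by ring.
replace (2 * (2 * V) + (4 * a + 2 * V)) with (4 * a + 6 * V) by ring.
rewrite !Theta_period.
replace (2 * V + (2 * V + 2 * (2 * a) + PiI)) with (2 * V + 2 * V + 4 * a + PiI) by ring.
rewrite (cexp_split (4 * a) (2 * a) (2 * a)) by ring.
rewrite !cexp_plus, cexp_PiI.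
rewrite (cexp_split (4 * a) (2 * a) (2 * a)) by ring. ring.
Qed.
Lemma FeFo_prod a : 2 * (Fe a * Fo a) = cexp (2 * a) * Theta (2 * V) (4 * a) * Theta (2 * V) (2 * V).
Proof.
transitivity (cexp (2 * a) * (Theta (2 * V) (4 * a) * Theta (2 * V) (2 * V))); [|ring].
rewrite Theta_mult by auto.
replace (2 * (2 * V) + (4 * a + 2 * V)) with (4 * a + 6 * V) by ring.
replace (2 * (2 * V) + (4 * a - 2 * V)) with (4 * a + 2 * V) by ring.
transitivity (Fe a * Fo a + Fo a * Fe a); [ring|].
rewrite (Fe_alt a) at 2. unfold Fe, Fo. ring.
Qed.
Lemma FeFo_sum a : Fe a * Fe a + Fo a * Fo a = Theta (2 * V) 0 * Theta (2 * V) (4 * a - 2 * V).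
Proof.
rewrite (Cmult_comm (Theta (2 * V) 0)), Theta_mult by auto. unfold Fe, Fo.
replace (4 * a - 2 * V + 0) with (4 * a - 2 * V) by ring.
replace (4 * a - 2 * V - 0) with (4 * a - 2 * V) by ring.
replace (2 * (2 * V) + (4 * a - 2 * V)) with (4 * a + 2 * V) by ring.
replace (2 * V + (4 * a - 2 * V)) with (2 * a + 2 * a) by ring.
rewrite cexp_plus; ring.
Qed.
Lemma K_sqr a : Theta (2 * V) (4 * a) * Theta (2 * V) (4 * a) = He (2 * a) * He 0 + Ho (2 * a) * Ho 0.
Proof.
rewrite Theta_mult by auto. unfold He, Ho.
replace (4 * a + 4 * a) with (4 * (2 * a)) by ring.
replace (4 * a - 4 * a) with (4 * 0) by ring.
replace (2 * (2 * V) + 4 * (2 * a)) with (4 * V + 4 * (2 * a)) by ring.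
replace (2 * (2 * V) + 4 * 0) with (4 * V + 4 * 0) by ring.
rewrite (cexp_split (2 * V + 4 * a) (V + 2 * (2 * a)) (V + 2 * 0)) by ring. ring.
Qed.
Lemma L_sqr a : cexp V * (Theta (2 * V) (4 * a - 2 * V) * Theta (2 * V) (4 * a - 2 * V)) =
  cexp (4 * a) * (Ho (2 * a) * He 0 + He (2 * a) * Ho 0).
Proof.
rewrite Theta_mult by auto. unfold He, Ho.
replace (4 * a - 2 * V - (4 * a - 2 * V)) with (4 * 0) by ring.
replace (4 * a - 2 * V + (4 * a - 2 * V)) with (8 * a - 4 * V) by ring.
rewrite (Theta_shift _ (8 * a - 4 * V)) by auto.
replace (8 * a - 4 * V + 2 * (2 * (2 * V))) with (4 * V + 4 * (2 * a)) by ring.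
replace (2 * (2 * V) + (8 * a - 4 * V)) with (4 * (2 * a)) by ring.
replace (2 * (2 * V) + 4 * 0) with (4 * V + 4 * 0) by ring.
replace (4 * (2 * a)) with (4 * a + 4 * a) by ring.
replace (2 * V + (4 * a - 2 * V)) with (4 * a) by ring.
replace (V + 2 * 0) with V by ring. replace (V + 2 * (2 * a)) with (V + 4 * a) by ring.
rewrite !cexp_plus; ring.
Qed.
Lemma p_eq : Theta (2 * V) 0 * Theta (2 * V) 0 = He 0 * He 0 + Ho 0 * Ho 0.
Proof. pose proof (K_sqr 0) as H. now replace (4 * 0) with (RtoC 0) in H by ring; replace (2 * 0) with (RtoC 0) in H by ring. Qed.
Lemma m_eq : cexp V * (Theta (2 * V) (2 * V) * Theta (2 * V) (2 * V)) = 2 * (He 0 * Ho 0).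
Proof.
rewrite Theta_mult by auto. rewrite (He_alt 0). unfold Ho.
replace (2 * V - 2 * V) with (4 * 0) by ring.
replace (2 * V + 2 * V) with (4 * V + 4 * 0) by ring.
replace (2 * (2 * V) + (4 * V + 4 * 0)) with (4 * 0 + 8 * V) by ring.
replace (2 * (2 * V) + 4 * 0) with (4 * V + 4 * 0) by ring.
replace (V + 2 * 0) with V by ring.
replace (2 * V + 2 * V) with (4 * V + 4 * 0) by ring.
change (Theta (2 * (2 * V)) (4 * 0)) with (He 0). rewrite (He_alt 0). ring.
Qed.

(* 4 (k + 1/k) for the modulus k *)
Definition beta := 4 * ((He 0 * He 0 + Ho 0 * Ho 0) / (2 * (He 0 * Ho 0)) + 2 * (He 0 * Ho 0) / (He 0 * He 0 + Ho 0 * Ho 0)).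

Hypothesis th2_nz : Theta (2 * V) (2 * V) <> 0.
Hypothesis th3_nz : Theta (2 * V) 0 <> 0.
Hypothesis th4_nz : Theta (2 * V) PiI <> 0.

Let p_nz : He 0 * He 0 + Ho 0 * Ho 0 <> 0.
Proof. rewrite <- p_eq; apply Cmult_neq_0; auto. Qed.
Let h_nz : He 0 <> 0.
Proof.
intros E; pose proof m_eq as H. rewrite E in H. apply (Cmult_neq_0 (cexp V) (Theta (2 * V) (2 * V) * Theta (2 * V) (2 * V))).
apply cexp_neq0. apply Cmult_neq_0; auto. rewrite H; ring.
Qed.
Let k_nz : Ho 0 <> 0.
Proof.
intros E; pose proof m_eq as H. rewrite E in H. apply (Cmult_neq_0 (cexp V) (Theta (2 * V) (2 * V) * Theta (2 * V) (2 * V))).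
apply cexp_neq0. apply Cmult_neq_0; auto. rewrite H; ring.
Qed.

(** Landen's transformation: k belongs to the nome e^(2V), and beta + 8 = 4 (1 + k)^2 / k equals 16
    / lambda at the nome e^V. The right-hand side is the variable in which the equation over j is
    monic. *)
Lemma beta_theta : beta + 8 = 16 * (Theta V 0) ^ 4 / (cexp V * Theta V V ^ 4).
Proof.
assert (E1 : Theta V 0 ^ 2 = Theta (2 * V) 0 * Theta (2 * V) 0 + cexp V * (Theta (2 * V) (2 * V) * Theta (2 * V) (2 * V))).
{ transitivity (Theta V 0 * Theta V 0); [ring|]. rewrite Theta_mult by auto.
  replace (0 + 0) with (RtoC 0) by ring. replace (0 - 0) with (RtoC 0) by ring.
  replace (2 * V + 0) with (2 * V) by ring. replace (V + 0) with V by ring. reflexivity. }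
assert (E2 : Theta V V ^ 2 = 2 * (Theta (2 * V) 0 * Theta (2 * V) (2 * V))).
{ transitivity (Theta V V * Theta V V); [ring|]. rewrite Theta_mult by auto.
  replace (V - V) with (RtoC 0) by ring. replace (V + V) with (2 * V) by ring.
  rewrite (Theta_shift _ 0) at 1 by auto.
  rewrite (Theta_shift _ 0) at 1 by auto.
  replace (2 * V + 0) with (2 * V) by ring. replace (0 + 2 * (2 * V)) with (2 * V + 2 * V) by ring. ring. }
replace (Theta V 0 ^ 4) with (Theta V 0 ^ 2 * Theta V 0 ^ 2) by ring.
replace (Theta V V ^ 4) with (Theta V V ^ 2 * Theta V V ^ 2) by ring.
rewrite E1, E2, p_eq, m_eq.
replace (cexp V * _) with (4 * (Theta (2 * V) 0 * Theta (2 * V) 0) * (cexp V * (Theta (2 * V) (2 * V) * Theta (2 * V) (2 * V)))) by ring.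
rewrite p_eq, m_eq. unfold beta. field. repeat split; auto.
Qed.

Lemma Ee_sqr a : Ee a ^ 2 = Fe a * He 0 + Fo a * Ho 0.
Proof.
rewrite <- Ee_mult. replace (a + 0) with a by ring. replace (a - 0) with a by ring. ring.
Qed.
Lemma Oo_sqr a : Oo a ^ 2 = Fo a * He 0 + Fe a * Ho 0.
Proof.
rewrite <- Oo_mult. replace (a + 0) with a by ring. replace (a - 0) with a by ring. ring.
Qed.
(** With [quartic_diff] this is the duplication formula of sn: for x = [Oo a / Ee a] the quotient of
    [S0 ^ 2] by e^V [S1 ^ 2] at 2a is -x^2 (4 - beta x^2 + 4 x^4) / (1 - x^4)^2. The products
    [K_sqr] and [L_sqr] determine the unknowns [He (2 * a)] and [Ho (2 * a)] linearly, and their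
    left-hand sides are quadratic expressions in [Fe] and [Fo]. *)
Lemma quartic a :
  (He 0 * He 0 - Ho 0 * Ho 0) ^ 3 * cexp (4 * a) * (S0 (2 * a)) ^ 2 =
  - cexp V * (Ee a ^ 2 * Oo a ^ 2 * (4 * Ee a ^ 4 + 4 * Oo a ^ 4 - beta * Ee a ^ 2 * Oo a ^ 2)).
Proof.
replace (Ee a ^ 4) with (Ee a ^ 2 * Ee a ^ 2) by ring.
replace (Oo a ^ 4) with (Oo a ^ 2 * Oo a ^ 2) by ring.
rewrite Ee_sqr, Oo_sqr.
replace (S0 (2 * a) ^ 2) with (S0 (2 * a) * S0 (2 * a)) by ring. rewrite S0_sqr.
assert (X : cexp (4 * a) * (He (2 * a) * He 0 + Ho (2 * a) * Ho 0) =
  2 * cexp V * (Fe a ^ 2 * Fo a ^ 2) / (He 0 * Ho 0)).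
{ rewrite <- K_sqr.
  apply (Cmult_cancel_r (2 * (He 0 * Ho 0))); [apply Cmult_neq_0; [apply RtoC_neq_0; lra|apply Cmult_neq_0; auto]|].
  rewrite <- m_eq at 1.
  transitivity (cexp V * (2 * (Fe a * Fo a)) * (2 * (Fe a * Fo a))); [|field; auto].
  rewrite FeFo_prod, (cexp_split (4 * a) (2 * a) (2 * a)) by ring. ring. }
assert (Z : cexp (4 * a) * (Ho (2 * a) * He 0 + He (2 * a) * Ho 0) =
  cexp V * (Fe a * Fe a + Fo a * Fo a) ^ 2 / (He 0 * He 0 + Ho 0 * Ho 0)).
{ rewrite <- L_sqr, FeFo_sum, <- p_eq. field; auto. }
transitivity ((He 0 * He 0 - Ho 0 * Ho 0) ^ 2 * (
  (He 0 * He 0 + Ho 0 * Ho 0) * (cexp (4 * a) * (He (2 * a) * He 0 + Ho (2 * a) * Ho 0)) -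
  2 * He 0 * Ho 0 * (cexp (4 * a) * (Ho (2 * a) * He 0 + He (2 * a) * Ho 0)))); [ring|].
rewrite X, Z. unfold beta. field. repeat split; auto.
Qed.
Lemma Ee_opp U : Ee (- U) = cexp (- U) * Oo U.
Proof.
unfold Ee, Oo. rewrite <- (Theta_even _ (2 * U + V)) by auto.
replace (- (2 * U + V)) with (2 * - U - V) by ring.
rewrite cexp_opp. field. apply cexp_neq0.
Qed.
Lemma Oo_opp U : Oo (- U) = cexp (- U) * Ee U.
Proof.
unfold Ee, Oo. rewrite <- (Theta_even _ (2 * U - V)) by auto. f_equal; f_equal; ring.
Qed.
(** Translation by [V] exchanges [Ee] and [Oo] up to a factor, and the two agree at 0; hence they
    also agree at V and at 2V. These are the values of 5U that occur for T_1 and T_2. *)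
Lemma Ee_Oo_V : Ee V = Oo V.
Proof.
unfold Ee, Oo. rewrite <- Theta_even by auto. rewrite Theta_shift by auto.
f_equal; f_equal; ring.
Qed.
Lemma Ee_Oo_2V : Ee (2 * V) = Oo (2 * V).
Proof.
unfold Ee, Oo.
assert (H1 : Theta (2 * V) V = cexp (3 * V) * Theta (2 * V) (5 * V)).
{ rewrite Theta_shift by auto. f_equal; f_equal; ring. }
assert (H2 : Theta (2 * V) V = cexp V * Theta (2 * V) (3 * V)).
{ rewrite <- Theta_even by auto. rewrite Theta_shift by auto. f_equal; f_equal; ring. }
replace (2 * (2 * V) - V) with (3 * V) by ring. replace (2 * (2 * V) + V) with (5 * V) by ring.
apply (Cmult_cancel_r (cexp V)); [apply cexp_neq0|].
rewrite Cmult_comm, <- H2, H1, (cexp_split (3 * V) (2 * V) V) by ring. ring.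
Qed.
(** Counterpart of the formula for sn(u + v) sn(u - v). Sum and difference occur together, so b = 2U
    leads from U to 3U, and then from 3U to 5U, with the known values at -U and U as the other
    factor. *)
Lemma Ee_Oo_add a b : 
  Oo (a + b) * Oo (a - b) * (He 0 * He 0 - Ho 0 * Ho 0) = Oo a ^ 2 * S0 b ^ 2 + Ee a ^ 2 * (cexp V * S1 b ^ 2) /\
  Ee (a + b) * Ee (a - b) * (He 0 * He 0 - Ho 0 * Ho 0) = Ee a ^ 2 * S0 b ^ 2 + Oo a ^ 2 * (cexp V * S1 b ^ 2).
Proof.
replace (S0 b ^ 2) with (S0 b * S0 b) by ring. replace (S1 b ^ 2) with (S1 b * S1 b) by ring.
rewrite Oo_mult, Ee_mult, S0_sqr, S1_sqr, Ee_sqr, Oo_sqr. split; ring.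
Qed.
Lemma quartic_diff a : 
  cexp V * (Ee a ^ 4 - Oo a ^ 4) ^ 2 =
  (He 0 * He 0 - Ho 0 * Ho 0) ^ 3 * cexp (4 * a) * (cexp V * S1 (2 * a) ^ 2).
Proof.
assert (E : S0 0 * S0 0 = He 0 * He 0 - Ho 0 * Ho 0) by (rewrite S0_sqr; ring).
transitivity (cexp V * ((Fe a * Fe a - Fo a * Fo a) * (He 0 * He 0 - Ho 0 * Ho 0)) ^ 2).
{ replace (Ee a ^ 4) with (Ee a ^ 2 * Ee a ^ 2) by ring.
  replace (Oo a ^ 4) with (Oo a ^ 2 * Oo a ^ 2) by ring. rewrite Ee_sqr, Oo_sqr. ring. }
rewrite FeFo_diff, <- E, (cexp_split (4 * a) (2 * a) (2 * a)) by ring. ring.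
Qed.

(* Eliminates the value of [Oo / Ee] at 3U from the addition formulas for U + 2U and 3U + 2U, the value at 5U being 1. *)
Definition torsion_poly (b x : C) : C :=
  let e := 1 - x ^ 4 in
  let m := 4 + 4 * x ^ 4 - b * x ^ 2 in
  let A := m - e ^ 2 in
  let B := e ^ 2 - x ^ 4 * m in
  x * (A ^ 2 * e ^ 2 - m * B ^ 2) - (B ^ 2 * e ^ 2 - x ^ 4 * A ^ 2 * m).

Lemma torsion_eq U : Ee (5 * U) = Oo (5 * U) -> Ee U <> 0 -> Oo U <> 0 ->
  torsion_poly beta (Oo U / Ee U) = 0.
Proof.
intros H5 HD HN.
assert (Hc : He 0 * He 0 - Ho 0 * Ho 0 <> 0).
{ rewrite <- S0_sqr. unfold S0. replace (2 * 0 + PiI) with PiI by ring. apply Cmult_neq_0; auto. }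
destruct (Ee_Oo_add U (2 * U)) as [R2 R2'].
destruct (Ee_Oo_add (3 * U) (2 * U)) as [R3 R3'].
replace (U + 2 * U) with (3 * U) in R2, R2' by ring.
replace (U - 2 * U) with (- U) in R2, R2' by ring.
replace (3 * U + 2 * U) with (5 * U) in R3, R3' by ring.
replace (3 * U - 2 * U) with U in R3, R3' by ring.
rewrite Oo_opp in R2. rewrite Ee_opp in R2'. rewrite H5 in R3'.
pose proof (quartic U) as Q0. pose proof (quartic_diff U) as Q1.
set (c := He 0 * He 0 - Ho 0 * Ho 0) in *.
set (D := Ee U) in *. set (N := Oo U) in *.
set (s0 := S0 (2 * U) ^ 2) in *. set (s1 := cexp V * S1 (2 * U) ^ 2) in *.
set (O3 := Oo (3 * U)) in *. set (E3 := Ee (3 * U)) in *.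
set (M := 4 * D ^ 4 + 4 * N ^ 4 - beta * D ^ 2 * N ^ 2) in *.
set (e := D ^ 4 - N ^ 4) in *.
(* The factor common to both halves of the duplication formula: multiplied by it, [s0] and [s1]
   become forms of degree 8 in [D] and [N]. *)
pose (G := c ^ 3 * cexp (4 * U) / cexp V).
pose proof (cexp_neq0 V) as HQ.
assert (G0 : G * s0 = - (D ^ 2 * N ^ 2 * M)).
{ unfold G. transitivity (c ^ 3 * cexp (4 * U) * s0 / cexp V); [field; auto|]. rewrite Q0; field; auto. }
assert (G1 : G * s1 = e ^ 2).
{ unfold G. transitivity (c ^ 3 * cexp (4 * U) * s1 / cexp V); [field; auto|]. rewrite <- Q1; field; auto. }
assert (HG : G <> 0).
{ unfold G. intros E. apply (Cmult_neq_0 (c ^ 3) (cexp (4 * U))); [now apply Cpow_nz|apply cexp_neq0|].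
  transitivity (c ^ 3 * cexp (4 * U) / cexp V * cexp V); [field; auto|]. rewrite E; ring. }
pose (k := G * cexp (- U) * c).
assert (O3e : k * O3 = D * (e ^ 2 - N ^ 4 * M)).
{ apply (Cmult_cancel_r D); auto. unfold k.
  transitivity (G * (O3 * (cexp (- U) * D) * c)); [ring|]. rewrite R2.
  transitivity (N ^ 2 * (G * s0) + D ^ 2 * (G * s1)); [ring|]. rewrite G0, G1. ring. }
assert (E3e : k * E3 = N * (e ^ 2 - D ^ 4 * M)).
{ apply (Cmult_cancel_r N); auto. unfold k.
  transitivity (G * (E3 * (cexp (- U) * N) * c)); [ring|]. rewrite R2'.
  transitivity (D ^ 2 * (G * s0) + N ^ 2 * (G * s1)); [ring|]. rewrite G0, G1. ring. }
assert (R : D * (O3 ^ 2 * s0 + E3 ^ 2 * s1) = N * (E3 ^ 2 * s0 + O3 ^ 2 * s1)).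
{ rewrite <- R3, <- R3'. ring. }
assert (R' : D * ((k * O3) ^ 2 * (G * s0) + (k * E3) ^ 2 * (G * s1)) = N * ((k * E3) ^ 2 * (G * s0) + (k * O3) ^ 2 * (G * s1))).
{ transitivity (k ^ 2 * G * (D * (O3 ^ 2 * s0 + E3 ^ 2 * s1))); [ring|]. rewrite R. ring. }
rewrite O3e, E3e, G0, G1 in R'.
(* The relation [R'] is homogeneous of degree 27 and divisible by D N; division of the remaining
   form by D^25 leaves a polynomial in x = N / D. *)
apply (Cmult_cancel_r (D ^ 25)); [now apply Cpow_nz|].
rewrite Cmult_0_l.
apply (Cmult_cancel_r (D * N)); [apply Cmult_neq_0; auto|].
rewrite Cmult_0_l.
apply Ceq_minus in R'. rewrite <- R'.
unfold torsion_poly, e, M. field. auto.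
Qed.
End ThetaIdentities.

(** * The Jacobi triple product *)

Local Notation qp := qpoch_partial.

Lemma is_lim_seq_Clim u l (f : C -> R) : (forall z : C, Rabs (f z) <= Cmod z)%R ->
  (forall z w : C, f (z - w)%C = (f z - f w)%R) -> Clim u l -> is_lim_seq (fun n => f (u n)) (f l).
Proof.
intros Hf Hs H. apply is_lim_seq_spec; intros eps. destruct (H eps (cond_pos eps)) as [N HN].
exists N; intros n Hn. change (Rabs (f (u n) - f l) < eps)%R. rewrite <- Hs. eapply Rle_lt_trans; [apply Hf|]. apply HN; auto.
Qed.
Lemma Rabs_Im_Cmod z : (Rabs (Im z) <= Cmod z)%R.
Proof. eapply Rle_trans; [apply Rmax_r|apply Rmax_Cmod]. Qed.

Lemma qp_app a q N M : qp a q (N + M) = qp a q N * qp (a * q ^ N) q M.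
Proof.
induction M as [|M IH]; [rewrite Nat.add_0_r; simpl; ring|].
rewrite Nat.add_succ_r; simpl. rewrite IH, Cpow_add_r; ring.
Qed.
Lemma qp_front a q N : qp a q (S N) = (1 - a) * qp (a * q) q N.
Proof. change (S N) with (1 + N)%nat; rewrite qp_app; simpl. replace (q * 1) with q by ring. ring. Qed.

Section QPoch.
Variables (a q : C).
Hypothesis Hq : (Cmod q < 1)%R.

Let S := (Cmod a / (1 - Cmod q))%R.
Let geom_le N : (rsum (fun k => Cmod a * Cmod q ^ k) (seq 0 N) <= S)%R.
Proof.
rewrite rsum_scal. unfold S, Rdiv; apply Rmult_le_compat_l; [apply Cmod_ge_0|].
apply rsum_seq_geom; split; auto; apply Cmod_ge_0.
Qed.
Lemma qp_le N : (Cmod (qp a q N) <= exp S)%R.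
Proof.
apply Rle_trans with (exp (rsum (fun k => Cmod a * Cmod q ^ k) (seq 0 N)))%R.
- induction N as [|N IH]; [simpl; rewrite Cmod_1, exp_0; lra|].
  rewrite seq_S, rsum_app; simpl. rewrite Cmod_mult, exp_plus, Rplus_0_r.
  apply Rmult_le_compat; auto using Cmod_ge_0.
  eapply Rle_trans; [|apply exp_ineq1_le].
  unfold Cminus; eapply Rle_trans; [apply Cmod_triangle|].
  rewrite Cmod_1, Cmod_opp, Cmod_mult, Cmod_pow; lra.
- destruct (Rle_lt_or_eq_dec _ _ (geom_le N)) as [H| ->]; [left; now apply exp_increasing|lra].
Qed.
(** Consecutive partial products differ by a summable family, so they converge as complex numbers.
    Hence the limits in [qpoch_inf] are finite and [real] does not fall back on its default. *)
Lemma qp_cvg : Clim (qp a q) (qpoch_inf a q).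
Proof.
assert (HL : exists L, Clim (qp a q) L).
{ pose (d := fun k => - (qp a q k * (a * q ^ k))).
  assert (Hd : summable d).
  { apply (summable_le _ (fun k => RtoC (exp S * Cmod a) * q ^ k)); [|apply summable_scal, summable_geom, Hq].
    intros k; unfold d. rewrite Cmod_opp, !Cmod_mult, Cmod_R, Rabs_pos_eq.
    - rewrite <- Rmult_assoc. apply Rmult_le_compat_r; [apply Cmod_ge_0|].
      apply Rmult_le_compat_r; [apply Cmod_ge_0|apply qp_le].
    - apply Rmult_le_pos; [left; apply exp_pos|apply Cmod_ge_0]. }
  exists (1 + csum d).
  apply (Clim_ext (fun N => 1 + lsum d (seq 0 N))).
  - induction n as [|n IH]; [simpl; ring|].
    rewrite seq_S, lsum_app. transitivity ((1 + lsum d (seq 0 n)) + d n); [simpl; ring|]. rewrite IH; unfold d; simpl; ring.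
  - apply Clim_plus; [apply Clim_const|apply csum_nat_lim, Hd]. }
destruct HL as [L HL].
replace (qpoch_inf a q) with L; auto.
unfold qpoch_inf.
rewrite (is_lim_seq_unique _ (Finite (Re L))), (is_lim_seq_unique _ (Finite (Im L))).
- destruct L; reflexivity.
- apply (is_lim_seq_Clim _ _ Im); auto using Rabs_Im_Cmod.
- apply (is_lim_seq_Clim _ _ Re); auto using re_le_Cmod.
Qed.
End QPoch.

Lemma Clim_Cmod_ge u l c : Clim u l -> (forall n, c <= Cmod (u n))%R -> (c <= Cmod l)%R.
Proof.
intros H Hc; apply Rnot_lt_le; intros Hl.
destruct (H (c - Cmod l)%R) as [N HN]; [lra|]. specialize (HN N (le_n _)). specialize (Hc N).
assert (Cmod (u N) <= Cmod l + Cmod (u N - l))%R; [|lra].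
replace (u N) with (l + (u N - l)) at 1 by ring. apply Cmod_triangle.
Qed.
(** Far out, the parameter a q^N0 is so small that prod (1 - t_k) >= 1 - sum t_k >= 1/2; the
    finitely many earlier products are nonzero. Uniformity gives both the nonvanishing of the
    infinite product and bounds for Gaussian binomials. *)
Lemma qp_ge a q : (Cmod q < 1)%R -> (forall k, 1 - a * q ^ k <> 0) ->
  exists c, (0 < c)%R /\ forall N, (c <= Cmod (qp a q N))%R.
Proof.
intros Hq Hnz.
assert (Hsmall : forall b, (Cmod b / (1 - Cmod q) <= /2)%R -> forall N, (/2 <= Cmod (qp b q N))%R).
{ intros b Hb N.
  assert (Hr : forall M, (rsum (fun k => Cmod b * Cmod q ^ k) (seq 0 M) <= /2)%R).
  { intros M; eapply Rle_trans; [|exact Hb].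
    rewrite rsum_scal. unfold Rdiv; apply Rmult_le_compat_l; [apply Cmod_ge_0|].
    apply rsum_seq_geom; split; auto; apply Cmod_ge_0. }
  apply Rle_trans with (1 - rsum (fun k => Cmod b * Cmod q ^ k) (seq 0 N))%R; [specialize (Hr N); lra|].
  induction N as [|N IH]; [simpl; rewrite Cmod_1; lra|].
  pose proof (Hr N) as H1. pose proof (Hr (S N)) as H2.
  rewrite seq_S, rsum_app in H2 |- *; simpl in H2 |- *.
  set (s := rsum _ (seq 0 N)) in *. set (t := (Cmod b * Cmod q ^ N)%R) in *.
  assert (Ht : (0 <= t)%R) by (apply Rmult_le_pos; [apply Cmod_ge_0|apply pow_le, Cmod_ge_0]).
  assert (Hs : (0 <= s)%R).
  { apply rsum_nonneg; intros; apply Rmult_le_pos; [apply Cmod_ge_0|apply pow_le, Cmod_ge_0]. }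
  rewrite Cmod_mult.
  assert (H3 : (1 - t <= Cmod (1 - b * q ^ N))%R).
  { assert (Cmod 1 <= Cmod (1 - b * q ^ N) + Cmod (b * q ^ N))%R.
    { replace (RtoC 1) with ((1 - b * q ^ N) + b * q ^ N) at 1 by ring. apply Cmod_triangle. }
    rewrite Cmod_1, Cmod_mult, Cmod_pow in H. fold t in H. lra. }
  apply Rle_trans with ((1 - s) * (1 - t))%R; [nra|].
  apply Rmult_le_compat; lra. }
destruct (Clim_pow0 q Hq (/ 2 * (1 - Cmod q) / (Cmod a + 1))%R) as [N0 HN0].
{ pose proof (Cmod_ge_0 a). apply Rdiv_lt_0_compat; lra. }
assert (Hpos : forall M, (0 < Cmod (qp a q M))%R).
{ intros M; apply Cmod_gt_0. induction M as [|M IH]; simpl; [apply C1_nz|]. apply Cmult_neq_0; auto. }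
assert (Htail : forall M, (/2 <= Cmod (qp (a * q ^ N0) q M))%R).
{ apply Hsmall. specialize (HN0 N0 (le_n _)).
  replace (q ^ N0 - 0) with (q ^ N0) in HN0 by ring. rewrite Cmod_mult.
  pose proof (Cmod_ge_0 a). pose proof (Cmod_ge_0 (q ^ N0)).
  apply (Rmult_le_reg_r (1 - Cmod q)); [lra|]. unfold Rdiv.
  rewrite Rmult_assoc, Rinv_l, Rmult_1_r by lra.
  apply Rle_trans with ((Cmod a + 1) * (/ 2 * (1 - Cmod q) / (Cmod a + 1)))%R; [apply Rmult_le_compat; lra|].
  right; field; lra. }
assert (Hfin : forall K, exists c, (0 < c)%R /\ forall M, (M <= K)%nat -> (c <= Cmod (qp a q M))%R).
{ induction K as [|K (c & Hc & H)].
  - exists (Cmod (qp a q 0)); split; auto. intros M HM; replace M with O by lia; lra.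
  - exists (Rmin c (Cmod (qp a q (S K)))); split; [apply Rmin_glb_lt; auto|].
    intros M HM. destruct (Nat.eq_dec M (S K)) as [->|]; [apply Rmin_r|].
    eapply Rle_trans; [apply Rmin_l|apply H; lia]. }
destruct (Hfin N0) as (c & Hc & H).
exists (c * /2)%R; split; [lra|]; intros N.
destruct (le_dec N N0) as [HN|HN]; [specialize (H N HN); lra|].
replace N with (N0 + (N - N0))%nat by lia. rewrite qp_app, Cmod_mult.
apply Rmult_le_compat; try lra; auto.
Qed.
Lemma qpoch_inf_neq_0 a q : (Cmod q < 1)%R -> (forall k, 1 - a * q ^ k <> 0) -> qpoch_inf a q <> 0.
Proof.
intros Hq Hnz. destruct (qp_ge a q Hq Hnz) as (c & Hc & H).
apply Cmod_gt_0. pose proof (Clim_Cmod_ge _ _ _ (qp_cvg a q Hq) H); lra.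
Qed.
Lemma one_minus_neq_0 z : (Cmod z < 1)%R -> 1 - z <> 0.
Proof.
intros H E. replace z with (1 - (1 - z)) in H by ring. rewrite E in H.
replace (1 - 0) with (RtoC 1) in H by ring. rewrite Cmod_1 in H; lra.
Qed.
Lemma small_factor a q k : (Cmod q < 1)%R -> (Cmod a < 1)%R -> 1 - a * q ^ k <> 0.
Proof.
intros Hq Ha. apply one_minus_neq_0. rewrite Cmod_mult, Cmod_pow.
pose proof (Cmod_ge_0 q). pose proof (Cmod_ge_0 a). 
assert (Cmod q ^ k <= 1)%R. { rewrite <- (pow1 k); apply pow_incr; lra. }
assert (0 <= Cmod q ^ k)%R by (apply pow_le; lra). nra.
Qed.

(** * Gaussian binomials and Rothe's identity *)

Fixpoint gbin (Q : C) (M i : nat) : C :=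
  match M, i with
  | _, O => 1
  | O, S _ => 0
  | S M', S i' => gbin Q M' i' + Q ^ (S i') * gbin Q M' (S i')
  end.
Lemma gbin_0 Q M : gbin Q M 0 = 1. Proof. destruct M; reflexivity. Qed.
Lemma gbin_gt Q M i : (M < i)%nat -> gbin Q M i = 0.
Proof.
revert i; induction M as [|M IH]; intros [|i] H; try lia; [reflexivity|].
simpl. rewrite !IH by lia; ring.
Qed.
(** [qp Q Q i] is a q-factorial up to a power of 1 - Q, so this is the quotient formula with
    denominators cleared; the induction is Pascal's rule. *)
Lemma gbin_closed Q i j : gbin Q (i + j) i * (qp Q Q i * qp Q Q j) = qp Q Q (i + j).
Proof.
remember (i + j)%nat as n eqn:E. revert i j E.
induction n as [n IH] using lt_wf_ind; intros i j ->.
destruct i as [|i]; [simpl; rewrite gbin_0; ring|].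
destruct j as [|j].
{ rewrite Nat.add_0_r. enough (E : gbin Q (S i) (S i) = 1) by (rewrite E; simpl; ring).
  clear. induction i as [|i IH]; [simpl; ring|]. remember (S i) as k. simpl. rewrite IH, gbin_gt by lia. ring. }
replace (S i + S j)%nat with (S (i + S j))%nat by lia.
pose proof (IH (i + S j)%nat ltac:(lia) i (S j) eq_refl) as H1.
pose proof (IH (S i + j)%nat ltac:(lia) (S i) j eq_refl) as H2.
replace (S i + j)%nat with (i + S j)%nat in H2 by lia.
change (gbin Q (S (i + S j)) (S i)) with (gbin Q (i + S j) i + Q ^ (S i) * gbin Q (i + S j) (S i)).
transitivity ((gbin Q (i + S j) i * (qp Q Q i * qp Q Q (S j))) * (1 - Q * Q ^ i) +
   Q ^ S i * (gbin Q (i + S j) (S i) * (qp Q Q (S i) * qp Q Q j)) * (1 - Q * Q ^ j)).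
{ simpl; ring. }
rewrite H1, H2. 
change (qp Q Q (S (i + S j))) with (qp Q Q (i + S j) * (1 - Q * Q ^ (i + S j))).
rewrite Cpow_add_r; simpl; ring.
Qed.
Lemma lsum_seq_front (f : nat -> C) n : lsum f (seq 0 (S n)) = f O + lsum (fun i => f (S i)) (seq 0 n).
Proof. simpl. now rewrite <- seq_shift, lsum_map. Qed.
Definition rterm (V X : C) (i : nat) : C := cexp (RtoC (INR i * (INR i - 1) / 2) * V + RtoC (INR i) * X).
Lemma rterm_0 V X : rterm V X 0 = 1.
Proof.
unfold rterm; rewrite <- cexp_0; f_equal. change (INR 0) with 0%R.
replace (0 * (0 - 1) / 2)%R with 0%R by field. ring.
Qed.
(** The q-binomial theorem. Splitting off the first factor replaces X by X + V, and the two
    resulting sums combine by Pascal's rule. *)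
Lemma rothe V M X :
  qp (- cexp X) (cexp V) M = lsum (fun i => gbin (cexp V) M i * rterm V X i) (seq 0 (S M)).
Proof.
revert X; induction M as [|M IH]; intros X.
- change (RtoC 1 = 1 * rterm V X 0 + 0). rewrite rterm_0; ring.
- rewrite qp_front. replace (- cexp X * cexp V) with (- cexp (X + V)) by (rewrite cexp_plus; ring).
  rewrite IH. set (g := fun i => gbin (cexp V) M i * rterm V (X + V) i).
  assert (R1 : forall i, cexp X * rterm V (X + V) i = rterm V X (S i)).
  { intros i; unfold rterm; rewrite <- cexp_plus; f_equal.
    rewrite S_INR. replace ((INR i + 1) * (INR i + 1 - 1) / 2)%R with (INR i * (INR i - 1) / 2 + INR i)%R by field.
    rewrite !RtoC_plus; ring. }
  assert (R2 : forall i, rterm V (X + V) i = cexp V ^ i * rterm V X i).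
  { intros i; unfold rterm; rewrite <- cexp_nat, <- cexp_plus; f_equal; ring. }
  rewrite (lsum_seq_front _ (S M)), gbin_0, rterm_0.
  assert (Eg : lsum g (seq 0 (S M)) = 1 + lsum (fun i => g (S i)) (seq 0 (S M))).
  { transitivity (lsum g (seq 0 (S (S M)))).
    - rewrite (seq_S (S M)), lsum_app; simpl lsum at 3. unfold g at 3. rewrite gbin_gt by lia. ring.
    - rewrite lsum_seq_front. unfold g at 1; rewrite gbin_0, rterm_0; ring. }
  replace ((1 - - cexp X) * lsum g (seq 0 (S M))) with (lsum g (seq 0 (S M)) + cexp X * lsum g (seq 0 (S M))) by ring.
  rewrite Eg at 1. rewrite <- lsum_scal.
  replace (1 * 1) with (RtoC 1) by ring.
  rewrite <- Cplus_assoc; f_equal. rewrite <- lsum_plus. apply lsum_ext; intros i _.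
  change (gbin (cexp V) (S M) (S i)) with (gbin (cexp V) M i + cexp V ^ (S i) * gbin (cexp V) M (S i)).
  unfold g. rewrite <- R1, (R2 (S i)), <- R1. ring.
Qed.

Section Jacobi.
Variables (U V : C).
Hypothesis HV : (Re V < 0)%R.
Let Q := cexp V.
Let HQ : (Cmod Q < 1)%R.
Proof. unfold Q; rewrite Cmod_cexp, <- exp_0. apply exp_increasing; auto. Qed.

(** The test on the sign is essential: [Z.to_nat] sends negative numbers to 0, where the Gaussian
    binomial is 1 instead of 0. *)
Let G (N : nat) (j : Z) : C :=
  if Z_lt_dec (Z.of_nat N + j) 0 then 0 else gbin Q (N + N) (Z.to_nat (Z.of_nat N + j)).
Let jt (j : Z) : C := thterm (V / 2) (U - V / 2) j.

(** With u = e^U, each factor 1 + u Q^(-k) for 1 <= k <= N is u Q^(-k) times 1 + Q^k / u; the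
    prefactors multiply to the exponential. *)
Lemma reflect_factors N : qp (- cexp (U - RtoC (INR N) * V)) Q N =
  cexp (RtoC (INR N) * U - RtoC (INR N * (INR N + 1) / 2) * V) * qp (- cexp (V - U)) Q N.
Proof.
induction N as [|N IH].
- simpl. replace (0 * (0 + 1) / 2)%R with 0%R by field.
  replace (0 * U - 0 * V) with (RtoC 0) by ring. rewrite cexp_0; ring.
- rewrite qp_front. replace (- cexp (U - RtoC (INR (S N)) * V) * Q) with (- cexp (U - RtoC (INR N) * V)).
  2:{ unfold Q. rewrite S_INR, RtoC_plus. 
      rewrite (cexp_split (U - INR N * V) (U - (INR N + 1) * V) V) by ring. ring. }
  rewrite IH. change (qp (- cexp (V - U)) Q (S N)) with (qp (- cexp (V - U)) Q N * (1 - - cexp (V - U) * Q ^ N)).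
  unfold Q; rewrite <- cexp_nat.
  rewrite (cexp_split (RtoC (INR (S N)) * U - RtoC (INR (S N) * (INR (S N) + 1) / 2) * V)
    (U - INR (S N) * V) (RtoC (INR N) * U - RtoC (INR N * (INR N + 1) / 2) * V)).
  2:{ rewrite S_INR. replace ((INR N + 1) * (INR N + 1 + 1) / 2)%R with (INR N * (INR N + 1) / 2 + (INR N + 1))%R by field.
      rewrite !RtoC_plus; ring. }
  assert (E : cexp (U - INR (S N) * V) * (cexp (V - U) * cexp (INR N * V)) = 1).
  { rewrite <- !cexp_plus, <- cexp_0. f_equal. rewrite S_INR, RtoC_plus; ring. }
  set (x := cexp (U - INR (S N) * V)) in *. set (y := cexp (V - U) * cexp (INR N * V)) in *.
  replace (- cexp (V - U) * cexp (INR N * V)) with (- y) by (unfold y; ring).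
  transitivity ((x * y + x) * cexp (INR N * U - RtoC (INR N * (INR N + 1) / 2) * V) * qp (- cexp (V - U)) (cexp V) N); [rewrite E|]; ring.
Qed.

(** Rothe's identity for 2N factors starting at u Q^(-N): the first N are reflected, the last N are
    those of u itself, and the index is recentred by j = i - N. *)
Lemma finite_jacobi N : qp (- cexp U) Q N * qp (- cexp (V - U)) Q N = csum (fun j => G N j * jt j).
Proof.
pose (L := map (fun i => (Z.of_nat i - Z.of_nat N)%Z) (seq 0 (S (N + N)))).
rewrite (hsum_csum _ (lsum (fun j => G N j * jt j) L)).
2:{ apply hsum_finite.
    - apply FinFun.Injective_map_NoDup; [intros x y; lia|apply seq_NoDup].
    - intros j Hj. unfold G. destruct Z_lt_dec; [ring|].
      rewrite gbin_gt; [ring|].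
      apply Nat.nle_gt; intros Hle; apply Hj.
      apply in_map_iff; exists (Z.to_nat (Z.of_nat N + j)); split; [lia|]. apply in_seq; lia. }
unfold L; rewrite lsum_map.
apply (Cmult_cancel_r (cexp (RtoC (INR N) * U - RtoC (INR N * (INR N + 1) / 2) * V))); [apply cexp_neq0|].
transitivity (qp (- cexp (U - RtoC (INR N) * V)) Q (N + N)).
{ rewrite qp_app, reflect_factors.
  replace (- cexp (U - INR N * V) * Q ^ N) with (- cexp U); [ring|].
  unfold Q; rewrite <- cexp_nat. rewrite (cexp_split U (U - INR N * V) (INR N * V)) at 1 by ring. ring. }
unfold Q at 1. rewrite rothe. rewrite (Cmult_comm (lsum _ _) (cexp _)), <- lsum_scal.
apply lsum_ext; intros i Hi. unfold G.
destruct Z_lt_dec; [lia|].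
replace (Z.to_nat _) with i by lia. fold Q.
transitivity (gbin Q (N + N) i * (cexp (INR N * U - RtoC (INR N * (INR N + 1) / 2) * V) * jt (Z.of_nat i - Z.of_nat N))); [|ring].
f_equal. unfold rterm, jt, thterm. rewrite <- cexp_plus; f_equal.
rewrite minus_IZR, <- !INR_IZR_INZ. unfold Rdiv, Cdiv.
rewrite <- RtoC_inv by lra.
rewrite !RtoC_mult, !RtoC_minus, RtoC_plus.
assert (E : RtoC (/2) * 2 = 1) by (rewrite <- RtoC_mult; f_equal; field).
assert (E2 : RtoC 1 = 2 * RtoC (/2)) by (rewrite Cmult_comm; auto).
set (h := RtoC (/2)) in *. set (nn := RtoC (INR N)). set (k := RtoC (INR i)).
transitivity (nn * U - nn * (nn + 1) * h * V + ((k - nn) * (k - nn) * (V * h) + (k - nn) * (U - V * h)) + k * nn * V * (2 * h - 1)); [ring|rewrite <- E2]; ring.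
Qed.

(** The limit of [finite_jacobi]: every Gaussian binomial in it tends to 1/(Q;Q)_infinity, and all
    are bounded by B / c^2, where B and c bound |(Q;Q)_n| from above and below. *)
Lemma jacobi_triple :
  qpoch_inf Q Q * (qpoch_inf (- cexp U) Q * qpoch_inf (- cexp (V - U)) Q) = Theta (V / 2) (U - V / 2).
Proof.
assert (HA : (Re (V / 2) < 0)%R).
{ unfold Cdiv. rewrite Cmult_comm, <- RtoC_inv, Re_scal_R by lra. lra. }
assert (HQQ : forall k, 1 - Q * Q ^ k <> 0) by (intros k; now apply small_factor).
destruct (qp_ge Q Q HQ HQQ) as (c & Hc & Hge).
pose proof (qp_cvg Q Q HQ) as HE.
assert (HE0 : qpoch_inf Q Q <> 0) by now apply qpoch_inf_neq_0.
set (E := qpoch_inf Q Q) in *.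
assert (Hnz : forall n, qp Q Q n <> 0).
{ intros n; apply Cmod_gt_0; specialize (Hge n); lra. }
destruct (Clim_bounded _ _ HE) as [B HB].
assert (Hlim : Clim (fun N => csum (fun j => G N j * jt j)) (csum (fun j => / E * jt j))).
{ apply (dominated_convergence _ _ (fun j => RtoC (B / (c * c)) * jt j)).
  - apply summable_scal. now apply summable_thterm.
  - intros N j. rewrite !Cmod_mult. apply Rmult_le_compat_r; [apply Cmod_ge_0|].
    assert (HB0 : (0 <= B)%R) by (eapply Rle_trans; [apply Cmod_ge_0|apply (HB O)]).
    assert (HBc : (0 <= B / (c * c))%R) by (apply Rdiv_le_0_compat; nra).
    rewrite Cmod_R, Rabs_pos_eq by auto. unfold G. destruct Z_lt_dec; [rewrite Cmod_0; auto|].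
    set (i := Z.to_nat _). destruct (le_dec i (N + N)) as [Hi|Hi]; [|rewrite gbin_gt, Cmod_0 by lia; auto].
    replace (N + N)%nat with (i + (N + N - i))%nat by lia.
    set (k := (N + N - i)%nat). pose proof (gbin_closed Q i k) as H.
    apply (f_equal Cmod) in H. rewrite !Cmod_mult in H.
    pose proof (Hge i). pose proof (Hge k). specialize (HB (i + k)%nat).
    pose proof (Cmod_ge_0 (gbin Q (i + k) i)).
    apply (Rmult_le_reg_r (c * c)); [nra|].
    replace (B / (c * c) * (c * c))%R with B by (field; lra).
    rewrite <- H in HB. eapply Rle_trans; [|exact HB].
    apply Rmult_le_compat_l; auto. apply Rmult_le_compat; lra.
  - intros j. rewrite (Cmult_comm (/ E)).
    apply (Clim_ext (fun N => jt j * G N j)); [intros; ring|]. apply Clim_scal.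
    assert (HG : exists N0, forall N, (N0 <= N)%nat -> G N j = 
      qp Q Q (N + N) / (qp Q Q (Z.to_nat (Z.of_nat N + j)) * qp Q Q (Z.to_nat (Z.of_nat N - j)))).
    { exists (Z.to_nat (Z.abs j)); intros N HN. unfold G. destruct Z_lt_dec; [lia|].
      replace (N + N)%nat with (Z.to_nat (Z.of_nat N + j) + Z.to_nat (Z.of_nat N - j))%nat by lia.
      rewrite <- gbin_closed. field. auto. }
    destruct HG as [N0 HG].
    assert (Hl : forall s : Z, Clim (fun N => qp Q Q (Z.to_nat (Z.of_nat N + s))) E).
    { intros s eps He. destruct (HE eps He) as [N1 H1]. exists (N1 + Z.to_nat (Z.abs s))%nat.
      intros n Hn; apply H1; lia. }
    assert (Hinv : forall u, Clim u E -> (forall n, c <= Cmod (u n))%R -> Clim (fun n => / u n) (/ E)).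
    { intros u Hu Hcu eps He. pose proof (proj1 (Cmod_gt_0 E) HE0) as HEp.
      destruct (Hu (eps * (c * Cmod E))%R) as [N1 H1]; [apply Rmult_lt_0_compat; auto; nra|].
      exists N1; intros n Hn. specialize (H1 n Hn). specialize (Hcu n).
      assert (Hun : u n <> 0) by (apply Cmod_gt_0; lra).
      replace (/ u n - / E) with (- (u n - E) / (u n * E)) by (field; auto).
      rewrite Cmod_div, Cmod_opp, Cmod_mult by (apply Cmult_neq_0; auto).
      apply (Rmult_lt_reg_r (Cmod (u n) * Cmod E)); [apply Rmult_lt_0_compat; lra|].
      unfold Rdiv; rewrite Rmult_assoc, Rinv_l, Rmult_1_r by (apply Rgt_not_eq, Rmult_lt_0_compat; lra).
      eapply Rlt_le_trans; [exact H1|]. apply Rmult_le_compat_l; [lra|].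
      apply Rmult_le_compat_r; lra. }
    assert (Hf : Clim (fun N => qp Q Q (N + N) * (/ qp Q Q (Z.to_nat (Z.of_nat N + j)) * / qp Q Q (Z.to_nat (Z.of_nat N + - j))))
       (E * (/ E * / E))).
    { apply Clim_mult; [apply (Clim_sub (fun n => n + n)%nat); auto; intros; lia|].
      apply Clim_mult; apply Hinv; auto. }
    replace (E * (/ E * / E)) with (/ E) in Hf by (field; auto).
    intros eps He. destruct (Hf eps He) as [N1 H1]. exists (N0 + N1)%nat; intros n Hn.
    specialize (H1 n ltac:(lia)). rewrite HG by lia.
    replace (_ / _) with (qp Q Q (n + n) * (/ qp Q Q (Z.to_nat (Z.of_nat n + j)) * / qp Q Q (Z.to_nat (Z.of_nat n + - j)))); auto.
    replace (Z.of_nat n + - j)%Z with (Z.of_nat n - j)%Z by lia. field; auto. }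
assert (Hlim2 : Clim (fun N => csum (fun j => G N j * jt j)) (qpoch_inf (- cexp U) Q * qpoch_inf (- cexp (V - U)) Q)).
{ apply (Clim_ext _ _ _ (finite_jacobi)). apply Clim_mult; now apply qp_cvg. }
rewrite (Clim_unique _ _ _ Hlim2 Hlim).
rewrite csum_scal by now apply summable_thterm. unfold jt. change (E * (/ E * Theta (V / 2) (U - V / 2)) = Theta (V / 2) (U - V / 2)). field; auto.
Qed.

Lemma Theta_neq_0 : (forall k, 1 + cexp U * Q ^ k <> 0) -> (forall k, 1 + cexp (V - U) * Q ^ k <> 0) ->
  Theta (V / 2) (U - V / 2) <> 0.
Proof.
intros H1 H2. rewrite <- jacobi_triple. repeat apply Cmult_neq_0; apply qpoch_inf_neq_0; auto.
- intros k; now apply small_factor.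
- intros k E; apply (H1 k). rewrite <- E; ring.
- intros k E; apply (H2 k). rewrite <- E; ring.
Qed.
End Jacobi.

Lemma Cmod_cexp_lt1 z : (Re z < 0)%R -> (Cmod (cexp z) < 1)%R.
Proof. intros H; rewrite Cmod_cexp, <- exp_0; now apply exp_increasing. Qed.

(** Zeros of a theta function come only from the factors of its product; in this strip both product
    variables have modulus less than 1. *)
Lemma Theta_neq_0_strip A B : (Rabs (Re B) < - Re A)%R -> Theta A B <> 0.
Proof.
intros H. apply Rabs_def2 in H.
assert (E2 : 2 * A / 2 = A) by (field; apply RtoC_neq_0; lra).
replace (Theta A B) with (Theta (2 * A / 2) ((B + A) - 2 * A / 2)).
2:{ rewrite E2; f_equal; ring. }
assert (HV : (Re (2 * A) < 0)%R) by (rewrite Re_scal_R; lra).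
assert (P : forall z k, (Re z < 0)%R -> 1 + cexp z * cexp (2 * A) ^ k <> 0).
{ intros z k Hz. replace (1 + cexp z * cexp (2 * A) ^ k) with (1 - (- cexp z) * cexp (2 * A) ^ k) by ring.
  apply small_factor; [|rewrite Cmod_opp]; now apply Cmod_cexp_lt1. }
apply Theta_neq_0; auto; intros k; apply P.
- rewrite Re_plus; lra.
- rewrite Re_minus, Re_plus, Re_scal_R; lra.
Qed.
Lemma Theta_neq_0_edge A : (Re A < 0)%R -> Theta A A <> 0.
Proof.
intros H.
assert (E2 : 2 * A / 2 = A) by (field; apply RtoC_neq_0; lra).
replace (Theta A A) with (Theta (2 * A / 2) (2 * A - 2 * A / 2)).
2:{ rewrite E2; f_equal; ring. }
assert (HV : (Re (2 * A) < 0)%R) by (rewrite Re_scal_R; lra).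
apply Theta_neq_0; auto; intros k.
- replace (1 + cexp (2 * A) * cexp (2 * A) ^ k) with (1 - (- cexp (2 * A)) * cexp (2 * A) ^ k) by ring.
  apply small_factor; [|rewrite Cmod_opp]; now apply Cmod_cexp_lt1.
(* On the edge of the strip the factor with k = 0 is 1 + 1, and the later ones behave as in the
   interior. *)
- replace (2 * A - 2 * A) with (RtoC 0) by ring. rewrite cexp_0.
  destruct k as [|k].
  + simpl. rewrite Cmult_1_l, <- RtoC_plus. apply RtoC_neq_0; lra.
  + replace (1 + 1 * cexp (2 * A) ^ S k) with (1 - (- cexp (2 * A)) * cexp (2 * A) ^ k) by (simpl; ring).
    apply small_factor; [|rewrite Cmod_opp]; now apply Cmod_cexp_lt1.
Qed.

(** * Theta inversion *)

Lemma Cmod_le_Re_Im z : (Cmod z <= Rabs (Re z) + Rabs (Im z))%R.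
Proof.
destruct z as [x y]. replace (x, y) with (RtoC x + RtoC y * Ci).
2:{ apply injective_projections; simpl; ring. }
eapply Rle_trans; [apply Cmod_triangle|]. rewrite Cmod_mult, !Cmod_R, Cmod_Ci; simpl.
replace (x + (y * 0 - 0 * 1))%R with x by ring. replace (0 + (y * 1 + 0 * 0))%R with y by ring. lra.
Qed.
Lemma exp_le x y : (x <= y)%R -> (exp x <= exp y)%R.
Proof. intros [H| ->]; [left; now apply exp_increasing|lra]. Qed.
Lemma exp_ge_1 x : (0 <= x)%R -> (1 <= exp x)%R.
Proof. intros H; rewrite <- exp_0; now apply exp_le. Qed.
Lemma exp_sub_1_le x : (exp x - 1 <= x * exp x)%R.
Proof.
pose proof (exp_ineq1_le (- x)) as H. rewrite exp_Ropp in H. pose proof (exp_pos x) as Hp.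
apply (Rmult_le_compat_r (exp x)) in H; [|lra]. rewrite Rinv_l in H by lra. lra.
Qed.
Lemma Rabs_exp_sub_1 x : (Rabs (exp x - 1) <= Rabs x * exp (Rabs x))%R.
Proof.
pose proof (exp_sub_1_le x). pose proof (exp_ineq1_le x). pose proof (exp_pos x).
destruct (Rle_dec 0 x) as [Hx|Hx].
- rewrite (Rabs_pos_eq x), Rabs_pos_eq by lra. lra.
- rewrite (Rabs_left x) by lra. rewrite Rabs_left1.
  + pose proof (exp_ge_1 (- x) ltac:(lra)). nra.
  + assert (exp x < exp 0)%R by (apply exp_increasing; lra). rewrite exp_0 in *; lra.
Qed.
Lemma Rabs_exp_sub_2 x : (Rabs (exp x - 1 - x) <= x * x * exp (Rabs x))%R.
Proof.
pose proof (exp_sub_1_le x). pose proof (exp_ineq1_le x). pose proof (exp_pos x).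
rewrite Rabs_pos_eq by lra.
destruct (Rle_dec 0 x) as [Hx|Hx].
- rewrite (Rabs_pos_eq x) by lra. nra.
- pose proof (exp_ge_1 (Rabs x) (Rabs_pos _)). nra.
Qed.
Lemma Rabs_sin_le y : (Rabs (sin y) <= Rabs y)%R.
Proof.
destruct (MVT_abs sin cos 0 y) as (c & Hc & _); [intros; apply derivable_pt_lim_sin|].
rewrite sin_0, !Rminus_0_r in Hc. rewrite Hc.
pose proof (COS_bound c). pose proof (Rabs_pos y).
assert (Rabs (cos c) <= 1)%R by (apply Rabs_le; lra). nra.
Qed.
Lemma Rabs_cos_sub_1 y : (Rabs (cos y - 1) <= Rabs y)%R.
Proof.
destruct (MVT_abs cos (fun x => - sin x)%R 0 y) as (c & Hc & _); [intros; apply derivable_pt_lim_cos|].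
rewrite cos_0, !Rminus_0_r in Hc. rewrite Hc.
pose proof (SIN_bound c). pose proof (Rabs_pos y).
assert (Rabs (- sin c) <= 1)%R by (apply Rabs_le; lra). nra.
Qed.
Lemma Rabs_cos_sub_1' y : (Rabs (cos y - 1) <= y * y)%R.
Proof.
destruct (MVT_abs cos (fun x => - sin x)%R 0 y) as (c & Hc & Hb); [intros; apply derivable_pt_lim_cos|].
rewrite cos_0, !Rminus_0_r in *. rewrite Hc, Rabs_Ropp.
pose proof (Rabs_sin_le c). pose proof (Rabs_pos y). pose proof (Rabs_pos (sin c)).
assert (Rabs c <= Rabs y)%R.
{ unfold Rmin, Rmax in Hb. unfold Rabs; repeat destruct Rcase_abs; destruct (Rle_dec 0 y); lra. }
assert (E : (y * y = Rabs y * Rabs y)%R) by (rewrite <- Rabs_mult, Rabs_pos_eq; auto; apply Rle_0_sqr).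
rewrite E. apply Rmult_le_compat_r; lra.
Qed.
Lemma Rabs_sin_sub y : (Rabs (sin y - y) <= y * y)%R.
Proof.
destruct (MVT_abs (fun x => sin x - x)%R (fun x => cos x - 1)%R 0 y) as (c & Hc & Hb).
{ intros c _. apply derivable_pt_lim_minus; [apply derivable_pt_lim_sin|apply derivable_pt_lim_id]. }
rewrite sin_0, !Rminus_0_r in *. rewrite Hc.
pose proof (Rabs_cos_sub_1 c). pose proof (Rabs_pos y). pose proof (Rabs_pos (cos c - 1)).
assert (Rabs c <= Rabs y)%R.
{ unfold Rmin, Rmax in Hb. unfold Rabs; repeat destruct Rcase_abs; destruct (Rle_dec 0 y); lra. }
assert (E : (y * y = Rabs y * Rabs y)%R) by (rewrite <- Rabs_mult, Rabs_pos_eq; auto; apply Rle_0_sqr).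
rewrite E. apply Rmult_le_compat_r; lra.
Qed.
Lemma cexp_taylor z : (Cmod (cexp z - 1 - z) <= 3 * (Cmod z * Cmod z) * exp (Cmod z))%R.
Proof.
destruct z as [x y].
assert (Hx : (Rabs x <= Cmod (x, y))%R) by apply (re_le_Cmod (x, y)).
assert (Hy : (Rabs y <= Cmod (x, y))%R) by apply (Rabs_Im_Cmod (x, y)).
set (m := Cmod (x, y)) in *.
eapply Rle_trans; [apply Cmod_le_Re_Im|].
replace (cexp (x, y) - 1 - (x, y)) with ((exp x - 1 - x) + exp x * (cos y - 1), (exp x - 1) * sin y + (sin y - y))%R.
2:{ unfold cexp; apply injective_projections; simpl; ring. }
simpl Re; simpl Im.
assert (E1 : (exp x <= exp m)%R) by (apply exp_le; pose proof (Rle_abs x); lra).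
assert (E2 : (exp (Rabs x) <= exp m)%R) by (apply exp_le; lra).
assert (E3 : (1 <= exp m)%R) by (apply exp_ge_1; pose proof (Rabs_pos x); lra).
pose proof (Rabs_pos x). pose proof (Rabs_pos y).
assert (Sx : (x * x = Rabs x * Rabs x)%R) by (rewrite <- Rabs_mult, Rabs_pos_eq; auto; apply Rle_0_sqr).
assert (Sy : (y * y = Rabs y * Rabs y)%R) by (rewrite <- Rabs_mult, Rabs_pos_eq; auto; apply Rle_0_sqr).
assert (Sm : (m * m = x * x + y * y)%R).
{ unfold m, Cmod; simpl. rewrite sqrt_sqrt; [ring|]. nra. }
pose proof (Rabs_exp_sub_2 x) as A1. pose proof (Rabs_cos_sub_1' y) as A2.
pose proof (Rabs_exp_sub_1 x) as A3. pose proof (Rabs_sin_le y) as A4. pose proof (Rabs_sin_sub y) as A5.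
pose proof (Rabs_triang (exp x - 1 - x) (exp x * (cos y - 1))) as T1.
pose proof (Rabs_triang ((exp x - 1) * sin y) (sin y - y)) as T2.
rewrite !Rabs_mult in T1, T2. rewrite (Rabs_pos_eq (exp x)) in T1 by (left; apply exp_pos).
assert (B1 : (Rabs (exp x - 1 - x) <= x * x * exp m)%R) by nra.
assert (B2 : (exp x * Rabs (cos y - 1) <= exp m * (y * y))%R).
{ apply Rmult_le_compat; auto; [left; apply exp_pos|apply Rabs_pos]. }
assert (B3 : (Rabs (exp x - 1) * Rabs (sin y) <= (Rabs x * exp m) * Rabs y)%R).
{ apply Rmult_le_compat; try apply Rabs_pos; auto. nra. }
assert (B4 : (Rabs (sin y - y) <= exp m * (y * y))%R) by nra.
assert (B5 : (Rabs x * Rabs y <= x * x + y * y)%R) by nra.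
nra.
Qed.

(** Subtracting the integer part of x costs at most a factor e, so the bound is uniform in x. *)
Lemma shift_exp_bound : exists C1, (0 < C1)%R /\ forall x L, NoDup L ->
  (rsum (fun n : Z => exp (- Rabs (x + IZR n))) L <= C1)%R.
Proof.
destruct summable_exp_abs as [B HB].
exists (exp 1 * B + 1)%R; split.
{ pose proof (HB nil (NoDup_nil _)). simpl in H. pose proof (exp_pos 1). nra. }
intros x L HL. pose (m := Int_part x).
destruct (base_Int_part x) as [H1 H2]. fold m in H1, H2.
specialize (HB (map (fun n => n + m)%Z L)).
rewrite rsum_map in HB.
assert (HN : NoDup (map (fun n => n + m)%Z L)) by (apply FinFun.Injective_map_NoDup; auto; intros a b; lia).
specialize (HB HN).
apply Rle_trans with (rsum (fun n => exp 1 * exp (- Rabs (IZR (n + m))))%R L).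
- apply rsum_le; intros n _. rewrite <- exp_plus. apply exp_le. rewrite plus_IZR.
  pose proof (Rabs_triang_inv (IZR n + IZR m) (IZR m - x)) as T.
  assert (Rabs (IZR m - x) <= 1)%R by (apply Rabs_le; lra).
  replace (IZR n + IZR m - (IZR m - x))%R with (x + IZR n)%R in T by ring. lra.
- rewrite rsum_scal.
  assert (E : rsum (fun i => Cmod (exp (- Rabs (IZR (i + m))))) L = rsum (fun n => exp (- Rabs (IZR (n + m)))) L).
  { apply Rle_antisym; apply rsum_le; intros; rewrite Cmod_R, (Rabs_pos_eq (exp _)) by (left; apply exp_pos); lra. }
  rewrite E in HB. pose proof (exp_pos 1). nra.
Qed.

Lemma summable_inv_sqr : summable (fun k : Z => RtoC (/ (IZR k * IZR k))).
Proof.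
assert (Hn : summable (fun n : nat => RtoC (/ (INR (S n) * INR (S n))))).
{ exists 2%R. apply summable_nat_bound; intros N.
  apply Rle_trans with (2 - 2 / INR (S N))%R.
  - induction N as [|N IH]; [simpl; lra|].
    rewrite seq_S, rsum_app; cbn [rsum fold_right Nat.add].
    rewrite Cmod_R, Rabs_pos_eq.
    2:{ left; apply Rinv_0_lt_compat, Rmult_lt_0_compat; apply lt_0_INR; lia. }
    assert (HS : (1 <= INR (S N))%R) by (apply (le_INR 1); lia).
    rewrite (S_INR (S N)). set (t := INR (S N)) in *.
    assert (/ (t * t) <= 2 / t - 2 / (t + 1))%R; [|lra].
    replace (2 / t - 2 / (t + 1))%R with (/ (t * ((t + 1) / 2)))%R by (field; lra).
    apply Rinv_le_contravar; [nra|]. apply Rmult_le_compat_l; lra.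
  - assert (0 < 2 / INR (S N))%R by (apply Rdiv_lt_0_compat; [lra|apply lt_0_INR; lia]). lra. }
apply summable_Z.
- apply (summable_le _ (fun n => RtoC 4 * RtoC (/ (INR (S n) * INR (S n))))); [|now apply summable_scal].
  intros n. rewrite <- RtoC_mult, !Cmod_R. rewrite <- INR_IZR_INZ.
  assert (HS : (1 <= INR (S n))%R) by (apply (le_INR 1); lia).
  rewrite (Rabs_pos_eq (4 * _)).
  2:{ apply Rmult_le_pos; [lra|]. left; apply Rinv_0_lt_compat; nra. }
  destruct n as [|n].
  + simpl INR. rewrite Rmult_0_l, Rinv_0, Rabs_R0. lra.
  + rewrite (S_INR (S n)) in *.
    assert (HS' : (1 <= INR (S n))%R) by (apply (le_INR 1); lia). set (t := INR (S n)) in *.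
    rewrite Rabs_pos_eq by (left; apply Rinv_0_lt_compat; nra).
    replace (4 * / ((t + 1) * (t + 1)))%R with (/ (((t + 1) / 2) * ((t + 1) / 2)))%R by (field; lra).
    apply Rinv_le_contravar; [nra|]. apply Rmult_le_compat; lra.
- eapply summable_ext; [|exact Hn]. intros n; cbv beta. apply f_equal, f_equal.
  rewrite minus_IZR, <- INR_IZR_INZ, S_INR. ring.
Qed.

Lemma chi_neq_1 r : (0 < r < 1)%R -> chi r <> 1.
Proof.
unfold chi; intros Hr E. pose proof PI_RGT_0.
assert (H1 : cos (2 * (r * PI)) = 1%R).
{ replace (RtoC r * (2 * PiI)) with ((0, 2 * (r * PI))%R : C) in E.
  - apply (f_equal Re) in E. unfold cexp in E; simpl in E. rewrite exp_0 in E. lra.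
  - unfold PiI; apply injective_projections; simpl; ring. }
rewrite cos_2a_sin in H1.
assert (sin (r * PI) = 0)%R by nra.
assert (0 < sin (r * PI))%R by (apply sin_gt_0; nra). lra.
Qed.
(** With pi >= 3 it yields |x| <= sin(pi |x|) for |x| <= 1/2, the lower bound needed for second
    differences of characters. *)
Lemma sin_ge_third x : (0 <= x <= PI / 2)%R -> (x / 3 <= sin x)%R.
Proof.
intros Hx. pose proof PI_4. pose proof PI_RGT_0.
destruct (sin_bound x 0) as [H1 _]; try lra.
unfold sin_approx, sin_term in H1; simpl in H1.
assert (E : (x * x <= 4)%R) by nra.
assert (x - x * (x * x) / 6 <= sin x)%R; [|nra].
eapply Rle_trans; [|exact H1]. right; field.
Qed.

Lemma lsum_exchange {I J} (f : I -> J -> C) L K :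
  lsum (fun i => lsum (f i) K) L = lsum (fun j => lsum (fun i => f i j) L) K.
Proof.
induction L as [|a L IH]; simpl.
- symmetry; now apply lsum_zero.
- rewrite IH, <- lsum_plus. reflexivity.
Qed.
Lemma lsum_periodic (h : nat -> C) N : h N = h O -> lsum (fun j => h (S j)) (seq 0 N) = lsum h (seq 0 N).
Proof.
intros E. assert (H : lsum h (seq 0 (S N)) = h O + lsum (fun j => h (S j)) (seq 0 N)) by apply lsum_seq_front.
rewrite seq_S, lsum_app in H. simpl in H. rewrite E in H.
replace (lsum (fun j => h (S j)) (seq 0 N)) with (h O + lsum (fun j => h (S j)) (seq 0 N) - h O) by ring.
rewrite <- H; ring.
Qed.

Lemma chi_sum N j s : (0 < j < N)%nat ->
  lsum (fun i => chi (- ((INR i - s) * (INR j / INR N)))) (seq 0 N) = 0.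
Proof.
intros Hj. assert (HN : (0 < INR N)%R) by (apply lt_0_INR; lia).
pose (t := (INR j / INR N)%R). pose (om := chi (- t)).
rewrite (lsum_ext _ (fun i => chi (s * t) * om ^ i)).
2:{ intros i _. unfold om. rewrite chi_pow, <- chi_add. f_equal. unfold t; ring. }
rewrite lsum_scal.
assert (Hom : om ^ N = 1).
{ unfold om. rewrite chi_pow, <- (chi_IZR (- Z.of_nat j)). f_equal.
  rewrite opp_IZR, <- INR_IZR_INZ. unfold t; field; lra. }
assert (Hne : om - 1 <> 0).
{ intros Eo. apply (chi_neq_1 t).
  - split; [apply Rdiv_lt_0_compat; auto; apply lt_0_INR; lia|].
    apply (Rmult_lt_reg_r (INR N)); auto. unfold t, Rdiv. rewrite Rmult_assoc, Rinv_l, Rmult_1_r, Rmult_1_l by lra.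
    apply lt_INR; lia.
  - transitivity (chi t * om); [|rewrite <- (chi_IZR 0); unfold om; rewrite <- chi_add; f_equal; ring].
    replace om with (om - 1 + 1) by ring. rewrite Eo; ring. }
apply (Cmult_cancel_r (om - 1)); auto. rewrite <- Cmult_assoc, (Cmult_comm (lsum _ _)), lsum_geom, Hom. ring.
Qed.

(* Poisson summation without integrals: the periodised Gaussian [G] is recovered exactly from its discrete Fourier
   coefficients at 2M + 1 nodes. Quasi-periodicity under tau makes these coefficients theta terms times means of [G] over
   shifted nodes, and these means become independent of the shift as M grows. *)
Section Poisson.
Variables (c0 tau : C).
Hypothesis Hc0 : (Re c0 < 0)%R.
Hypothesis Htau : c0 * tau = - PiI.
Let A := PiI * tau.
Hypothesis HA : (Re A < 0)%R.

Let g (w : C) : C := cexp (c0 * (w * w)).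
Let g1 (w : C) : C := 2 * c0 * w * g w.

(** In a horizontal strip the Gaussian, its derivative [g1] and its second-order Taylor remainder
    decay like e^(-|Re w|) with one constant; this makes termwise estimates of the periodised
    function possible. *)
Lemma gaussian_bounds Y : exists K, (0 < K)%R /\ forall w, (Rabs (Im w) <= Y)%R ->
  (Cmod (g w) <= K * exp (- Rabs (Re w)))%R /\
  (Cmod (g1 w) <= K * exp (- Rabs (Re w)))%R /\
  forall d, (Cmod d <= 1)%R ->
    (Cmod (g (w + d) - g w - d * g1 w) <= Cmod d * Cmod d * (K * exp (- Rabs (Re w))))%R.
Proof.
set (a := Re c0). set (b := Im c0). set (m := Cmod c0).
pose (B := (2 * Rabs b * Rabs Y + 6 * m)%R).
pose (K0 := ((Rabs B + 1) * (Rabs B + 1) / (-4 * a) + Rabs a * (Y * Y) + 6 * m * Rabs Y + 3 * m)%R).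
assert (Hm : (0 <= m)%R) by apply Cmod_ge_0.
exists ((3 + m) * exp K0)%R; split; [pose proof (exp_pos K0); nra|].
intros w Hw. set (x := Re w) in *. set (v := Im w) in *.
assert (HYv : (Rabs v <= Rabs Y)%R) by (eapply Rle_trans; [exact Hw|apply Rle_abs]).
(* For |d| <= 1 the exponent of g(w + d) differs from that of g(w) by at most |d| t. All polynomial
   and exponential losses in t are absorbed in e^(3t), which grows slower than the Gaussian
   decays. *)
pose (t := (m * (2 * Cmod w + 1))%R).
assert (Hwx : (Cmod w <= Rabs x + Rabs Y)%R).
{ eapply Rle_trans; [apply Cmod_le_Re_Im|]. fold x v. lra. }
pose proof (Cmod_ge_0 w) as Hw0.
assert (Ht0 : (0 <= t)%R) by (unfold t; nra).
assert (Hg : Cmod (g w) = exp (a * (x * x - v * v) - 2 * b * x * v)).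
{ unfold g; rewrite Cmod_cexp; f_equal. unfold a, b, x, v. destruct c0, w; unfold Re, Im; simpl; ring. }
assert (Hexp : (Cmod (g w) * exp (3 * t) <= exp K0 * exp (- Rabs x))%R).
{ rewrite Hg, <- !exp_plus. apply exp_le.
  pose proof (gauss_le a B (Rabs x) Hc0) as GL. rewrite Rabs_Rabsolu in GL.
  assert (Sx : (x * x = Rabs x * Rabs x)%R) by (rewrite <- Rabs_mult, Rabs_pos_eq; auto; apply Rle_0_sqr).
  assert (T1 : (3 * t <= 6 * m * Rabs x + 6 * m * Rabs Y + 3 * m)%R) by (unfold t; nra).
  assert (T2 : (- (a * (v * v)) <= Rabs a * (Y * Y))%R).
  { assert (Sv : (v * v <= Y * Y)%R).
    { replace (v * v)%R with (Rabs v * Rabs v)%R by (rewrite <- Rabs_mult, Rabs_pos_eq; auto; apply Rle_0_sqr).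
      replace (Y * Y)%R with (Rabs Y * Rabs Y)%R by (rewrite <- Rabs_mult, Rabs_pos_eq; auto; apply Rle_0_sqr).
      pose proof (Rabs_pos v). nra. }
    rewrite Rabs_left by exact Hc0. fold a in Hc0. nra. }
  assert (T3 : (- 2 * b * x * v <= 2 * Rabs b * Rabs Y * Rabs x)%R).
  { eapply Rle_trans; [apply Rle_abs|]. rewrite !Rabs_mult. rewrite (Rabs_left (-2)) by lra.
    pose proof (Rabs_pos b). pose proof (Rabs_pos x). 
    assert (0 <= Rabs b * Rabs x)%R by nra.
    assert (Rabs b * Rabs x * Rabs v <= Rabs b * Rabs x * Rabs Y)%R by (apply Rmult_le_compat_l; auto). lra. }
  assert (E1 : (a * (x * x) = Rabs x * Rabs x * a)%R) by (rewrite Sx; ring).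
  assert (E2 : (Rabs x * B = 2 * Rabs b * Rabs Y * Rabs x + 6 * m * Rabs x)%R) by (unfold B; ring).
  unfold K0. lra. }
pose proof (exp_pos (- Rabs x)) as Pex. pose proof (exp_pos K0) as PK. pose proof (Cmod_ge_0 (g w)) as Pg.
pose proof (exp_ge_1 (3 * t) ltac:(lra)) as E3.
assert (Et : (t <= exp t)%R) by (pose proof (exp_ineq1_le t); lra).
assert (Et3 : exp (3 * t) = (exp t * exp t * exp t)%R).
{ rewrite <- !exp_plus; f_equal; ring. }
assert (E1 : (1 <= exp t)%R) by (apply exp_ge_1; auto).
assert (Ht3 : (t <= exp (3 * t))%R) by (rewrite Et3; nra).
assert (Htt : (t * t * exp t <= exp (3 * t))%R).
{ rewrite Et3. apply Rmult_le_compat_r; [lra|]. apply Rmult_le_compat; lra. }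
assert (Hgw : (Cmod (g w) <= exp K0 * exp (- Rabs x))%R) by nra.
assert (PP : (0 <= exp K0 * exp (- Rabs x))%R) by nra.
split; [nra|split].
- unfold g1. rewrite !Cmod_mult. fold m. rewrite Cmod_R, Rabs_pos_eq by lra.
  assert (2 * m * Cmod w * Cmod (g w) <= exp (3 * t) * Cmod (g w))%R; [|nra].
  apply Rmult_le_compat_r; auto. unfold t in Ht3 |- *. nra.
- intros d Hd. set (a1 := 2 * c0 * w * d + c0 * (d * d)).
  replace (g (w + d) - g w - d * g1 w) with (g w * ((cexp a1 - 1 - a1) + c0 * (d * d))).
  2:{ unfold g1. replace (g (w + d)) with (g w * cexp a1); [unfold a1; ring|].
      unfold g, a1; rewrite <- cexp_plus; f_equal; ring. }
  rewrite Cmod_mult. set (r := Cmod d) in *.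
  assert (Hr : (0 <= r)%R) by apply Cmod_ge_0.
  assert (Ha1 : (Cmod a1 <= r * t)%R).
  { unfold a1. eapply Rle_trans; [apply Cmod_triangle|]. rewrite !Cmod_mult. fold m r.
    rewrite Cmod_R, Rabs_pos_eq by lra. unfold t.
    assert (m * (r * r) <= m * r)%R by (apply Rmult_le_compat_l; nra). nra. }
  assert (Ha1t : (Cmod a1 <= t)%R) by nra.
  pose proof (Cmod_ge_0 a1) as Pa1.
  assert (HT : (Cmod (cexp a1 - 1 - a1) <= 3 * (r * r) * exp (3 * t))%R).
  { eapply Rle_trans; [apply cexp_taylor|].
    apply Rle_trans with (3 * (r * r) * (t * t * exp t))%R.
    - replace (3 * (r * r) * (t * t * exp t))%R with ((3 * ((r * t) * (r * t))) * exp t)%R by ring.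
      apply Rmult_le_compat; [nra|left; apply exp_pos| |apply exp_le; auto].
      apply Rmult_le_compat_l; [lra|]. apply Rmult_le_compat; auto.
    - apply Rmult_le_compat_l; nra. }
  assert (HC : (Cmod (cexp a1 - 1 - a1 + c0 * (d * d)) <= (3 + m) * (r * r) * exp (3 * t))%R).
  { eapply Rle_trans; [apply Cmod_triangle|]. rewrite !Cmod_mult. fold m r.
    assert (m * (r * r) * 1 <= m * (r * r) * exp (3 * t))%R by (apply Rmult_le_compat_l; nra). lra. }
  apply Rle_trans with (Cmod (g w) * ((3 + m) * (r * r) * exp (3 * t)))%R; [apply Rmult_le_compat_l; auto|].
  replace (Cmod (g w) * ((3 + m) * (r * r) * exp (3 * t)))%R with ((r * r) * ((3 + m) * (Cmod (g w) * exp (3 * t))))%R by ring.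
  apply Rmult_le_compat_l; [nra|]. rewrite Rmult_assoc. apply Rmult_le_compat_l; lra.
Qed.

Let G (z : C) : C := csum (fun n : Z => g (z + RtoC (IZR n))).
Let G1 (z : C) : C := csum (fun n : Z => g1 (z + RtoC (IZR n))).

Lemma translates_sum_bound (f : C -> C) K (w : C) :
  (0 < K)%R -> (forall n : Z, Cmod (f (w + RtoC (IZR n))%C) <= K * exp (- Rabs (Re w + IZR n)))%R ->
  forall C1, (forall L, NoDup L -> (rsum (fun n : Z => exp (- Rabs (Re w + IZR n))) L <= C1)%R) ->
  forall L, NoDup L -> (rsum (fun n : Z => Cmod (f (w + RtoC (IZR n))%C)) L <= K * C1)%R.
Proof.
intros HK Hf C1 HC L HL.
eapply Rle_trans; [apply rsum_le; intros; apply Hf|]. rewrite rsum_scal.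
apply Rmult_le_compat_l; [lra|auto].
Qed.

Lemma Re_translate w (n : Z) : Re (w + RtoC (IZR n)) = (Re w + IZR n)%R. Proof. reflexivity. Qed.
Lemma Im_translate w (n : R) : Im (w + RtoC n) = Im w. Proof. unfold Im; simpl; ring. Qed.

Lemma summable_g w : summable (fun n : Z => g (w + RtoC (IZR n))).
Proof.
destruct (gaussian_bounds (Rabs (Im w))) as (K & HK & H). destruct shift_exp_bound as (C1 & _ & HC).
exists (K * C1)%R. apply (translates_sum_bound g K w HK); auto.
intros n. apply (H (w + RtoC (IZR n))). rewrite Im_translate; lra.
Qed.
Lemma summable_g1 w : summable (fun n : Z => g1 (w + RtoC (IZR n))).
Proof.
destruct (gaussian_bounds (Rabs (Im w))) as (K & HK & H). destruct shift_exp_bound as (C1 & _ & HC).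
exists (K * C1)%R. apply (translates_sum_bound g1 K w HK); auto.
intros n. apply (H (w + RtoC (IZR n))). rewrite Im_translate; lra.
Qed.

Let D (w d : C) : C := G (w + d) - G w - d * G1 w.

Lemma D_bound Y : exists K, (0 < K)%R /\ forall w, (Rabs (Im w) <= Y)%R -> forall d, (Cmod d <= 1)%R ->
  (Cmod (D w d) <= K * (Cmod d * Cmod d))%R.
Proof.
destruct (gaussian_bounds Y) as (K & HK & H). destruct shift_exp_bound as (C1 & HC1 & HC).
exists (K * C1)%R; split; [nra|]. intros w Hw d Hd.
assert (E : D w d = csum (fun n : Z => g (w + d + RtoC (IZR n)) + ((-1) * g (w + RtoC (IZR n)) + (- d) * g1 (w + RtoC (IZR n))))).
{ rewrite csum_plus, csum_plus, !csum_scal; auto using summable_g, summable_g1, summable_scal, summable_plus.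
  unfold D, G, G1. ring. }
rewrite E. apply csum_Cmod. intros L HL.
apply Rle_trans with (rsum (fun n : Z => (Cmod d * Cmod d * K) * exp (- Rabs (Re w + IZR n)))%R L).
- apply rsum_le; intros n _.
  destruct (H (w + RtoC (IZR n))) as (_ & _ & H3); [now rewrite Im_translate|].
  specialize (H3 d Hd). rewrite Re_translate in H3. eapply Rle_trans; [|eapply Rle_trans; [exact H3|lra]].
  right; f_equal. replace (w + d + RtoC (IZR n)) with (w + RtoC (IZR n) + d) by ring. ring.
- rewrite rsum_scal. pose proof (HC (Re w) L HL). pose proof (Cmod_ge_0 d).
  replace (K * C1 * (Cmod d * Cmod d))%R with (Cmod d * Cmod d * K * C1)%R by ring.
  apply Rmult_le_compat_l; auto. apply Rmult_le_pos; [nra|lra].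
Qed.

Lemma G_periodic w : G (w + 1) = G w.
Proof.
unfold G. rewrite <- (csum_reindex (fun n : Z => g (w + RtoC (IZR n))) (fun n => n + 1)%Z).
- apply csum_ext; intros n. rewrite plus_IZR, RtoC_plus. f_equal; ring.
- intros; lia.
- intros j; left; exists (j - 1)%Z; lia.
- apply (summable_inj (fun n : Z => g (w + RtoC (IZR n))) (fun n => n + 1)%Z); [intros; lia|apply summable_g].
Qed.
(** Because c0 tau = -pi i, the cross term between the shift by k tau and the summation index n is
    -2 pi i k n and drops out of the exponential. *)
Lemma G_tau z k : G (z + RtoC (IZR k) * tau) = cexp (- (RtoC (IZR k * IZR k) * A + RtoC (IZR k) * (2 * PiI * z))) * G z.
Proof.
unfold G. rewrite <- csum_scal by apply summable_g. apply csum_ext; intros n. unfold g. rewrite <- cexp_plus.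
rewrite <- (cexp_period (- (k * n)) (_ + c0 * ((z + _) * (z + _)))). f_equal.
rewrite opp_IZR, mult_IZR, RtoC_opp, !RtoC_mult. unfold A.
set (kk := RtoC (IZR k)). set (nn := RtoC (IZR n)).
transitivity (c0 * ((z + nn) * (z + nn)) + (c0 * tau) * (2 * kk * (z + nn) + kk * kk * tau)); [ring|].
rewrite Htau. ring.
Qed.

Let pt (N j : nat) : C := RtoC (INR j / INR N).
Let mean (N : nat) (w : C) : C := RtoC (/ INR N) * lsum (fun j => G (w + pt N j)) (seq 0 N).

Lemma pt_S N j : (0 < N)%nat -> pt N (S j) = pt N j + RtoC (/ INR N).
Proof. intros HN. unfold pt. rewrite <- RtoC_plus. f_equal. rewrite S_INR. field. apply not_0_INR; lia. Qed.
Lemma pt_N N j : (0 < N)%nat -> pt N (j + N) = pt N j + 1.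
Proof. intros HN. unfold pt. rewrite <- RtoC_plus. f_equal. rewrite plus_INR. field. apply not_0_INR; lia. Qed.
Lemma pt_0 N : pt N 0 = 0.
Proof. unfold pt. simpl. f_equal. unfold Rdiv; ring. Qed.
Lemma G_pt_period N w j : (0 < N)%nat -> G (w + pt N (j + N)) = G (w + pt N j).
Proof. intros HN. rewrite pt_N by auto. rewrite <- (G_periodic (w + pt N j)). f_equal; ring. Qed.

Lemma mean_step N w : (0 < N)%nat -> mean N (w + RtoC (/ INR N)) = mean N w.
Proof.
intros HN. unfold mean. f_equal.
rewrite <- (lsum_periodic (fun j => G (w + pt N j))).
- apply lsum_ext; intros j _. rewrite pt_S by auto. f_equal; ring.
- exact (G_pt_period N w 0 HN).
Qed.

Lemma lsum_Cmod_le {I} (f : I -> C) L B : (forall i, In i L -> (Cmod (f i) <= B)%R) -> (Cmod (lsum f L) <= INR (length L) * B)%R.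
Proof.
intros H. eapply Rle_trans; [apply Cmod_lsum|]. rewrite <- rsum_const. now apply rsum_le.
Qed.
Lemma avg_Cmod_le N (f : nat -> C) B : (0 < N)%nat -> (forall i, (Cmod (f i) <= B)%R) ->
  (Cmod (RtoC (/ INR N) * lsum f (seq 0 N)) <= B)%R.
Proof.
intros HN H. assert (HN' : (0 < INR N)%R) by (apply lt_0_INR; auto).
rewrite Cmod_mult, Cmod_R, Rabs_pos_eq by (left; now apply Rinv_0_lt_compat).
assert (E : (Cmod (lsum f (seq 0 N)) <= INR (length (seq 0 N)) * B)%R) by (apply lsum_Cmod_le; auto).
rewrite length_seq in E. apply (Rmult_le_compat_l (/ INR N)) in E; [|left; now apply Rinv_0_lt_compat].
eapply Rle_trans; [exact E|]. right; field; lra.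
Qed.

(** The mean does not change under the step h = 1/N. So the linear term of a step v h can be
    cancelled by subtracting v times the step h, which leaves an error of order h^2; N such steps
    give an error of order 1/N. *)
Lemma mean_close w v : exists K, (0 < K)%R /\ forall N, (0 < N)%nat -> (Cmod v <= INR N)%R ->
  (Cmod (mean N (w + v) - mean N w) <= K / INR N)%R.
Proof.
destruct (D_bound (Rabs (Im w) + Cmod v)) as (K & HK & HD).
pose (r := Cmod v). assert (Hr : (0 <= r)%R) by apply Cmod_ge_0.
exists (K * (r * r + r) + 1)%R; split; [nra|]. intros N HN Hv.
assert (HN' : (0 < INR N)%R) by (apply lt_0_INR; auto).
pose (h := (/ INR N)%R). assert (Hh : (0 < h)%R) by now apply Rinv_0_lt_compat.
assert (HhN : (h * INR N = 1)%R) by (unfold h; field; lra).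
assert (Hh1 : (h <= 1)%R).
{ unfold h. rewrite <- Rinv_1. apply Rinv_le_contravar; [lra|]. apply (le_INR 1); lia. }
assert (Hvh : (Cmod (v * RtoC h) <= 1)%R).
{ rewrite Cmod_mult, Cmod_R, (Rabs_pos_eq h) by lra. nra. }
assert (step : forall u, (Rabs (Im u) <= Rabs (Im w) + Cmod v)%R ->
  (Cmod (mean N (u + v * RtoC h) - mean N u) <= K * (r * r + r) * (h * h))%R).
{ intros u Hu.
  replace (mean N (u + v * RtoC h) - mean N u) with
    (RtoC (/ INR N) * lsum (fun j => D (u + pt N j) (v * RtoC h) + (- v) * D (u + pt N j) (RtoC h)) (seq 0 N)).
  - apply avg_Cmod_le; auto. intros j.
    eapply Rle_trans; [apply Cmod_triangle|]. rewrite Cmod_mult, Cmod_opp.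
    assert (Hu' : (Rabs (Im (u + pt N j)) <= Rabs (Im w) + Cmod v)%R) by (unfold pt; rewrite Im_translate; auto).
    assert (Hch : Cmod (RtoC h) = h) by (rewrite Cmod_R, Rabs_pos_eq; lra).
    pose proof (HD _ Hu' (v * RtoC h) Hvh) as D1.
    pose proof (HD _ Hu' (RtoC h) ltac:(rewrite Hch; auto)) as D2.
    rewrite Cmod_mult, Hch in D1. rewrite Hch in D2. fold r in D1 |- *.
    assert (r * Cmod (D (u + pt N j) (RtoC h)) <= r * (K * (h * h)))%R by (apply Rmult_le_compat_l; auto). nra.
  - transitivity (mean N (u + v * RtoC h) - mean N u - v * (mean N (u + RtoC (/ INR N)) - mean N u)).
    + unfold mean. rewrite lsum_plus, lsum_scal. unfold D.
      assert (P : forall d, lsum (fun j => G (u + pt N j + d) - G (u + pt N j) - d * G1 (u + pt N j)) (seq 0 N) =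
        lsum (fun j => G (u + d + pt N j)) (seq 0 N) - lsum (fun j => G (u + pt N j)) (seq 0 N)
        - d * lsum (fun j => G1 (u + pt N j)) (seq 0 N)).
      { intros d. transitivity (lsum (fun j => G (u + d + pt N j) + ((-1) * G (u + pt N j) + (- d) * G1 (u + pt N j))) (seq 0 N)).
        - apply lsum_ext; intros j _. replace (u + pt N j + d) with (u + d + pt N j) by ring. ring.
        - rewrite !lsum_plus, !lsum_scal. ring. }
      rewrite !P. fold h. ring.
    + rewrite mean_step by auto. ring. }
assert (iter : forall k, (k <= N)%nat ->
   (Cmod (mean N (w + RtoC (INR k) * (v * RtoC h)) - mean N w) <= INR k * (K * (r * r + r) * (h * h)))%R).
{ induction k as [|k IH]; intros Hk.
  - simpl INR. replace (w + 0 * (v * RtoC h)) with w by ring.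
    replace (mean N w - mean N w) with (RtoC 0) by ring. rewrite Cmod_0; lra.
  - specialize (IH ltac:(lia)). rewrite S_INR, RtoC_plus.
    set (u := w + RtoC (INR k) * (v * RtoC h)) in *.
    replace (w + (RtoC (INR k) + 1) * (v * RtoC h)) with (u + v * RtoC h) by (unfold u; ring).
    replace (mean N (u + v * RtoC h) - mean N w) with ((mean N (u + v * RtoC h) - mean N u) + (mean N u - mean N w)) by ring.
    eapply Rle_trans; [apply Cmod_triangle|].
    assert (Hu : (Rabs (Im u) <= Rabs (Im w) + Cmod v)%R).
    { unfold u. rewrite Im_plus. eapply Rle_trans; [apply Rabs_triang|]. apply Rplus_le_compat_l.
      eapply Rle_trans; [apply Rabs_Im_Cmod|]. rewrite !Cmod_mult, !Cmod_R.
      rewrite (Rabs_pos_eq h), (Rabs_pos_eq (INR k)) by (try apply pos_INR; lra).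
      assert (INR k <= INR N)%R by (apply le_INR; lia). pose proof (pos_INR k). fold r.
      assert (INR k * h <= 1)%R by nra. nra. }
    specialize (step u Hu). lra. }
specialize (iter N (le_n _)).
replace (w + RtoC (INR N) * (v * RtoC h)) with (w + v) in iter.
2:{ replace (RtoC (INR N) * (v * RtoC h)) with (v * RtoC (h * INR N)) by (rewrite RtoC_mult; ring). rewrite HhN; ring. }
eapply Rle_trans; [exact iter|]. unfold Rdiv. fold h.
replace (INR N * (K * (r * r + r) * (h * h)))%R with (K * (r * r + r) * h * (h * INR N))%R by ring.
rewrite HhN. nra.
Qed.

Let fcoef (N : nat) (z : C) (k : Z) : C :=
  RtoC (/ INR N) * lsum (fun j => G (z + pt N j) * chi (- (IZR k * (INR j / INR N)))) (seq 0 N).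

Lemma fcoef_eq N z k : fcoef N z k = thterm A (2 * PiI * z) k * mean N (z + RtoC (IZR k) * tau).
Proof.
unfold fcoef, mean.
transitivity (RtoC (/ INR N) * (thterm A (2 * PiI * z) k * lsum (fun j => G (z + RtoC (IZR k) * tau + pt N j)) (seq 0 N))); [|ring].
f_equal. rewrite <- lsum_scal. apply lsum_ext; intros j _.
replace (z + RtoC (IZR k) * tau + pt N j) with (z + pt N j + RtoC (IZR k) * tau) by ring.
rewrite G_tau, Cmult_assoc. unfold thterm. rewrite <- cexp_plus, Cmult_comm. f_equal.
unfold chi, pt. f_equal. rewrite RtoC_opp, (RtoC_mult (IZR k) (INR j / INR N)). ring.
Qed.

Let freqs (M : nat) : list Z := map (fun i => (Z.of_nat i - Z.of_nat M)%Z) (seq 0 (2 * M + 1)).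
Lemma in_freqs M k : In k (freqs M) <-> (Z.abs k <= Z.of_nat M)%Z.
Proof.
unfold freqs; rewrite in_map_iff; split.
- intros (i & <- & Hi). apply in_seq in Hi. lia.
- intros H; exists (Z.to_nat (k + Z.of_nat M)); split; [lia|apply in_seq; lia].
Qed.
Lemma NoDup_freqs M : NoDup (freqs M).
Proof. apply FinFun.Injective_map_NoDup; [intros a b; lia|apply seq_NoDup]. Qed.

(** Fourier inversion on N = 2M + 1 nodes with the N frequencies from -M to M: summing the
    characters kills every node except 0. *)
Lemma sum_fcoef M z : lsum (fcoef (2 * M + 1) z) (freqs M) = G z.
Proof.
set (N := (2 * M + 1)%nat). unfold freqs. fold N. rewrite lsum_map.
assert (HN : (0 < INR N)%R) by (apply lt_0_INR; unfold N; lia).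
unfold fcoef. rewrite lsum_scal, lsum_exchange.
transitivity (RtoC (/ INR N) * lsum (fun j => G (z + pt N j) * lsum (fun i => chi (- ((INR i - INR M) * (INR j / INR N)))) (seq 0 N)) (seq 0 N)).
{ f_equal. apply lsum_ext; intros j _. rewrite <- lsum_scal. apply lsum_ext; intros i _.
  rewrite minus_IZR, <- !INR_IZR_INZ. reflexivity. }
assert (EN : forall f : nat -> C, lsum f (seq 0 N) = f O + lsum (fun i => f (S i)) (seq 0 (2 * M))).
{ intros f. replace N with (S (2 * M)) by (unfold N; lia). apply lsum_seq_front. }
match goal with |- _ * lsum ?f _ = _ => rewrite (EN f) end.
rewrite (lsum_zero _ (seq 0 (2 * M))).
- rewrite pt_0.
  replace (lsum _ (seq 0 N)) with (RtoC (INR N)).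
  + replace (z + 0) with z by ring.
    transitivity (RtoC (/ INR N * INR N) * G z); [rewrite RtoC_mult; ring|].
    rewrite Rinv_l by lra. ring.
  + transitivity (lsum (fun _ : nat => RtoC 1) (seq 0 N)).
    * clear. induction N as [|N IH]; [reflexivity|].
      rewrite seq_S, lsum_app, <- IH, S_INR, RtoC_plus. simpl; ring.
    * apply lsum_ext; intros i _. rewrite <- (chi_IZR 0). f_equal. simpl. unfold Rdiv; ring.
- intros j Hj. apply in_seq in Hj. rewrite chi_sum; [ring|unfold N; lia].
Qed.

(** Discrete integration by parts: taking second differences of [G] multiplies the k-th coefficient
    by -4 sin^2(pi k / N), which is at least 4 k^2 / N^2 in modulus, whereas the second differences
    are of order 1/N^2. The bound is uniform in M, as dominated convergence demands. *)
Lemma fcoef_bound z : exists K, (0 < K)%R /\ forall M k, k <> 0%Z -> (Z.abs k <= Z.of_nat M)%Z ->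
  (Cmod (fcoef (2 * M + 1) z k) <= K * / (IZR k * IZR k))%R.
Proof.
destruct (D_bound (Rabs (Im z))) as (K & HK & HD).
exists K; split; auto. intros M k Hk HkM. set (N := (2 * M + 1)%nat).
assert (HNp : (0 < N)%nat) by (unfold N; lia).
assert (HN : (0 < INR N)%R) by (apply lt_0_INR; auto).
pose (h := (/ INR N)%R). assert (Hh : (0 < h)%R) by now apply Rinv_0_lt_compat.
assert (HhN : (h * INR N = 1)%R) by (unfold h; field; lra).
assert (Hh1 : (h <= 1)%R).
{ unfold h. rewrite <- Rinv_1. apply Rinv_le_contravar; [lra|]. apply (le_INR 1); lia. }
pose (H := fun j => G (z + pt N j) * chi (- (IZR k * (INR j / INR N)))).
assert (Hper : forall j, H (j + N)%nat = H j).
{ intros j; unfold H. rewrite G_pt_period by auto. f_equal. rewrite plus_INR.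
  replace (- (IZR k * ((INR j + INR N) / INR N)))%R with (- (IZR k * (INR j / INR N)) + IZR (- k))%R.
  - rewrite chi_add, chi_IZR; ring.
  - rewrite opp_IZR. field; lra. }
set (x := (IZR k * h)%R).
pose (d2 := fun j => G (z + pt N (S (S j))) - 2 * G (z + pt N (S j)) + G (z + pt N j)).
assert (Eq : RtoC h * lsum (fun j => d2 j * chi (- (IZR k * (INR (S j) / INR N)))) (seq 0 N) =
   (chi x + chi (- x) - 2) * fcoef N z k).
{ unfold fcoef. fold h.
  transitivity (RtoC h * lsum (fun j => chi x * H (S (S j)) + ((-2) * H (S j) + chi (- x) * H j)) (seq 0 N)).
  - f_equal. apply lsum_ext; intros j _. unfold d2, H.
    assert (E1 : chi (- (IZR k * (INR (S j) / INR N))) = chi x * chi (- (IZR k * (INR (S (S j)) / INR N)))).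
    { rewrite <- chi_add. f_equal. unfold x, h. rewrite (S_INR (S j)). field; lra. }
    assert (E2 : chi (- (IZR k * (INR (S j) / INR N))) = chi (- x) * chi (- (IZR k * (INR j / INR N)))).
    { rewrite <- chi_add. f_equal. unfold x, h. rewrite S_INR. field; lra. }
    transitivity (G (z + pt N (S (S j))) * chi (- (IZR k * (INR (S j) / INR N)))
      - 2 * G (z + pt N (S j)) * chi (- (IZR k * (INR (S j) / INR N)))
      + G (z + pt N j) * chi (- (IZR k * (INR (S j) / INR N)))); [ring|].
    rewrite E1 at 1. rewrite E2 at 2. ring.
  - rewrite !lsum_plus, !lsum_scal.
    rewrite (lsum_periodic (fun j => H (S j))), (lsum_periodic H).
    + unfold H. ring.
    + exact (Hper O).
    + exact (Hper 1%nat). }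
assert (Hd2 : forall j, (Cmod (d2 j) <= 2 * K * (h * h))%R).
{ intros j. set (w := z + pt N (S j)).
  assert (Hw : (Rabs (Im w) <= Rabs (Im z))%R) by (unfold w, pt; rewrite Im_translate; lra).
  assert (Hch : Cmod (RtoC h) = h) by (rewrite Cmod_R, Rabs_pos_eq; lra).
  replace (d2 j) with (D w (RtoC h) + D w (- RtoC h)).
  - pose proof (HD w Hw (RtoC h) ltac:(rewrite Hch; auto)) as D1.
    pose proof (HD w Hw (- RtoC h) ltac:(rewrite Cmod_opp, Hch; auto)) as D2.
    rewrite Cmod_opp in D2. rewrite Hch in D1, D2.
    eapply Rle_trans; [apply Cmod_triangle|]. lra.
  - unfold D, d2, w. rewrite (pt_S N (S j)) by auto. fold h.
    replace (z + pt N (S j) + - RtoC h) with (z + pt N j) by (rewrite (pt_S N j) by auto; fold h; ring).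
    replace (z + pt N (S j) + RtoC h) with (z + (pt N (S j) + RtoC h)) by ring. ring. }
assert (HL : (Cmod ((chi x + chi (- x) - 2) * fcoef N z k) <= 2 * K * (h * h))%R).
{ rewrite <- Eq. apply avg_Cmod_le; auto. intros j. rewrite Cmod_mult, Cmod_chi, Rmult_1_r. apply Hd2. }
assert (Hchi : chi x + chi (- x) - 2 = RtoC (- (4 * (sin (x * PI) * sin (x * PI))))).
{ unfold chi.
  replace (RtoC x * (2 * PiI)) with ((0, 2 * (x * PI))%R : C) by (unfold PiI; apply injective_projections; simpl; ring).
  replace (RtoC (- x) * (2 * PiI)) with ((0, - (2 * (x * PI)))%R : C) by (unfold PiI; apply injective_projections; simpl; ring).
  unfold cexp; simpl Re; simpl Im. rewrite exp_0, cos_neg, sin_neg, cos_2a_sin.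
  apply injective_projections; simpl; ring. }
rewrite Cmod_mult, Hchi, Cmod_R, Rabs_Ropp in HL.
assert (Hx2 : (Rabs x <= /2)%R).
{ unfold x. rewrite Rabs_mult, (Rabs_pos_eq h), <- abs_IZR by lra.
  apply IZR_le in HkM. rewrite <- INR_IZR_INZ in HkM.
  assert (INR N = 2 * INR M + 1)%R by (unfold N; rewrite plus_INR, mult_INR; simpl; ring). nra. }
assert (Hsin : (x * x <= sin (x * PI) * sin (x * PI))%R).
{ pose proof PI2_3_2 as P3. pose proof (sin_ge_third (Rabs x * PI)) as S3. pose proof (Rabs_pos x).
  assert (E : (sin (x * PI) * sin (x * PI) = sin (Rabs x * PI) * sin (Rabs x * PI))%R).
  { unfold Rabs; destruct Rcase_abs; auto. replace (- x * PI)%R with (- (x * PI))%R by ring. rewrite sin_neg; ring. }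
  assert (S3' : (Rabs x <= sin (Rabs x * PI))%R).
  { eapply Rle_trans; [|apply S3; split; nra]. nra. }
  rewrite E. replace (x * x)%R with (Rabs x * Rabs x)%R by (rewrite <- Rabs_mult, Rabs_pos_eq; auto; apply Rle_0_sqr).
  nra. }
assert (Hkk : (1 <= IZR k * IZR k)%R).
{ rewrite <- mult_IZR. apply IZR_le. nia. }
rewrite Rabs_pos_eq in HL by nra.
pose proof (Cmod_ge_0 (fcoef N z k)) as Pa.
assert (HF : (4 * (x * x) * Cmod (fcoef N z k) <= 2 * K * (h * h))%R).
{ eapply Rle_trans; [|exact HL]. apply Rmult_le_compat_r; auto. nra. }
unfold x in HF.
assert (HF2 : ((h * h) * (4 * (IZR k * IZR k) * Cmod (fcoef N z k)) <= (h * h) * (2 * K))%R) by nra.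
apply Rmult_le_reg_l in HF2; [|nra].
apply (Rmult_le_reg_r (IZR k * IZR k)); [lra|]. rewrite Rmult_assoc, Rinv_l, Rmult_1_r by lra. nra.
Qed.

Lemma mean_bound w : exists B, (0 <= B)%R /\ forall N, (0 < N)%nat -> (Cmod (mean N w) <= B)%R.
Proof.
destruct (gaussian_bounds (Rabs (Im w))) as (K & HK & H). destruct shift_exp_bound as (C1 & HC1 & HC).
exists (K * C1)%R; split; [nra|]. intros N HN. apply avg_Cmod_le; auto. intros j.
apply csum_Cmod. apply (translates_sum_bound g K (w + pt N j) HK); auto.
intros n. apply (H (w + pt N j + RtoC (IZR n))). unfold pt. rewrite !Im_translate. lra.
Qed.

(** [G z] is the sum of its discrete coefficients, each a theta term times the mean at z + k tau. By
    [mean_close] that mean may be replaced by the mean at 0 in the limit, and [fcoef_bound] supplies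
    the dominating family. *)
Lemma theta_limit z : Clim (fun M => mean (2 * M + 1) 0 * Theta A (2 * PiI * z)) (G z).
Proof.
destruct (fcoef_bound z) as (K & HK & Hak).
pose (Nn := fun M => (2 * M + 1)%nat).
assert (HNn : forall M, (0 < Nn M)%nat) by (intros; unfold Nn; lia).
destruct (mean_bound 0) as (B & HB0 & HB). destruct (mean_bound z) as (Bz & HBz0 & HBz).
pose (u := fun M k => (if Z_le_dec (Z.abs k) (Z.of_nat M) then fcoef (Nn M) z k else 0) + (- mean (Nn M) 0) * thterm A (2 * PiI * z) k).
assert (Hth : summable (thterm A (2 * PiI * z))) by now apply summable_thterm.
assert (Hfin : forall M, csum (fun k => if Z_le_dec (Z.abs k) (Z.of_nat M) then fcoef (Nn M) z k else 0) = G z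
    /\ summable (fun k => if Z_le_dec (Z.abs k) (Z.of_nat M) then fcoef (Nn M) z k else 0)).
{ intros M. 
  assert (Z0 : forall k, ~ In k (freqs M) -> (if Z_le_dec (Z.abs k) (Z.of_nat M) then fcoef (Nn M) z k else 0) = 0).
  { intros k Hk. destruct Z_le_dec; auto. exfalso; apply Hk, in_freqs; auto. }
  split.
  - rewrite (hsum_csum _ _ (hsum_finite _ _ (NoDup_freqs M) Z0)). rewrite <- (sum_fcoef M z).
    apply lsum_ext; intros k Hk. apply in_freqs in Hk. destruct Z_le_dec; [reflexivity|lia].
  - exact (summable_finite _ _ (NoDup_freqs M) Z0). }
assert (Hu : Clim (fun M => csum (u M)) (csum (fun _ : Z => RtoC 0))).
{ assert (Ha0 : forall M, (Cmod (fcoef (Nn M) z 0) <= Cmod (thterm A (2 * PiI * z) 0) * Cmod (mean (Nn M) z))%R).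
  { intros M. rewrite fcoef_eq. rewrite Cmod_mult. replace (z + 0 * tau) with z by ring. lra. }
  apply (dominated_convergence u (fun _ => RtoC 0)
    (* The coefficient with k = 0 needs its own term, since the inverse square takes the default
       value 0 there. *)
    (fun k => RtoC K * RtoC (/ (IZR k * IZR k)) + ((if Z.eq_dec k 0 then RtoC (Cmod (thterm A (2 * PiI * z) 0) * Bz) else 0)
       + RtoC (B * Cmod (thterm A (2 * PiI * z) k))))).
  - apply summable_plus; [apply summable_scal, summable_inv_sqr|apply summable_plus].
    + apply (csum_single _ 0%Z). intros k Hk. now destruct Z.eq_dec.
    + apply (summable_le _ (fun k => RtoC B * thterm A (2 * PiI * z) k)); [|now apply summable_scal].
      intros k. rewrite Cmod_mult, !Cmod_R, !Rabs_pos_eq; auto; try lra.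
      apply Rmult_le_pos; auto; apply Cmod_ge_0.
  - intros M k. unfold u.
    assert (Hpos : (0 <= B * Cmod (thterm A (2 * PiI * z) k))%R) by (apply Rmult_le_pos; auto; apply Cmod_ge_0).
    assert (Hpos0 : (0 <= Cmod (thterm A (2 * PiI * z) 0) * Bz)%R) by (apply Rmult_le_pos; auto; apply Cmod_ge_0).
    assert (Hi : (0 <= / (IZR k * IZR k))%R).
    { destruct (Z.eq_dec k 0) as [->|Hk]; [rewrite Rmult_0_l, Rinv_0; lra|].
      left; apply Rinv_0_lt_compat. rewrite <- mult_IZR. apply IZR_lt. nia. }
    assert (Hki : (0 <= K * / (IZR k * IZR k))%R) by (apply Rmult_le_pos; lra).
    eapply Rle_trans; [apply Cmod_triangle|]. rewrite Cmod_mult, Cmod_opp.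
    assert (T2 : (Cmod (mean (Nn M) 0) * Cmod (thterm A (2 * PiI * z) k) <= B * Cmod (thterm A (2 * PiI * z) k))%R).
    { apply Rmult_le_compat_r; [apply Cmod_ge_0|auto]. }
    rewrite <- RtoC_mult.
    destruct (Z.eq_dec k 0) as [->|Hk].
    + rewrite <- !RtoC_plus, Cmod_R, Rabs_pos_eq by lra.
      destruct Z_le_dec; [|rewrite Cmod_0; lra]. specialize (Ha0 M).
      assert (Cmod (thterm A (2 * PiI * z) 0) * Cmod (mean (Nn M) z) <= Cmod (thterm A (2 * PiI * z) 0) * Bz)%R.
      { apply Rmult_le_compat_l; [apply Cmod_ge_0|auto]. }
      lra.
    + rewrite <- !RtoC_plus, Cmod_R, Rabs_pos_eq by lra.
      destruct Z_le_dec as [Hl|]; [|rewrite Cmod_0; lra]. specialize (Hak M k Hk Hl).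
      fold (Nn M) in Hak. lra.
  - intros k eps He.
    destruct (mean_close 0 (z + RtoC (IZR k) * tau)) as (K2 & HK2 & Hc).
    pose (e := Cmod (thterm A (2 * PiI * z) k)). assert (He0 : (0 <= e)%R) by apply Cmod_ge_0.
    destruct (INR_unbounded (e * K2 / eps)) as [N1 H1].
    destruct (INR_unbounded (Cmod (z + RtoC (IZR k) * tau))) as [N2 H2].
    exists (N1 + N2 + Z.to_nat (Z.abs k))%nat. intros M HM. unfold u.
    destruct Z_le_dec; [|lia]. rewrite fcoef_eq.
    replace (_ - 0) with (thterm A (2 * PiI * z) k * (mean (Nn M) (0 + (z + RtoC (IZR k) * tau)) - mean (Nn M) 0)).
    2:{ replace (0 + (z + RtoC (IZR k) * tau)) with (z + RtoC (IZR k) * tau) by ring. ring. }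
    rewrite Cmod_mult. fold e.
    assert (HNM : (INR N1 <= INR (Nn M) /\ INR N2 <= INR (Nn M))%R) by (split; apply le_INR; unfold Nn; lia).
    assert (HNp : (0 < INR (Nn M))%R) by (apply lt_0_INR; auto).
    specialize (Hc (Nn M) (HNn M) ltac:(lra)).
    apply Rle_lt_trans with (e * (K2 / INR (Nn M)))%R; [apply Rmult_le_compat_l; auto|].
    apply (Rmult_lt_reg_r (INR (Nn M))); auto.
    replace (e * (K2 / INR (Nn M)) * INR (Nn M))%R with (e * K2)%R by (field; lra).
    apply (Rmult_lt_reg_r (/ eps)); [now apply Rinv_0_lt_compat|].
    replace (eps * INR (Nn M) * / eps)%R with (INR (Nn M)) by (field; lra). fold (Rdiv (e * K2) eps). lra. }
rewrite csum_0 in Hu.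
intros eps He. destruct (Hu eps He) as [M0 HM0]. exists M0; intros M HM. specialize (HM0 M HM).
unfold u in HM0. destruct (Hfin M) as [F1 F2].
rewrite csum_plus, F1, csum_scal in HM0 by auto using summable_scal.
fold (Theta A (2 * PiI * z)) in HM0.
replace (mean (2 * M + 1) 0 * Theta A (2 * PiI * z) - G z) with (- (G z + (- mean (Nn M) 0) * Theta A (2 * PiI * z) - 0)) by (unfold Nn; ring).
now rewrite Cmod_opp.
Qed.

(** The means at 0 do not involve z, so z = 0 determines their limit, namely G(0) / Theta(A, 0), and
    with it the factor for every z. *)
Lemma theta_inversion : Theta A 0 <> 0 -> exists kappa, forall z,
  cexp (c0 * (z * z)) * Theta c0 (2 * c0 * z) = kappa * Theta A (2 * PiI * z).
Proof.
intros H0. exists (G 0 / Theta A 0). intros z.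
assert (EG : cexp (c0 * (z * z)) * Theta c0 (2 * c0 * z) = G z).
{ unfold Theta, G. rewrite <- csum_scal by now apply summable_thterm.
  apply csum_ext; intros n. unfold thterm, g. rewrite <- cexp_plus; f_equal. rewrite RtoC_mult; ring. }
rewrite EG.
pose proof (theta_limit 0) as L0. replace (2 * PiI * 0) with (RtoC 0) in L0 by ring.
assert (Ls : Clim (fun M => mean (2 * M + 1) 0) (G 0 / Theta A 0)).
{ apply (Clim_ext (fun M => / Theta A 0 * (mean (2 * M + 1) 0 * Theta A 0))); [intros; field; auto|].
  replace (G 0 / Theta A 0) with (/ Theta A 0 * G 0) by (field; auto). now apply Clim_scal. }
apply (Clim_unique _ _ _ (theta_limit z)).
apply (Clim_ext (fun M => Theta A (2 * PiI * z) * mean (2 * M + 1) 0)); [intros; ring|].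
replace (G 0 / Theta A 0 * Theta A (2 * PiI * z)) with (Theta A (2 * PiI * z) * (G 0 / Theta A 0)) by (field; auto).
now apply Clim_scal.
Qed.
End Poisson.

(** * The modular invariant *)

Definition th2_4 tau := cexp (PiI * tau) * Theta (PiI * tau) (PiI * tau) ^ 4.
Definition th3_4 tau := Theta (PiI * tau) 0 ^ 4.
Definition th4_4 tau := Theta (PiI * tau) PiI ^ 4.

Lemma Re_PiI_mult tau : Re (PiI * tau) = (- (PI * Im tau))%R.
Proof. unfold PiI; destruct tau; unfold Re, Im; simpl; ring. Qed.
Lemma Re_PiI_neg tau : (0 < Im tau)%R -> (Re (PiI * tau) < 0)%R.
Proof. intros H; rewrite Re_PiI_mult. pose proof PI_RGT_0. nra. Qed.
Lemma th2_4_nz tau : (0 < Im tau)%R -> th2_4 tau <> 0.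
Proof.
intros H; apply Cmult_neq_0; [apply cexp_neq0|apply Cpow_nz, Theta_neq_0_edge; now apply Re_PiI_neg].
Qed.
Lemma th3_4_nz tau : (0 < Im tau)%R -> th3_4 tau <> 0.
Proof.
intros H; apply Cpow_nz, Theta_neq_0_strip. change (Re 0) with 0%R. rewrite Rabs_R0. pose proof (Re_PiI_neg tau H); lra.
Qed.
Lemma th4_4_nz tau : (0 < Im tau)%R -> th4_4 tau <> 0.
Proof.
intros H; apply Cpow_nz, Theta_neq_0_strip. replace (Re PiI) with 0%R by (unfold PiI; simpl; ring). rewrite Rabs_R0. pose proof (Re_PiI_neg tau H); lra.
Qed.

(** If p and m are the two terms in the doubling formula for theta_3^2, then theta_4^2 = p - m and
    theta_2^4 = 4 p m, and the claim is (p + m)^2 = 4 p m + (p - m)^2. *)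
Lemma jacobi_quartic tau : (0 < Im tau)%R -> th3_4 tau = th2_4 tau + th4_4 tau.
Proof.
intros H. pose proof (Re_PiI_neg tau H) as HA. unfold th2_4, th3_4, th4_4. set (A := PiI * tau) in *.
assert (HA2 : (Re (2 * A) < 0)%R) by (rewrite Re_scal_R; lra).
assert (E3 : Theta A 0 ^ 2 = Theta (2 * A) 0 ^ 2 + cexp A * Theta (2 * A) (2 * A) ^ 2).
{ transitivity (Theta A 0 * Theta A 0); [ring|]. rewrite Theta_mult by auto.
  replace (0 + 0) with (RtoC 0) by ring. replace (0 - 0) with (RtoC 0) by ring.
  replace (2 * A + 0) with (2 * A) by ring. replace (A + 0) with A by ring. ring. }
assert (E4 : Theta A PiI ^ 2 = Theta (2 * A) 0 ^ 2 - cexp A * Theta (2 * A) (2 * A) ^ 2).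
{ transitivity (Theta A PiI * Theta A PiI); [ring|]. rewrite Theta_mult by auto.
  replace (PiI + PiI) with (0 + 2 * PiI) by ring. replace (PiI - PiI) with (RtoC 0) by ring.
  replace (2 * A + (0 + 2 * PiI)) with (2 * A + 2 * PiI) by ring. rewrite !Theta_period.
  replace (2 * A + 0) with (2 * A) by ring. rewrite cexp_plus, cexp_PiI. ring. }
assert (E2 : Theta A A ^ 2 = 2 * (Theta (2 * A) 0 * Theta (2 * A) (2 * A))).
{ transitivity (Theta A A * Theta A A); [ring|]. rewrite Theta_mult by auto.
  replace (A - A) with (RtoC 0) by ring. replace (A + A) with (2 * A) by ring.
  rewrite (Theta_shift _ 0) at 1 by auto. rewrite (Theta_shift _ 0) at 1 by auto.
  replace (2 * A + 0) with (2 * A) by ring. replace (0 + 2 * (2 * A)) with (2 * A + 2 * A) by ring. ring. }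
replace (Theta A 0 ^ 4) with (Theta A 0 ^ 2 * Theta A 0 ^ 2) by ring.
replace (Theta A PiI ^ 4) with (Theta A PiI ^ 2 * Theta A PiI ^ 2) by ring.
replace (Theta A A ^ 4) with (Theta A A ^ 2 * Theta A A ^ 2) by ring.
rewrite E2, E3, E4. ring.
Qed.

(* 256 (1 - lambda + lambda^2)^3 / (lambda^2 (1 - lambda)^2) with lambda = theta2^4 / theta3^4, denominators cleared *)
Definition jinv tau : C :=
  256 * (th3_4 tau ^ 2 - th2_4 tau * th3_4 tau + th2_4 tau ^ 2) ^ 3 / (th2_4 tau * th3_4 tau * th4_4 tau) ^ 2.

(** The translation exchanges theta_3^4 and theta_4^4 and changes the sign of theta_2^4;
    [jacobi_quartic] then makes the two rational expressions agree. *)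
Lemma jinv_T tau : (0 < Im tau)%R -> jinv (tau + 1) = jinv tau.
Proof.
intros H.
assert (E : PiI * (tau + 1) = PiI * tau + PiI) by ring.
assert (E2 : th2_4 (tau + 1) = - th2_4 tau).
{ unfold th2_4. rewrite E, cexp_plus, cexp_PiI, Theta_APi.
  replace (PiI * tau + PiI + PiI) with (PiI * tau + 2 * PiI) by ring. rewrite Theta_period; ring. }
assert (E3 : th3_4 (tau + 1) = th4_4 tau).
{ unfold th3_4, th4_4. rewrite E, Theta_APi. do 2 f_equal. ring. }
assert (E4 : th4_4 (tau + 1) = th3_4 tau).
{ unfold th3_4, th4_4. rewrite E, Theta_APi. replace (PiI + PiI) with (0 + 2 * PiI) by ring.
  now rewrite Theta_period. }
unfold jinv. rewrite E2, E3, E4.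
pose proof (th2_4_nz tau H). pose proof (th3_4_nz tau H) as H3. pose proof (th4_4_nz tau H).
rewrite (jacobi_quartic tau H) in *. field. auto.
Qed.

Lemma im_neg_inv tau : (0 < Im tau)%R -> Im (- / tau) = (Im tau / (Re tau ^ 2 + Im tau ^ 2))%R.
Proof.
intros H. destruct tau as [x y]; unfold Re, Im, Cinv in *; simpl in *. field. nra.
Qed.
Lemma im_neg_inv_pos tau : (0 < Im tau)%R -> (0 < Im (- / tau))%R.
Proof. intros H. rewrite im_neg_inv by auto. apply Rdiv_lt_0_compat; auto. nra. Qed.
Lemma uhp_neq_0 tau : (0 < Im tau)%R -> tau <> 0.
Proof. intros H E; rewrite E in H; simpl in H; lra. Qed.

(** The inversion formula at z = 0, 1/2 and tau/2 fixes theta_3^4 and exchanges theta_2^4 with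
    theta_4^4, up to the common factor k^4, which cancels by homogeneity. *)
Lemma jinv_S tau : (0 < Im tau)%R -> jinv (- / tau) = jinv tau.
Proof.
intros H. pose proof (uhp_neq_0 tau H) as Hn. pose proof (im_neg_inv_pos tau H) as H'.
destruct (theta_inversion (PiI * (- / tau)) tau) as [k Hk].
- now apply Re_PiI_neg.
- field; auto.
- now apply Re_PiI_neg.
- intros E. apply (th3_4_nz tau H). unfold th3_4. rewrite E. ring.
- pose (A := PiI * tau). pose (c0 := PiI * (- / tau)). fold A c0 in Hk.
  assert (E3 : th3_4 (- / tau) = k ^ 4 * th3_4 tau).
  { unfold th3_4. fold A c0. specialize (Hk 0).
    replace (c0 * (0 * 0)) with (RtoC 0) in Hk by ring. rewrite cexp_0, Cmult_1_l in Hk.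
    replace (2 * c0 * 0) with (RtoC 0) in Hk by ring. replace (2 * PiI * 0) with (RtoC 0) in Hk by ring.
    rewrite Hk. ring. }
  assert (Hhalf : RtoC (/2) * 2 = 1) by (rewrite <- RtoC_mult; f_equal; field).
  assert (E2 : th2_4 (- / tau) = k ^ 4 * th4_4 tau).
  { unfold th2_4, th4_4. fold A c0. specialize (Hk (RtoC (/2))).
    replace (2 * c0 * RtoC (/2)) with c0 in Hk.
    2:{ transitivity (c0 * (RtoC (/2) * 2)); [rewrite Hhalf|]; ring. }
    replace (2 * PiI * RtoC (/2)) with PiI in Hk.
    2:{ transitivity (PiI * (RtoC (/2) * 2)); [rewrite Hhalf|]; ring. }
    transitivity ((cexp (c0 * (RtoC (/ 2) * RtoC (/ 2))) * Theta c0 c0) ^ 4); [|rewrite Hk; ring].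
    set (e := cexp (c0 * (RtoC (/ 2) * RtoC (/ 2)))). replace (cexp c0) with (e ^ 4); [ring|].
    unfold e. rewrite <- cexp_nat. f_equal. simpl INR.
    transitivity (c0 * ((RtoC (/ 2) * 2) * (RtoC (/ 2) * 2))); [|rewrite Hhalf; ring].
    replace (1 + 1 + 1 + 1)%R with (2 * 2)%R by ring. rewrite RtoC_mult. ring. }
  assert (E4 : th4_4 (- / tau) = k ^ 4 * th2_4 tau).
  { unfold th2_4, th4_4. fold A c0. specialize (Hk (tau * RtoC (/2))).
    assert (Hct : c0 * tau = - PiI) by (unfold c0; field; auto).
    replace (2 * c0 * (tau * RtoC (/2))) with (- PiI) in Hk.
    2:{ transitivity (c0 * tau * (RtoC (/2) * 2)); [rewrite Hhalf, Hct|]; ring. }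
    replace (2 * PiI * (tau * RtoC (/2))) with A in Hk.
    2:{ transitivity (A * (RtoC (/2) * 2)); [rewrite Hhalf|unfold A]; ring. }
    rewrite Theta_even in Hk by now apply Re_PiI_neg.
    transitivity (cexp A * (k * Theta A A) ^ 4); [|ring]. rewrite <- Hk.
    set (e := cexp (c0 * _)). assert (Ee : cexp A * e ^ 4 = 1).
    { unfold e. rewrite <- cexp_nat, <- cexp_plus, <- cexp_0. f_equal. simpl INR.
      replace (1 + 1 + 1 + 1)%R with (2 * 2)%R by ring. rewrite RtoC_mult.
      transitivity (A + c0 * tau * tau * ((RtoC (/ 2) * 2) * (RtoC (/ 2) * 2))); [ring|].
      rewrite Hhalf, Hct. unfold A. ring. }
    transitivity (cexp A * e ^ 4 * Theta c0 PiI ^ 4); [rewrite Ee|]; ring. }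
  assert (Hk0 : k <> 0).
  { intros E. apply (th3_4_nz _ H'). rewrite E3, E. ring. }
  unfold jinv. rewrite E2, E3, E4.
  pose proof (th2_4_nz tau H). pose proof (th3_4_nz tau H) as H3. pose proof (th4_4_nz tau H).
  rewrite (jacobi_quartic tau H) in *. field. auto.
Qed.

(** The triple product at the three half-periods; all factors other than (Q;Q)_infinity cancel by
    Euler's identity. The denominator of [jinv] thereby becomes a power of an invertible product. *)
Lemma theta_product A : (Re A < 0)%R ->
  Theta A 0 * Theta A PiI * Theta A A = 2 * qpoch_inf (cexp (2 * A)) (cexp (2 * A)) ^ 3.
Proof.
intros HA. assert (HV : (Re (2 * A) < 0)%R) by (rewrite Re_scal_R; lra).
pose proof (RtoC_neq_0 2 ltac:(lra)) as N2.
set (Q := cexp (2 * A)). set (rho := cexp A).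
assert (HQ : (Cmod Q < 1)%R) by now apply Cmod_cexp_lt1.
assert (Er : Q = rho * rho) by (unfold Q, rho; rewrite <- cexp_plus; f_equal; ring).
assert (E2 : 2 * A / 2 = A) by (field; auto).
pose proof (jacobi_triple A (2 * A) HV) as J3.
pose proof (jacobi_triple (A + PiI) (2 * A) HV) as J4.
pose proof (jacobi_triple (2 * A) (2 * A) HV) as J2.
rewrite E2 in J2, J3, J4. fold Q in J2, J3, J4.
replace (A - A) with (RtoC 0) in J3 by ring. replace (2 * A - A) with A in J3, J2 by ring.
replace (A + PiI - A) with PiI in J4 by ring.
replace (2 * A - 2 * A) with (RtoC 0) in J2 by ring. rewrite cexp_0 in J2.
rewrite cexp_plus, cexp_PiI in J4.
replace (cexp (2 * A - (A + PiI))) with (- cexp A) in J4.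
2:{ rewrite <- (cexp_period 1 (2 * A - (A + PiI))). replace (2 * A - (A + PiI) + 1 * (2 * PiI)) with (A + PiI) by ring.
    rewrite cexp_plus, cexp_PiI; ring. }
fold rho in J3, J4.
replace (- (rho * - (1))) with rho in J4 by ring. replace (- - rho) with rho in J4 by ring. fold Q in J2.
rewrite <- J2, <- J3, <- J4.
(* the factor 1 + Q^0 = 2 *)
assert (F2 : qpoch_inf (- (1)) Q = 2 * qpoch_inf (- Q) Q).
{ apply (Clim_unique (fun n => qpoch_partial (- (1)) Q (S n))).
  - apply (Clim_sub S); [lia|]. now apply qp_cvg.
  - apply (Clim_ext (fun n => 2 * qpoch_partial (- Q) Q n)); [|apply Clim_scal; now apply qp_cvg].
    intros n. rewrite qp_front. replace (- (1) * Q) with (- Q) by ring. ring. }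
rewrite F2.
(* Euler: prod (1-Q^(2n+1))(1+Q^(n+1)) = 1 *)
assert (W : qpoch_inf (- rho) Q * qpoch_inf rho Q * qpoch_inf (- Q) Q = 1).
{ set (E := qpoch_inf Q Q).
  assert (HE : E <> 0).
  { apply qpoch_inf_neq_0; auto. intros k; now apply small_factor. }
  apply (Cmult_cancel_r E); auto. rewrite Cmult_1_l.
  apply (Clim_unique (fun n => qpoch_partial (- rho) Q n * qpoch_partial rho Q n * qpoch_partial (- Q) Q n * qpoch_partial Q Q n)).
  - repeat apply Clim_mult; now apply qp_cvg.
  - apply (Clim_ext (fun n => qpoch_partial Q Q (n + n))).
    + induction n as [|n IH]; [simpl; ring|].
      replace (S n + S n)%nat with (S (S (n + n))) by lia. 
      change (qpoch_partial Q Q (S (S (n + n)))) with (qpoch_partial Q Q (n + n) * (1 - Q * Q ^ (n + n)) * (1 - Q * Q ^ (S (n + n)))).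
      rewrite IH. cbn [qpoch_partial]. rewrite Cpow_S, Cpow_add_r.
      assert (Er2 : rho * rho = Q) by auto.
      set (x := Q ^ n). 
      transitivity (qpoch_partial (- rho) Q n * qpoch_partial rho Q n * qpoch_partial (- Q) Q n * qpoch_partial Q Q n
        * (1 - (rho * rho) * (x * x)) * (1 - Q * x) * (1 + Q * x)); [rewrite Er2|]; ring.
    + apply (Clim_sub (fun n => n + n)%nat); [lia|]. now apply qp_cvg. }
set (E := qpoch_inf Q Q) in *. set (u := qpoch_inf (- rho) Q) in *. set (v := qpoch_inf rho Q) in *.
set (w := qpoch_inf (- Q) Q) in *.
transitivity (2 * E ^ 3 * (u * v * w) ^ 2); [ring|]. rewrite W. ring.
Qed.

(** The 256 in [jinv] is exactly the square of the 16 = 2^4 produced by [theta_product], so the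
    right-hand side has integral coefficients. *)
Lemma jinv_eta tau : (0 < Im tau)%R -> forall P,
  P * qpoch_inf (cexp (2 * (PiI * tau))) (cexp (2 * (PiI * tau))) = 1 ->
  cexp (PiI * tau) ^ 2 * jinv tau =
  (th3_4 tau ^ 2 - th2_4 tau * th3_4 tau + th2_4 tau ^ 2) ^ 3 * P ^ 24.
Proof.
intros H P HP. pose proof (theta_product (PiI * tau) (Re_PiI_neg tau H)) as TP.
set (E := qpoch_inf _ _) in *. set (x := cexp (PiI * tau)).
assert (D : th2_4 tau * th3_4 tau * th4_4 tau = 16 * x * E ^ 12).
{ unfold th2_4, th3_4, th4_4. fold x.
  transitivity (x * (Theta (PiI * tau) 0 * Theta (PiI * tau) PiI * Theta (PiI * tau) (PiI * tau)) ^ 4); [ring|].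
  rewrite TP; ring. }
unfold jinv. rewrite D.
assert (HE : E <> 0) by (intros E0; rewrite E0, Cmult_0_r in HP; apply C1_nz; auto).
assert (Hx : x <> 0) by apply cexp_neq0.
assert (HPE : P = / E). { transitivity (P * E * / E); [field; auto|]. rewrite HP; ring. }
rewrite HPE. field. auto.
Qed.

(** y = 16 / lambda; this scaling removes the factor 256 and makes the equation monic in y over
    Z[j]. *)
Lemma jinv_y tau : (0 < Im tau)%R -> let y := 16 * th3_4 tau / th2_4 tau in
  (y ^ 2 - 16 * y + 256) ^ 3 = jinv tau * y ^ 2 * (y - 16) ^ 2.
Proof.
intros H y. unfold y, jinv.
pose proof (th2_4_nz tau H). pose proof (th3_4_nz tau H) as H3. pose proof (th4_4_nz tau H).
rewrite (jacobi_quartic tau H) in *. field. auto.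
Qed.

(** * Power series with algebraic integer coefficients *)

Lemma algint_0 : algint 0. Proof. exact (algint_IZR 0). Qed.
Lemma algint_1 : algint 1. Proof. exact (algint_IZR 1). Qed.
Lemma algint_opp x : algint x -> algint (- x).
Proof. intros H; replace (- x) with (0 - x) by ring. apply algint_minus; auto using algint_0. Qed.
Lemma algint_pow x n : algint x -> algint (x ^ n).
Proof. intros H; induction n; simpl; auto using algint_1, algint_mult. Qed.
Lemma algint_lsum {I} (f : I -> C) L : (forall i, algint (f i)) -> algint (lsum f L).
Proof. intros H; induction L; simpl; auto using algint_0, algint_plus. Qed.
Lemma algint_root_of_unity n z : (0 < n)%nat -> z ^ n = 1 -> algint z.
Proof.
intros Hn Hz. destruct n as [|n]; [lia|].
apply (algint_root ((- (1)) :: repeat (RtoC 0) n)).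
- constructor; [apply algint_opp, algint_1|]. apply Forall_forall; intros c Hc. apply repeat_spec in Hc as ->. apply algint_0.
- simpl. transitivity (z ^ S n - 1); [|rewrite Hz; ring]. simpl. replace (fold_right _ _ _) with (z ^ n); [ring|].
  clear. induction n as [|n IH]; simpl; auto. rewrite <- IH. ring.
Qed.

Definition pterm (c : nat -> C) x k := c k * x ^ k.
Definition pconv c := forall x, (Cmod x < 1)%R -> summable (pterm c x).
Definition psum c x := csum (pterm c x).
Definition conv (c d : nat -> C) (n : nat) : C := lsum (fun i => c i * d (n - i)%nat) (seq 0 (S n)).

Section Conv.
Variables (c d : nat -> C) (x : C).
Hypothesis (Hc : summable (pterm c x)) (Hd : summable (pterm d x)).
Let F (p : nat * nat) : C := pterm c x (fst p) * pterm d x (snd p).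
Let pi (p : nat * nat) := (fst p + snd p)%nat.
Let HF : summable F. Proof. now apply summable_mult. Qed.
Let fibre n : csum (on_fibre pi F n) = pterm (conv c d) x n.
Proof.
pose (L := map (fun i => (i, (n - i)%nat)) (seq 0 (S n))).
rewrite (hsum_csum _ (lsum (on_fibre pi F n) L)).
- unfold L. rewrite lsum_map. unfold pterm, conv. rewrite Cmult_comm, <- lsum_scal.
  apply lsum_ext; intros i Hi. apply in_seq in Hi. unfold on_fibre, pi, F, pterm; cbn [fst snd].
  destruct excluded_middle_informative as [E|E]; [|lia].
  replace (x ^ n) with (x ^ i * x ^ (n - i)); [ring|]. rewrite <- Cpow_add_r. f_equal; lia.
- apply hsum_finite.
  + apply FinFun.Injective_map_NoDup; [intros a b E; now inversion E|apply seq_NoDup].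
  + intros [i j] Hij. unfold on_fibre, pi; cbn [fst snd]. destruct excluded_middle_informative as [E|E]; auto.
    exfalso; apply Hij. unfold L. apply in_map_iff. exists i; split; [f_equal; lia|apply in_seq; lia].
Qed.
Lemma summable_conv : summable (pterm (conv c d) x).
Proof. eapply summable_ext; [exact fibre|]. apply summable_fibres, HF. Qed.
Lemma psum_conv : psum (conv c d) x = psum c x * psum d x.
Proof.
unfold psum. rewrite <- csum_mult by auto.
rewrite <- (csum_ext _ _ fibre). apply (csum_fibres pi F HF).
Qed.
End Conv.

Definition int_series (g : C -> C) (c : nat -> C) :=
  pconv c /\ (forall k, algint (c k)) /\ forall x, (Cmod x < 1)%R -> g x = psum c x.
(** Besides integrality only the constant term is recorded; it becomes the leading coefficient of a
    modular function once the pole has been cleared. *)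
Definition int_series0 (g : C -> C) (u : C) := exists c, int_series g c /\ c O = u.

Lemma AS_ext g h c : (forall x, (Cmod x < 1)%R -> g x = h x) -> int_series g c -> int_series h c.
Proof. intros E (H1 & H2 & H3); split; [|split]; auto. intros x Hx; rewrite <- E; auto. Qed.
Lemma int_series0_ext g h u : (forall x, (Cmod x < 1)%R -> g x = h x) -> int_series0 g u -> int_series0 h u.
Proof. intros E (c & H & H0); exists c; split; auto. now apply (AS_ext g). Qed.
Lemma int_series0_mult g h u v : int_series0 g u -> int_series0 h v -> int_series0 (fun x => g x * h x) (u * v).
Proof.
intros (c & (H1 & H2 & H3) & H0) (d & (K1 & K2 & K3) & K0).
exists (conv c d); split; [split; [|split]|].
- intros x Hx; apply summable_conv; auto.
- intros k; apply algint_lsum; auto using algint_mult.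
- intros x Hx. rewrite psum_conv, H3, K3; auto.
- unfold conv; simpl. rewrite H0, K0; ring.
Qed.
Lemma int_series_plus g h c d : int_series g c -> int_series h d -> int_series (fun x => g x + h x) (fun k => c k + d k).
Proof.
intros (H1 & H2 & H3) (K1 & K2 & K3).
assert (E : forall x k, pterm c x k + pterm d x k = pterm (fun k => c k + d k) x k).
{ intros; unfold pterm; ring. }
split; [|split].
- intros x Hx. eapply summable_ext; [apply E|]. apply summable_plus; auto.
- auto using algint_plus.
- intros x Hx. unfold psum. rewrite <- (csum_ext _ _ (E x)), csum_plus, H3, K3; auto.
Qed.
Lemma int_series0_plus g h u v : int_series0 g u -> int_series0 h v -> int_series0 (fun x => g x + h x) (u + v).
Proof.
intros (c & Hg & H0) (d & Hh & K0). exists (fun k => c k + d k); split; [now apply int_series_plus|congruence].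
Qed.
Lemma int_series0_mono m u : algint u -> int_series0 (fun x => u * x ^ m) (if Nat.eq_dec m 0 then u else 0).
Proof.
intros Hu. pose (c := fun k => if Nat.eq_dec k m then u else 0).
assert (Z : forall x, summable (pterm c x) /\ psum c x = pterm c x m).
{ intros x. apply csum_single. intros k Hk. unfold pterm, c. destruct Nat.eq_dec; [easy|ring]. }
exists c; split; [split; [|split]|].
- intros x _; apply Z.
- intros k; unfold c; destruct Nat.eq_dec; auto using algint_0.
- intros x _. rewrite (proj2 (Z x)). unfold pterm, c. destruct Nat.eq_dec; [ring|lia].
- unfold c. destruct (Nat.eq_dec 0 m), (Nat.eq_dec m 0); auto; lia.
Qed.
Lemma int_series0_const u : algint u -> int_series0 (fun _ => u) u.
Proof. intros H. apply (int_series0_ext (fun x => u * x ^ 0)); [intros; simpl; ring|]. exact (int_series0_mono 0 u H). Qed.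
Lemma int_series0_shift m g u : (0 < m)%nat -> int_series0 g u -> int_series0 (fun x => x ^ m * g x) 0.
Proof.
intros Hm Hg. pose proof (int_series0_mult _ _ _ _ (int_series0_mono m 1 algint_1) Hg) as H.
destruct (Nat.eq_dec m 0); [lia|]. replace (0 * u) with (RtoC 0) in H by ring.
revert H. apply int_series0_ext. intros; ring.
Qed.
Lemma int_series0_pow g u n : int_series0 g u -> int_series0 (fun x => g x ^ n) (u ^ n).
Proof.
intros H; induction n as [|n IH]; simpl; [apply int_series0_const, algint_1|]. now apply int_series0_mult.
Qed.
Lemma int_series0_scal a g u : algint a -> int_series0 g u -> int_series0 (fun x => a * g x) (a * u).
Proof. intros Ha Hg. apply int_series0_mult; auto. now apply int_series0_const. Qed.
Lemma int_series0_minus g h u v : int_series0 g u -> int_series0 h v -> int_series0 (fun x => g x - h x) (u - v).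
Proof.
intros Hg Hh. pose proof (int_series0_plus _ _ _ _ Hg (int_series0_scal (- (1)) _ _ (algint_opp _ algint_1) Hh)) as H.
replace (u - v) with (u + - (1) * v) by ring. revert H. apply int_series0_ext. intros; ring.
Qed.
Lemma Cmod_pow_lt1 x m : (0 < m)%nat -> (Cmod x < 1)%R -> (Cmod (x ^ m) < 1)%R.
Proof.
intros Hm Hx. rewrite Cmod_pow. apply pow_lt_1_compat; [split; auto using Cmod_ge_0|lia].
Qed.
(** Serves for the nome at (a tau + b) / d, which is a root of unity times a power of [nome_root].
    |zeta| = 1 preserves the unit disc, and integrality of zeta preserves that of the
    coefficients. *)
Lemma int_series0_comp m zeta g u : (0 < m)%nat -> algint zeta -> Cmod zeta = 1%R -> int_series0 g u -> int_series0 (fun x => g (zeta * x ^ m)) u.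
Proof.
intros Hm Hz Hz1 (c & (H1 & H2 & H3) & H0).
pose (c' := fun k => if Nat.eq_dec (k mod m) 0 then c (k / m)%nat * zeta ^ (k / m) else 0).
assert (Hx' : forall x, (Cmod x < 1)%R -> (Cmod (zeta * x ^ m) < 1)%R).
{ intros x Hx. rewrite Cmod_mult, Hz1, Rmult_1_l. now apply Cmod_pow_lt1. }
assert (E : forall x l, pterm c' x (m * l) = pterm c (zeta * x ^ m) l).
{ intros x l. unfold pterm, c'. rewrite Nat.mul_comm, Nat.Div0.mod_mul, Nat.div_mul by lia.
  destruct Nat.eq_dec; [|lia]. rewrite Cpow_mult_l, Nat.mul_comm, Cpow_mult_r. ring. }
assert (I1 : forall i i', (m * i = m * i')%nat -> i = i') by (intros; nia).
assert (I2 : forall x j, (exists i, j = (m * i)%nat) \/ pterm c' x j = 0).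
{ intros x j. unfold pterm, c'. destruct (Nat.eq_dec (j mod m) 0) as [E0|]; [|right; ring].
  left; exists (j / m)%nat. pose proof (Nat.div_mod_eq j m). lia. }
assert (Hs : forall x, (Cmod x < 1)%R -> summable (fun l => pterm c' x (m * l))).
{ intros x Hx. eapply summable_ext; [intros l; symmetry; apply E|]. auto. }
exists c'; split; [split; [|split]|].
- intros x Hx. apply (summable_reindex _ (fun l => m * l)%nat); auto.
- intros k; unfold c'. destruct Nat.eq_dec; auto using algint_0, algint_mult, algint_pow.
- intros x Hx. rewrite H3 by auto. unfold psum.
  rewrite <- (csum_reindex (pterm c' x) (fun l => m * l)%nat); auto. apply csum_ext; auto.
- unfold c'. rewrite Nat.Div0.mod_0_l, Nat.Div0.div_0_l. destruct Nat.eq_dec; [|lia]. simpl. rewrite H0; ring.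
Qed.
Lemma geom_le_of_le r i k : (0 <= r < 1)%R -> (k <= i)%nat -> (r ^ i <= r ^ k)%R.
Proof.
intros Hr H. replace i with (k + (i - k))%nat by lia. rewrite pow_add.
assert (0 <= r ^ k)%R by (apply pow_le; lra).
assert (r ^ (i - k) <= 1)%R by (rewrite <- (pow1 (i - k)); apply pow_incr; lra). nra.
Qed.

Section ThetaSeries.
Variable e : Z -> nat.
Hypothesis He : forall n, (Z.abs n <= Z.of_nat (e n) + 1)%Z.
Let range k := map (fun i => (Z.of_nat i - Z.of_nat (S k))%Z) (seq 0 (2 * S k + 1)).
Let in_range k n : (Z.abs n <= Z.of_nat (S k))%Z -> In n (range k).
Proof. intros H; apply in_map_iff; exists (Z.to_nat (n + Z.of_nat (S k))); split; [lia|apply in_seq; lia]. Qed.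
(** The number of n with [e n = k]; the growth condition on [e] confines them to |n| <= k + 1, the
    extent of [range k]. *)
Definition tcoef k := lsum (fun n => if Nat.eq_dec (e n) k then RtoC 1 else 0) (range k).
Lemma summable_tser x : (Cmod x < 1)%R -> summable (fun n : Z => x ^ e n).
Proof.
intros Hx. pose (r := RtoC (Cmod x)).
assert (Hr : (Cmod r < 1)%R) by (unfold r; rewrite Cmod_R, Rabs_pos_eq; auto using Cmod_ge_0).
assert (Hx0 := Cmod_ge_0 x).
assert (B : forall n, (Cmod (x ^ e n) <= Cmod x ^ (Z.to_nat (Z.abs n) - 1))%R).
{ intros n. rewrite Cmod_pow. apply geom_le_of_le; [lra|]. specialize (He n). lia. }
assert (R : forall k, Cmod (r ^ k) = (Cmod x ^ k)%R).
{ intros k. rewrite Cmod_pow. unfold r. rewrite Cmod_R, Rabs_pos_eq; auto. }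
apply summable_Z.
- apply (summable_le _ (fun k => (if Nat.eq_dec k 0 then 1 else 0) + r ^ (k - 1))).
  + intros k. eapply Rle_trans; [apply B|]. replace (Z.to_nat (Z.abs (Z.of_nat k)) - 1)%nat with (k - 1)%nat by lia.
    rewrite <- R. destruct Nat.eq_dec as [->|]; [|rewrite Cplus_0_l; lra].
    simpl. rewrite <- RtoC_plus, !Cmod_R, !Rabs_pos_eq; lra.
  + apply summable_plus.
    * apply (csum_single _ O). intros k Hk; now destruct Nat.eq_dec.
    * apply (summable_ext (fun k => (if Nat.eq_dec k 0 then 1 else 0) + (if Nat.eq_dec k 0 then RtoC 0 else r ^ (k - 1)))).
      { intros k. destruct Nat.eq_dec as [->|]; simpl; ring. }
      apply summable_plus.
      -- apply (csum_single _ O). intros k Hk; now destruct Nat.eq_dec.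
      -- apply (summable_reindex _ S); [intros; lia| |].
         ++ intros j. destruct (Nat.eq_dec j 0); auto. left; exists (j - 1)%nat; lia.
         ++ eapply summable_ext; [|apply (summable_geom r Hr)]. intros k. cbv beta. destruct Nat.eq_dec; [lia|].
            f_equal; lia.
- apply (summable_le _ (fun k => r ^ k)); [|now apply summable_geom].
  intros k. eapply Rle_trans; [apply B|]. rewrite R. right; f_equal. lia.
Qed.
Lemma tser_int_series : int_series (fun x => csum (fun n : Z => x ^ e n)) tcoef.
Proof.
assert (Fib : forall x k, csum (on_fibre e (fun n : Z => x ^ e n) k) = pterm tcoef x k).
{ intros x k. rewrite (hsum_csum _ (lsum (on_fibre e (fun n : Z => x ^ e n) k) (range k))).
  - unfold pterm, tcoef. rewrite Cmult_comm, <- lsum_scal. apply lsum_ext; intros n _.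
    unfold on_fibre. destruct excluded_middle_informative as [<-|], Nat.eq_dec; try easy; ring.
  - apply hsum_finite.
    + apply FinFun.Injective_map_NoDup; [intros a b; lia|apply seq_NoDup].
    + intros n Hn. unfold on_fibre. destruct excluded_middle_informative as [E|]; auto.
      exfalso; apply Hn, in_range. specialize (He n). lia. }
split; [|split].
- intros x Hx. eapply summable_ext; [apply Fib|]. apply (summable_fibres e _ (summable_tser x Hx)).
- intros k; apply algint_lsum. intros n; destruct Nat.eq_dec; auto using algint_0, algint_1.
- intros x Hx. rewrite <- (csum_fibres e _ (summable_tser x Hx)). apply csum_ext, Fib.
Qed.
Lemma tser_int_series0 : int_series0 (fun x => csum (fun n : Z => x ^ e n)) (tcoef 0).
Proof. exists tcoef; split; auto using tser_int_series. Qed.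
End ThetaSeries.

Definition theta3_exponent (n : Z) := Z.to_nat (n * n).
Definition theta2_exponent (n : Z) := Z.to_nat (n * n + n).
Lemma theta3_exponent_ge n : (Z.abs n <= Z.of_nat (theta3_exponent n) + 1)%Z. Proof. unfold theta3_exponent. nia. Qed.
Lemma theta2_exponent_ge n : (Z.abs n <= Z.of_nat (theta2_exponent n) + 1)%Z. Proof. unfold theta2_exponent. nia. Qed.
Lemma tcoef_theta3 : tcoef theta3_exponent 0 = 1.
Proof. unfold tcoef, theta3_exponent; simpl. ring. Qed.
Definition theta3_series x := csum (fun n : Z => x ^ theta3_exponent n).
Definition theta2_series x := csum (fun n : Z => x ^ theta2_exponent n).
Lemma theta3_int_series : int_series0 theta3_series 1.
Proof. rewrite <- tcoef_theta3. apply tser_int_series0, theta3_exponent_ge. Qed.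
Lemma theta2_int_series : exists u, int_series0 theta2_series u.
Proof. eexists. apply tser_int_series0, theta2_exponent_ge. Qed.
Lemma cexp_Znat (m : Z) z : (0 <= m)%Z -> cexp (RtoC (IZR m) * z) = cexp z ^ Z.to_nat m.
Proof. intros H. rewrite <- cexp_nat, INR_IZR_INZ, Z2Nat.id; auto. Qed.
Lemma theta3_series_eq z : Theta z 0 = theta3_series (cexp z).
Proof.
unfold Theta, theta3_series. apply csum_ext; intros n. unfold thterm, theta3_exponent. rewrite <- cexp_Znat by nia.
f_equal. rewrite mult_IZR. ring.
Qed.
Lemma theta2_series_eq z : Theta z z = theta2_series (cexp z).
Proof.
unfold Theta, theta2_series. apply csum_ext; intros n. unfold thterm, theta2_exponent. rewrite <- cexp_Znat by nia.
f_equal. rewrite plus_IZR, mult_IZR, RtoC_plus. ring.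
Qed.

(** * Partitions and the reciprocal of Euler's product *)

Definition geo (m k : nat) : R := if Nat.eq_dec (k mod m) 0 then 1%R else 0%R.
(** The number of partitions of k into parts of size at most N: each stage multiplies the generating
    function by 1/(1 - x^N). It is independent of N for N >= k, so [part k k] is the partition
    function. *)
Fixpoint part (N : nat) : nat -> R :=
  match N with
  | O => fun k => if Nat.eq_dec k 0 then 1%R else 0%R
  | S N' => fun k => rsum (fun i => part N' i * geo N (k - i))%R (seq 0 (S k))
  end.
Lemma geo_nonneg m k : (0 <= geo m k)%R. Proof. unfold geo; destruct Nat.eq_dec; lra. Qed.
Lemma part_nonneg N k : (0 <= part N k)%R.
Proof.
revert k; induction N as [|N IH]; intros k; [simpl; destruct Nat.eq_dec; lra|].
apply rsum_nonneg; intros i. apply Rmult_le_pos; auto using geo_nonneg.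
Qed.
Lemma part_last N k : part (S N) k = (rsum (fun i => part N i * geo (S N) (k - i))%R (seq 0 k) + part N k)%R.
Proof.
cbn [part]. rewrite seq_S, rsum_app. simpl rsum at 2. rewrite Nat.sub_diag.
unfold geo at 2. rewrite Nat.Div0.mod_0_l. destruct Nat.eq_dec; [ring|lia].
Qed.
Lemma part_mono N k : (part N k <= part (S N) k)%R.
Proof.
rewrite part_last. enough (0 <= rsum (fun i => part N i * geo (S N) (k - i)) (seq 0 k))%R by lra.
apply rsum_nonneg; intros i. apply Rmult_le_pos; auto using geo_nonneg, part_nonneg.
Qed.
Lemma part_stable N k : (k <= N)%nat -> part (S N) k = part N k.
Proof.
intros H. rewrite part_last. rewrite <- (Rplus_0_l (part N k)) at 2. f_equal.
transitivity (rsum (fun _ : nat => 0%R) (seq 0 k)); [|rewrite rsum_const; ring].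
apply Rle_antisym; apply rsum_le; intros i Hi; apply in_seq in Hi; unfold geo;
 rewrite Nat.mod_small by lia; destruct Nat.eq_dec; try lia; lra.
Qed.
Lemma part_eq N k : (k <= N)%nat -> part N k = part k k.
Proof. intros H; induction H as [|N H IH]; auto. rewrite part_stable; auto. Qed.
Lemma part_le N k : (part N k <= part k k)%R.
Proof.
destruct (le_dec k N) as [H|H]; [rewrite part_eq by auto; lra|].
assert (HN : (N <= k)%nat) by lia. clear H. induction HN as [|m Hm IH]; [lra|].
enough (part N (S m) <= part (S m) (S m))%R by auto.
clear IH. assert (HN : (N <= S m)%nat) by lia. clear Hm. generalize (S m) at 1 3 as k. intros k.
induction HN; [lra|]. eapply Rle_trans; [exact IHHN|apply part_mono].
Qed.
Lemma part_algint N k : algint (RtoC (part N k)).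
Proof.
assert (G : forall m k, algint (RtoC (geo m k))) by (intros; unfold geo; destruct Nat.eq_dec; auto using algint_0, algint_1).
revert k; induction N as [|N IH]; intros k; [simpl; destruct Nat.eq_dec; auto using algint_0, algint_1|].
cbn [part]. induction (seq 0 (S k)) as [|i L IHL]; simpl; [apply algint_0|].
rewrite RtoC_plus, RtoC_mult. apply algint_plus; auto. apply algint_mult; auto.
Qed.

Lemma geo_series m x : (0 < m)%nat -> (Cmod x < 1)%R ->
  summable (pterm (fun k => RtoC (geo m k)) x) /\ psum (fun k => RtoC (geo m k)) x = / (1 - x ^ m).
Proof.
intros Hm Hx.
assert (Hxm : (Cmod (x ^ m) < 1)%R).
{ now apply Cmod_pow_lt1. }
assert (E : forall l, pterm (fun k => RtoC (geo m k)) x (m * l) = (x ^ m) ^ l).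
{ intros l. unfold pterm, geo. rewrite Nat.mul_comm, Nat.Div0.mod_mul. destruct Nat.eq_dec; [|lia].
  rewrite Nat.mul_comm, Cpow_mult_r. ring. }
assert (I1 : forall i i', (m * i = m * i')%nat -> i = i') by (intros; nia).
assert (I2 : forall j, (exists i, j = (m * i)%nat) \/ pterm (fun k => RtoC (geo m k)) x j = 0).
{ intros j. unfold pterm, geo. destruct (Nat.eq_dec (j mod m) 0) as [E0|]; [|right; ring].
  left; exists (j / m)%nat. pose proof (Nat.div_mod_eq j m). lia. }
assert (Hs : summable (fun l => pterm (fun k => RtoC (geo m k)) x (m * l))).
{ eapply summable_ext; [intros l; symmetry; apply E|]. now apply summable_geom. }
split.
- apply (summable_reindex _ (fun l => m * l)%nat); auto.
- unfold psum. rewrite <- (csum_reindex _ (fun l => m * l)%nat); auto.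
  rewrite (csum_ext _ _ E). now apply csum_geom.
Qed.
Lemma part_series N x : (Cmod x < 1)%R -> summable (pterm (fun k => RtoC (part N k)) x) /\
  psum (fun k => RtoC (part N k)) x * qpoch_partial x x N = 1.
Proof.
intros Hx. induction N as [|N [IH1 IH2]].
- destruct (csum_single (pterm (fun k => RtoC (part 0 k)) x) O) as [S1 S2].
  { intros k Hk. unfold pterm; simpl. destruct Nat.eq_dec; [easy|ring]. }
  split; auto. unfold psum. rewrite S2. unfold pterm; simpl. ring.
- destruct (geo_series (S N) x ltac:(lia) Hx) as [G1 G2].
  assert (E : conv (fun k => RtoC (part N k)) (fun k => RtoC (geo (S N) k)) = fun k => RtoC (part (S N) k)).
  { apply functional_extensionality; intros k. unfold conv. cbn [part].
    induction (seq 0 (S k)) as [|i L IHL]; simpl; auto. now rewrite RtoC_plus, RtoC_mult, <- IHL. }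
  rewrite <- E. split; [now apply summable_conv|].
  rewrite psum_conv by auto. rewrite G2. cbn [qpoch_partial].
  assert (H1 : 1 - x ^ S N <> 0).
  { apply one_minus_neq_0, Cmod_pow_lt1; [lia|auto]. }
  replace (x * x ^ N) with (x ^ S N) by reflexivity.
  etransitivity; [|exact IH2]. field. auto.
Qed.

Definition partition_series x := psum (fun k => RtoC (part k k)) x.
(** All coefficients are nonnegative, so the first K terms at r = |x| are bounded by the whole
    series with parts up to K, which is 1/(r;r)_K; [qp_ge] bounds this uniformly in K. *)
Lemma summable_part x : (Cmod x < 1)%R -> summable (pterm (fun k => RtoC (part k k)) x).
Proof.
intros Hx. pose (r := RtoC (Cmod x)).
assert (Hr : (Cmod r < 1)%R) by (unfold r; rewrite Cmod_R, Rabs_pos_eq; auto using Cmod_ge_0).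
destruct (qp_ge r r Hr) as (c & Hc & Hge); [intros k; now apply small_factor|].
exists (/ c)%R. apply summable_nat_bound; intros K.
destruct (part_series K r Hr) as [S1 S2].
assert (B1 : (Cmod (psum (fun k => RtoC (part K k)) r) <= / c)%R).
{ specialize (Hge K). apply (f_equal Cmod) in S2. rewrite Cmod_mult, Cmod_1 in S2.
  pose proof (Cmod_ge_0 (psum (fun k => RtoC (part K k)) r)).
  apply (Rmult_le_reg_r c); auto. rewrite Rinv_l by lra. rewrite <- S2. apply Rmult_le_compat_l; auto. }
eapply Rle_trans; [|exact B1].
assert (Hx0 := Cmod_ge_0 x).
assert (Epos : forall k, (0 <= part K k * Cmod x ^ k)%R).
{ intros k. apply Rmult_le_pos; [apply part_nonneg|apply pow_le; auto]. }
assert (Er : forall k, pterm (fun k => RtoC (part K k)) r k = RtoC (part K k * Cmod x ^ k)).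
{ intros k. unfold pterm, r. now rewrite RtoC_mult, RtoC_pow. }
apply Rle_trans with (rsum (fun k => part K k * Cmod x ^ k)%R (seq 0 K)).
- apply rsum_le; intros k Hk. apply in_seq in Hk. unfold pterm. rewrite Cmod_mult, Cmod_pow, Cmod_R.
  rewrite Rabs_pos_eq by apply part_nonneg. rewrite (part_eq K) by lia. lra.
- assert (HL : forall L, lsum (pterm (fun k => RtoC (part K k)) r) L = RtoC (rsum (fun k => part K k * Cmod x ^ k)%R L)).
  { induction L as [|a L IH]; simpl; auto. now rewrite RtoC_plus, <- IH, Er. }
  apply Rnot_lt_le; intros Hlt.
  destruct (csum_partial _ S1 (rsum (fun k => part K k * Cmod x ^ k)%R (seq 0 K) - Cmod (psum (fun k => RtoC (part K k)) r))%R) as (L0 & _ & H0); [lra|].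
  specialize (H0 _ (NoDup_nodupc _) (incl_nodupc_r (seq 0 K) L0)). rewrite HL in H0.
  assert (rsum (fun k => part K k * Cmod x ^ k)%R (seq 0 K) <= rsum (fun k => part K k * Cmod x ^ k)%R (nodupc (seq 0 K ++ L0)))%R.
  { apply rsum_incl; auto using seq_NoDup, incl_nodupc_l. }
  set (s := rsum _ (nodupc _)) in *. fold (psum (fun k => RtoC (part K k)) r) in H0.
  set (p := psum _ _) in *. pose proof (Cmod_le_sub (RtoC s) p) as H2.
  replace (p - RtoC s) with (- (RtoC s - p)) in H2 by ring.
  rewrite Cmod_opp, Cmod_R in H2. pose proof (Rle_abs s). lra.
Qed.
Lemma partition_int_series : int_series0 partition_series 1.
Proof.
exists (fun k => RtoC (part k k)); split; [split; [|split]|].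
- intros x Hx; now apply summable_part.
- intros k; apply part_algint.
- reflexivity.
- reflexivity.
Qed.
Lemma partition_inv x : (Cmod x < 1)%R -> partition_series x * qpoch_inf x x = 1.
Proof.
intros Hx. pose (u := fun N => psum (fun k => RtoC (part N k)) x).
assert (Hu : Clim u (partition_series x)).
{ apply (dominated_convergence (fun N => pterm (fun k => RtoC (part N k)) x) _ (pterm (fun k => RtoC (part k k)) x)).
  - now apply summable_part.
  - intros N k. unfold pterm. rewrite !Cmod_mult, !Cmod_R, !Rabs_pos_eq by apply part_nonneg.
    apply Rmult_le_compat_r; [apply Cmod_ge_0|apply part_le].
  - intros k eps He. exists k; intros N HN. unfold pterm. rewrite (part_eq N) by auto.
    replace (_ - _) with (RtoC 0) by ring. now rewrite Cmod_0. }
apply (Clim_unique (fun N => u N * qpoch_partial x x N)).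
- apply Clim_mult; auto. now apply qp_cvg.
- apply (Clim_ext (fun _ => RtoC 1)); [|apply Clim_const]. intros N; symmetry; apply part_series; auto.
Qed.

(** With x = e^(pi i tau) as variable the pole has order 2. The fourth power of theta_2 carries a
    factor x, so the constant term 1 comes from theta_3 and the partition series alone. *)
Lemma jinv_expansion : exists g, int_series0 g 1 /\ forall tau, (0 < Im tau)%R ->
  cexp (PiI * tau) ^ 2 * jinv tau = g (cexp (PiI * tau)).
Proof.
destruct theta2_int_series as [u2 H2]. pose proof theta3_int_series as H3. pose proof partition_int_series as HP.
pose (b := fun x => theta3_series x ^ 4). pose (a := fun x => x ^ 1 * theta2_series x ^ 4).
exists (fun x => (b x ^ 2 - a x * b x + a x ^ 2) ^ 3 * partition_series (1 * x ^ 2) ^ 24). split.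
- assert (Hb : int_series0 b 1).
  { pose proof (int_series0_pow _ _ 4 H3) as H. replace (1 ^ 4) with (RtoC 1) in H by ring. exact H. }
  assert (Ha : int_series0 a 0) by (eapply int_series0_shift; [lia|apply int_series0_pow, H2]).
  assert (HP2 : int_series0 (fun x => partition_series (1 * x ^ 2)) 1).
  { apply int_series0_comp; auto using algint_1, Cmod_1. }
  pose proof (int_series0_mult _ _ _ _ (int_series0_pow _ _ 3 (int_series0_plus _ _ _ _
    (int_series0_minus _ _ _ _ (int_series0_pow _ _ 2 Hb) (int_series0_mult _ _ _ _ Ha Hb)) (int_series0_pow _ _ 2 Ha))) (int_series0_pow _ _ 24 HP2)) as H.
  replace ((1 ^ 2 - 0 * 1 + 0 ^ 2) ^ 3 * 1 ^ 24) with (RtoC 1) in H by ring. exact H.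
- intros tau Ht. rewrite (jinv_eta tau Ht (partition_series (cexp (2 * (PiI * tau))))).
  + unfold a, b, th2_4, th3_4. rewrite <- theta3_series_eq, <- theta2_series_eq.
    replace (1 * cexp (PiI * tau) ^ 2) with (cexp (2 * (PiI * tau))); [ring|].
    rewrite <- (cexp_nat 2). simpl INR. rewrite Cmult_1_l. reflexivity.
  + apply partition_inv. apply Cmod_cexp_lt1. rewrite Re_scal_R. pose proof (Re_PiI_neg tau Ht). lra.
Qed.

(** * The q-expansion principle *)

Lemma psum_bound c rho : pconv c -> (0 <= rho < 1)%R ->
  exists M, (0 <= M)%R /\ forall x, (Cmod x <= rho)%R -> (Cmod (psum c x) <= M)%R.
Proof.
intros Hc Hr. destruct (Hc (RtoC rho)) as [B HB]; [rewrite Cmod_R, Rabs_pos_eq; lra|].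
exists B; split; [apply (HB nil); constructor|]. intros x Hx. apply csum_Cmod. intros L HL.
eapply Rle_trans; [|apply (HB L HL)]. apply rsum_le; intros k _. unfold pterm. rewrite !Cmod_mult, !Cmod_pow.
apply Rmult_le_compat_l; [apply Cmod_ge_0|]. apply pow_incr. rewrite Cmod_R, Rabs_pos_eq by lra.
split; auto using Cmod_ge_0.
Qed.
Lemma pconv_tail c : pconv c -> pconv (fun k => c (S k)).
Proof.
intros Hc x Hx. destruct (classic (x = 0)) as [->|Hn].
- apply (csum_single _ O). intros [|k] Hk; [easy|]. unfold pterm; simpl; ring.
- apply (summable_ext (fun k => / x * pterm c x (S k))).
  + intros k. unfold pterm; simpl. field; auto.
  + apply summable_scal. apply (summable_inj (pterm c x) S); auto.
Qed.
Lemma psum_split c x : pconv c -> (Cmod x < 1)%R -> psum c x = c O + x * psum (fun k => c (S k)) x.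
Proof.
intros Hc Hx. unfold psum. rewrite <- csum_scal by now apply pconv_tail.
pose (f0 := fun k => if Nat.eq_dec k 0 then c O else 0).
pose (f1 := fun k => if Nat.eq_dec k 0 then RtoC 0 else pterm c x k).
destruct (csum_single f0 O) as [F1 F2]; [intros k Hk; unfold f0; now destruct Nat.eq_dec|].
assert (S1 : summable (fun k => f1 (S k))).
{ apply (summable_ext (fun k => pterm c x (S k))); [reflexivity|]. apply (summable_inj (pterm c x) S); auto. }
assert (Sp : forall j, (exists i, j = S i) \/ f1 j = 0).
{ intros [|j]; [right; reflexivity|left; eauto]. }
assert (Hf1 : summable f1) by (apply (summable_reindex f1 S); auto).
transitivity (csum (fun k => f0 k + f1 k)).
- apply csum_ext. intros [|k]; unfold f0, f1; simpl; unfold pterm; simpl; ring.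
- rewrite csum_plus, F2 by auto. unfold f0; simpl. f_equal.
  rewrite <- (csum_reindex f1 S); auto. apply csum_ext. intros k. unfold f1, pterm; simpl. ring.
Qed.
Lemma csum_lsum {I J} (f : I -> J -> C) L : (forall i, summable (f i)) ->
  summable (fun j => lsum (fun i => f i j) L) /\ csum (fun j => lsum (fun i => f i j) L) = lsum (fun i => csum (f i)) L.
Proof.
intros Hf. induction L as [|a L [IH1 IH2]]; simpl.
- split; [exact (summable_finite _ nil (NoDup_nil _) (fun _ _ => eq_refl))|apply csum_0].
- split; [now apply summable_plus|]. rewrite csum_plus, IH2; auto.
Qed.

(** The contour integral is replaced by the average over N-th roots of unity, which retains the
    coefficients with index congruent to k modulo N; as N grows only c_k survives. *)
Lemma cauchy_estimate c r M k : pconv c -> (0 < r < 1)%R ->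
  (forall s, Cmod (psum c (RtoC r * chi s)) <= M)%R -> (Cmod (c k) * r ^ k <= M)%R.
Proof.
intros Hc Hr HM.
assert (Hsr : summable (pterm c (RtoC r))) by (apply Hc; rewrite Cmod_R, Rabs_pos_eq; lra).
pose (w := fun N l => RtoC (/ INR N) * lsum (fun i => chi (INR i * ((INR l - INR k) / INR N))) (seq 0 N)).
pose (avg := fun N => RtoC (/ INR N) * lsum (fun i => psum c (RtoC r * chi (INR i / INR N)) * chi (- (INR k * (INR i / INR N)))) (seq 0 N)).
assert (HN0 : forall n, (0 < INR (S n))%R) by (intros; apply lt_0_INR; lia).
assert (Eavg : forall N, avg N = csum (fun l => pterm c (RtoC r) l * w N l)).
{ intros N. unfold avg.
  assert (Hs : forall i, summable (fun l => pterm c (RtoC r) l * chi (INR i * ((INR l - INR k) / INR N)))).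
  { intros i. eapply summable_le; [|exact Hsr]. intros l. rewrite Cmod_mult, Cmod_chi. lra. }
  destruct (csum_lsum _ (seq 0 N) Hs) as [C1 C2].
  transitivity (RtoC (/ INR N) * csum (fun l => lsum (fun i => pterm c (RtoC r) l * chi (INR i * ((INR l - INR k) / INR N))) (seq 0 N))).
  - rewrite C2. f_equal. apply lsum_ext; intros i _. unfold psum. rewrite Cmult_comm, <- csum_scal.
    + apply csum_ext; intros l. unfold pterm. rewrite Cpow_mult_l, chi_pow.
      transitivity (c l * RtoC r ^ l * (chi (INR l * (INR i / INR N)) * chi (- (INR k * (INR i / INR N))))); [ring|].
      rewrite <- chi_add. f_equal. f_equal. unfold Rdiv; ring.
    + apply Hc. rewrite Cmod_mult, Cmod_chi, Cmod_R, Rabs_pos_eq; lra.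
  - rewrite <- csum_scal by auto. apply csum_ext; intros l. unfold w. rewrite lsum_scal. ring. }
assert (Hw1 : forall N l, (Cmod (w (S N) l) <= 1)%R).
{ intros N l. unfold w. rewrite Cmod_mult, Cmod_R, Rabs_pos_eq by (left; apply Rinv_0_lt_compat; auto).
  apply (Rmult_le_reg_l (INR (S N))); auto. rewrite <- Rmult_assoc, Rinv_r, Rmult_1_l, Rmult_1_r by (apply not_0_INR; lia).
  eapply Rle_trans; [apply Cmod_lsum|]. 
  eapply Rle_trans; [apply (rsum_le _ (fun _ => 1%R)); intros; rewrite Cmod_chi; lra|].
  rewrite rsum_const, length_seq. lra. }
assert (Hwl : forall l N, (l + k < N)%nat -> w N l = if Nat.eq_dec l k then 1 else 0).
{ intros l N HN. assert (HNp : (0 < INR N)%R) by (apply lt_0_INR; lia). unfold w.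
  destruct Nat.eq_dec as [->|Hne].
  - transitivity (RtoC (/ INR N) * lsum (fun _ : nat => RtoC 1) (seq 0 N)).
    + f_equal. apply lsum_ext; intros i _. rewrite <- (chi_IZR 0). f_equal. unfold Rdiv; ring.
    + replace (lsum _ _) with (RtoC (INR N)); [rewrite <- RtoC_mult; f_equal; field; lra|].
      clear. induction N as [|N IH]; [reflexivity|].
      rewrite seq_S, lsum_app, <- IH, S_INR, RtoC_plus. simpl; ring.
  - rewrite (lsum_ext _ (fun i => chi (- ((INR i - 0) * (INR (if le_dec l k then k - l else N - (l - k)) / INR N))))).
    + rewrite chi_sum; [ring|]. destruct le_dec; lia.
    + intros i _. rewrite Rminus_0_r. destruct le_dec as [Hlk|Hlk].
      * f_equal. rewrite minus_INR by lia. field; lra.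
      * rewrite !minus_INR by lia. 
        replace (- (INR i * ((INR N - (INR l - INR k)) / INR N)))%R with (INR i * ((INR l - INR k) / INR N) + IZR (- Z.of_nat i))%R.
        -- rewrite chi_add, chi_IZR; ring.
        -- rewrite opp_IZR, <- INR_IZR_INZ. field; lra. }
assert (HL : Clim (fun N => avg (S N)) (csum (fun l => if Nat.eq_dec l k then c k * RtoC r ^ k else 0))).
{ apply (Clim_ext (fun N => csum (fun l => pterm c (RtoC r) l * w (S N) l))); [intros; symmetry; apply Eavg|].
  apply (dominated_convergence (fun N l => pterm c (RtoC r) l * w (S N) l) _ (pterm c (RtoC r))); auto.
  - intros N l. rewrite Cmod_mult. pose proof (Hw1 N l). pose proof (Cmod_ge_0 (pterm c (RtoC r) l)). nra.
  - intros l eps He. exists (l + k + 1)%nat. intros N HN. rewrite Hwl by lia. unfold pterm.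
    destruct Nat.eq_dec as [->|].
    + replace (_ - _) with (RtoC 0) by ring. now rewrite Cmod_0.
    + replace (_ - _) with (RtoC 0) by ring. now rewrite Cmod_0. }
destruct (csum_single (fun l => if Nat.eq_dec l k then c k * RtoC r ^ k else 0) k) as [_ E]; [intros l Hl; now destruct Nat.eq_dec|].
rewrite E in HL. destruct Nat.eq_dec; [|lia].
replace (Cmod (c k) * r ^ k)%R with (Cmod (c k * RtoC r ^ k)).
2:{ rewrite Cmod_mult, Cmod_pow, Cmod_R, Rabs_pos_eq; lra. }
apply Rnot_lt_le; intros Hlt.
destruct (HL (Cmod (c k * RtoC r ^ k) - M)%R) as [N0 H0]; [lra|]. specialize (H0 N0 (le_n _)).
assert (Ha : (Cmod (avg (S N0)) <= M)%R).
{ unfold avg. rewrite Cmod_mult, Cmod_R, Rabs_pos_eq by (left; apply Rinv_0_lt_compat; auto).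
  apply (Rmult_le_reg_l (INR (S N0))); auto. rewrite <- Rmult_assoc, Rinv_r, Rmult_1_l by (apply not_0_INR; lia).
  eapply Rle_trans; [apply Cmod_lsum|].
  eapply Rle_trans; [apply (rsum_le _ (fun _ => M)); intros; rewrite Cmod_mult, Cmod_chi, Rmult_1_r; apply HM|].
  rewrite rsum_const, length_seq. lra. }
pose proof (Cmod_le_sub (c k * RtoC r ^ k) (avg (S N0))). lra.
Qed.

(** Invariance is stated for the two standard generators only, so that no generation theorem for
    SL_2(Z) has to be invoked. *)
Definition modular_inv (F : C -> C) := forall tau, (0 < Im tau)%R -> F (tau + 1) = F tau /\ F (- / tau) = F tau.

Lemma modular_inv_Z F : modular_inv F -> forall (k : Z) tau, (0 < Im tau)%R -> F (tau + RtoC (IZR k)) = F tau.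
Proof.
intros HF. assert (P : forall n tau, (0 < Im tau)%R -> F (tau + RtoC (INR n)) = F tau).
{ induction n as [|n IH]; intros tau Ht; [simpl INR; f_equal; ring|].
  rewrite S_INR, RtoC_plus. replace (tau + (RtoC (INR n) + 1)) with (tau + RtoC (INR n) + 1) by ring.
  rewrite (proj1 (HF (tau + RtoC (INR n)) ltac:(rewrite Im_translate; auto))). auto. }
intros k tau Ht. destruct (Z_le_dec 0 k) as [Hk|Hk].
- rewrite <- (Z2Nat.id k), <- INR_IZR_INZ by auto. now apply P.
- rewrite <- (P (Z.to_nat (- k)) (tau + RtoC (IZR k))) by (rewrite Im_translate; auto).
  rewrite INR_IZR_INZ, Z2Nat.id, opp_IZR, RtoC_opp by lia. f_equal; ring.
Qed.

(** As 3/4 lies below the optimal sqrt(3)/2, descent is geometric: if |Re| <= 1/2 and Im < 3/4 then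
    |tau|^2 <= 1/4 + 9/16 = 13/16, and inversion multiplies the imaginary part by at least 16/13. *)
Lemma reduce_im tau : (0 < Im tau)%R -> exists tau', (3 / 4 <= Im tau')%R /\ forall F, modular_inv F -> F tau' = F tau.
Proof.
intros Ht.
assert (Hk : exists k, (3 / 4 * (13 / 16) ^ k <= Im tau)%R).
{ destruct (pow_lt_1_zero (13 / 16)) with (y := Im tau) as [N HN]; auto.
  - rewrite Rabs_pos_eq; lra.
  - exists N. specialize (HN N (le_n _)). rewrite Rabs_pos_eq in HN by (apply pow_le; lra).
    assert (0 <= (13 / 16) ^ N)%R by (apply pow_le; lra). lra. }
destruct Hk as [k Hk]. revert tau Ht Hk. induction k as [|k IH]; intros tau Ht Hk.
- exists tau; split; auto. simpl in Hk; lra.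
- destruct (Rle_dec (3 / 4) (Im tau)) as [H|H]; [exists tau; auto|].
  pose (z := Int_part (Re tau + / 2)%R). destruct (base_Int_part (Re tau + / 2)) as [B1 B2]. fold z in B1, B2.
  pose (t1 := tau + RtoC (IZR (- z))).
  assert (I1 : Im t1 = Im tau) by (unfold t1; apply Im_translate).
  assert (R1 : Re t1 = (Re tau - IZR z)%R).
  { unfold t1. rewrite Re_plus. simpl. rewrite opp_IZR; ring. }
  destruct (IH (- / t1)) as (t' & Ht' & HF).
  + apply im_neg_inv_pos. now rewrite I1.
  + rewrite im_neg_inv, R1, I1 by (rewrite I1; auto). simpl pow in Hk |- *.
    set (y := Im tau) in *. set (x := (Re tau - IZR z)%R).
    assert (Hx : (x * x <= / 4)%R) by (unfold x; nra).
    assert (Hd : (0 < x * (x * 1) + y * (y * 1) <= 13 / 16)%R) by nra.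
    apply Rle_trans with (y * / (13 / 16))%R.
    * replace (y * / (13 / 16))%R with (y * (16 / 13))%R by field. lra.
    * unfold Rdiv. apply Rmult_le_compat_l; [lra|]. apply Rinv_le_contravar; lra.
  + exists t'; split; auto. intros F HFi. rewrite (HF F HFi).
    rewrite (proj2 (HFi t1 ltac:(rewrite I1; auto))). unfold t1. now apply modular_inv_Z.
Qed.

Section Principle.
Variable n : nat.
Hypothesis Hn : (0 < n)%nat.
(** For determinant n = a d, the nome at (a tau + b) / d is a root of unity times the power a^2 of
    this variable, so all factors of the Hecke product are series in it. *)
Definition nome_root (tau : C) : C := cexp (PiI * tau * RtoC (/ INR n)).
Let HnR : (0 < INR n)%R. Proof. now apply lt_0_INR. Qed.

Lemma Cmod_nome_root tau : Cmod (nome_root tau) = exp (- (PI * Im tau * / INR n)).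
Proof. unfold nome_root. rewrite Cmod_cexp. f_equal. destruct tau; unfold PiI, Re, Im; simpl; ring. Qed.
Lemma Cmod_nome_root_lt1 tau : (0 < Im tau)%R -> (Cmod (nome_root tau) < 1)%R.
Proof.
intros H. rewrite Cmod_nome_root, <- exp_0. apply exp_increasing. pose proof PI_RGT_0.
assert (0 < PI * Im tau * / INR n)%R; [|lra]. apply Rmult_lt_0_compat; [apply Rmult_lt_0_compat; lra|now apply Rinv_0_lt_compat].
Qed.
Lemma nome_root_surj r s : (0 < r < 1)%R -> exists tau, (0 < Im tau)%R /\ nome_root tau = RtoC r * chi s.
Proof.
intros Hr. pose proof PI_RGT_0 as HP.
exists ((INR n * 2 * s)%R, (- (INR n * ln r / PI))%R). split.
- simpl. assert (ln r < 0)%R by (rewrite <- ln_1; apply ln_increasing; lra).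
  unfold Rdiv. assert (0 < / PI)%R by now apply Rinv_0_lt_compat. 
  assert (0 < INR n * - ln r * / PI)%R by (apply Rmult_lt_0_compat; [apply Rmult_lt_0_compat; lra|auto]). lra.
- unfold nome_root, chi. rewrite <- (exp_ln r) at 2 by lra.
  assert (E : RtoC (exp (ln r)) = cexp (RtoC (ln r))).
  { unfold cexp; simpl. rewrite cos_0, sin_0. apply injective_projections; simpl; ring. }
  rewrite E, <- cexp_plus. f_equal. unfold PiI. apply injective_projections; simpl; field; lra.
Qed.

(* Such an F is X g(X) with X = e^(pi i tau / n). Every point is equivalent to one with Im tau >= 3/4, so Cauchy's
   estimates for g^l on a larger circle improve every upper bound on |F^l| by a factor 1/2 once l is large. *)
Lemma schwarz F G c : modular_inv F -> int_series G c -> c O = 0 ->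
  (forall tau, (0 < Im tau)%R -> F tau = G (nome_root tau)) -> forall tau, (0 < Im tau)%R -> F tau = 0.
Proof.
intros HF HG Hc0 HFG. pose proof PI_RGT_0 as HP.
(* The circles correspond to Im tau = 3/4 and Im tau = 1/2: values are bounded on the larger one and
   needed only inside the smaller one. *)
pose (r0 := exp (- (PI * (3 / 4) * / INR n))). pose (r1 := exp (- (PI * (1 / 2) * / INR n))).
assert (Hin : (0 < / INR n)%R) by now apply Rinv_0_lt_compat.
assert (HPn : (0 < PI * / INR n)%R) by nra.
assert (Hr0 : (0 < r0)%R) by apply exp_pos.
assert (Hr01 : (r0 < r1)%R) by (apply exp_increasing; nra).
assert (Hr1 : (r1 < 1)%R) by (apply Rlt_le_trans with (exp 0); [apply exp_increasing; nra|rewrite exp_0; lra]).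
pose (rho := (r0 / r1)%R).
assert (Hrho : (0 < rho < 1)%R).
{ unfold rho. split; [apply Rdiv_lt_0_compat; lra|]. apply (Rmult_lt_reg_r r1); [lra|].
  unfold Rdiv; rewrite Rmult_assoc, Rinv_l; lra. }
assert (Hlow : forall tau, (3 / 4 <= Im tau)%R -> (Cmod (nome_root tau) <= r0)%R).
{ intros tau Ht. rewrite Cmod_nome_root. apply exp_le. nra. }
destruct HG as (G1 & _ & G3).
pose (g := psum (fun k => c (S k))).
assert (HFg : forall tau, (0 < Im tau)%R -> F tau = nome_root tau * g (nome_root tau)).
{ intros tau Ht. rewrite HFG, G3, psum_split, Hc0 by (auto; now apply Cmod_nome_root_lt1). unfold g; ring. }
assert (Hgc := pconv_tail c G1).
(* The factor rho^l gained from the zero of order l must beat the 1/(1 - rho) lost in summing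
   Cauchy's estimates. *)
destruct (pow_lt_1_zero rho) with (y := ((1 - rho) / 2)%R) as [l0 Hl0]; [rewrite Rabs_pos_eq; lra|lra|].
pose (l := l0).
assert (Hl : (rho ^ l * / (1 - rho) <= / 2)%R).
{ specialize (Hl0 l (le_n _)). rewrite Rabs_pos_eq in Hl0 by (apply pow_le; lra).
  apply (Rmult_le_reg_r (1 - rho)); [lra|]. rewrite Rmult_assoc, Rinv_l, Rmult_1_r by lra. lra. }
assert (Hpow : exists d, pconv d /\ forall x, (Cmod x < 1)%R -> psum d x = g x ^ l).
{ clear -Hgc. induction l as [|m (d & D1 & D2)].
  - pose (c1 := fun k => if Nat.eq_dec k 0 then RtoC 1 else 0).
    assert (Z : forall x, summable (pterm c1 x) /\ psum c1 x = pterm c1 x O).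
    { intros x. apply csum_single. intros k Hk. unfold pterm, c1. destruct Nat.eq_dec; [easy|ring]. }
    exists c1; split; [intros x _; apply Z|]. intros x _. rewrite (proj2 (Z x)). unfold pterm, c1; simpl; ring.
  - exists (conv (fun k => c (S k)) d); split; [intros x Hx; apply summable_conv; auto|].
    intros x Hx. rewrite psum_conv by auto. rewrite D2 by auto. reflexivity. }
destruct Hpow as (d & D1 & D2).
assert (HFl : forall tau, (0 < Im tau)%R -> F tau ^ l = nome_root tau ^ l * psum d (nome_root tau)).
{ intros tau Ht. rewrite HFg, D2, Cpow_mult_l; auto. now apply Cmod_nome_root_lt1. }
assert (Hr1l : (0 < r1 ^ l)%R) by (apply pow_lt; lra).
assert (half : forall B, (forall tau, (0 < Im tau)%R -> (Cmod (F tau ^ l) <= B)%R) ->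
  forall tau, (0 < Im tau)%R -> (Cmod (F tau ^ l) <= B / 2)%R).
{ intros B HB tau Ht. destruct (reduce_im tau Ht) as (t' & Ht' & HFt). rewrite <- (HFt F HF).
  assert (Ht0 : (0 < Im t')%R) by lra.
  assert (HB0 : (0 <= B)%R) by (eapply Rle_trans; [apply Cmod_ge_0|apply (HB tau Ht)]).
  assert (Hcoef : forall k, (Cmod (d k) * r1 ^ k <= B / r1 ^ l)%R).
  { intros k. apply cauchy_estimate; auto; [lra|]. intros s.
    destruct (nome_root_surj r1 s) as (ts & Hts & Ets); [lra|]. rewrite <- Ets.
    specialize (HB ts Hts). rewrite HFl, Cmod_mult, Cmod_pow in HB by auto.
    assert (Er : Cmod (nome_root ts) = r1) by (rewrite Ets, Cmod_mult, Cmod_chi, Cmod_R, Rabs_pos_eq; lra).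
    rewrite Er in HB. apply (Rmult_le_reg_l (r1 ^ l)); auto.
    replace (r1 ^ l * (B / r1 ^ l))%R with B by (field; lra). auto. }
  assert (Hx := Hlow t' Ht'). set (x := nome_root t') in *.
  assert (Hpd : (Cmod (psum d x) <= B / r1 ^ l * / (1 - rho))%R).
  { apply csum_Cmod. intros L HL.
    apply Rle_trans with (rsum (fun k => B / r1 ^ l * rho ^ k)%R L).
    - apply rsum_le; intros k _. unfold pterm. rewrite Cmod_mult, Cmod_pow.
      apply Rle_trans with (Cmod (d k) * r0 ^ k)%R.
      + apply Rmult_le_compat_l; [apply Cmod_ge_0|]. apply pow_incr; split; auto using Cmod_ge_0.
      + replace (r0 ^ k)%R with (r1 ^ k * rho ^ k)%R.
        * rewrite <- Rmult_assoc. apply Rmult_le_compat_r; auto. apply pow_le; lra.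
        * rewrite <- Rpow_mult_distr. f_equal. unfold rho; field; lra.
    - rewrite rsum_scal. apply Rmult_le_compat_l; [apply Rdiv_le_0_compat; auto|].
      pose proof (geom_bound (RtoC rho)) as GB. rewrite Cmod_R, Rabs_pos_eq in GB by lra.
      eapply Rle_trans; [|apply (GB ltac:(lra) L HL)]. apply rsum_le; intros k _.
      rewrite Cmod_pow, Cmod_R, Rabs_pos_eq; lra. }
  rewrite HFl, Cmod_mult, Cmod_pow by auto. fold x.
  apply Rle_trans with (r0 ^ l * (B / r1 ^ l * / (1 - rho)))%R.
  - apply Rmult_le_compat; auto using Cmod_ge_0; [apply pow_le, Cmod_ge_0|].
    apply pow_incr; split; auto using Cmod_ge_0.
  - replace (r0 ^ l * (B / r1 ^ l * / (1 - rho)))%R with (B * (rho ^ l * / (1 - rho)))%R.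
    + unfold Rdiv. apply Rmult_le_compat_l; auto.
    + assert (Er : (rho ^ l * r1 ^ l = r0 ^ l)%R).
      { rewrite <- Rpow_mult_distr. f_equal. unfold rho; field; lra. }
      rewrite <- Er. field; lra. }
destruct (psum_bound d r0 D1) as (M & HM0 & HM); [lra|].
assert (HB : forall tau, (0 < Im tau)%R -> (Cmod (F tau ^ l) <= M)%R).
{ intros tau Ht. destruct (reduce_im tau Ht) as (t' & Ht' & HFt). rewrite <- (HFt F HF).
  rewrite HFl, Cmod_mult, Cmod_pow by lra.
  assert (Hx := Hlow t' Ht'). specialize (HM _ Hx).
  assert (Cmod (nome_root t') ^ l <= 1)%R by (rewrite <- (pow1 l); apply pow_incr; split; auto using Cmod_ge_0; lra).
  pose proof (Cmod_ge_0 (psum d (nome_root t'))). assert (0 <= Cmod (nome_root t') ^ l)%R by (apply pow_le, Cmod_ge_0). nra. }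
assert (iter : forall k tau, (0 < Im tau)%R -> (Cmod (F tau ^ l) <= M * (/ 2) ^ k)%R).
{ induction k as [|k IH]; [intros; simpl; rewrite Rmult_1_r; auto|]. intros tau Ht.
  replace (M * (/ 2) ^ S k)%R with (M * (/ 2) ^ k / 2)%R by (simpl; field). now apply half. }
intros tau Ht. apply NNPP; intros Hne.
assert (Hpos : (0 < Cmod (F tau ^ l))%R) by (apply Cmod_gt_0; now apply Cpow_nz).
destruct (pow_lt_1_zero (/ 2)) with (y := (Cmod (F tau ^ l) / (M + 1))%R) as [N HN].
- rewrite Rabs_pos_eq; lra.
- apply Rdiv_lt_0_compat; lra.
- specialize (HN N (le_n _)). specialize (iter N tau Ht).
  rewrite Rabs_pos_eq in HN by (apply pow_le; lra).
  assert ((M + 1) * (/ 2) ^ N < Cmod (F tau ^ l))%R.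
  { replace (Cmod (F tau ^ l)) with ((M + 1) * (Cmod (F tau ^ l) / (M + 1)))%R by (field; lra).
    apply Rmult_lt_compat_l; lra. }
  assert (0 <= (/ 2) ^ N)%R by (apply pow_le; lra). nra.
Qed.

Lemma nome_root_T tau : nome_root (tau + 1) = chi (/ (2 * INR n)) * nome_root tau.
Proof.
unfold nome_root, chi. rewrite <- cexp_plus. f_equal.
assert (E : RtoC (/ (2 * INR n)) * 2 = RtoC (/ INR n)) by (rewrite <- RtoC_mult; f_equal; field; lra).
transitivity (PiI * tau * RtoC (/ INR n) + (RtoC (/ (2 * INR n)) * 2) * PiI); [rewrite E|]; ring.
Qed.

(** Under tau -> tau + 1 the variable X = [nome_root tau] is multiplied by the primitive 2n-th root
    of unity e^(pi i / n). Comparing leading terms as X tends to 0 forces its N-th power to be 1. *)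
Lemma order_divides N F G c : modular_inv F -> int_series G c -> c O <> 0 ->
  (forall tau, (0 < Im tau)%R -> nome_root tau ^ N * F tau = G (nome_root tau)) -> exists D, N = (2 * n * D)%nat.
Proof.
intros HF (G1 & _ & G3) Hc0 HFG.
pose (om := chi (/ (2 * INR n))).
destruct (psum_bound (fun k => c (S k)) (/ 2)) as (M & HM0 & HM); [now apply pconv_tail|lra|].
assert (Hest : forall x, (Cmod x <= / 2)%R -> (Cmod (G x - c O) <= Cmod x * M)%R).
{ intros x Hx. rewrite G3, psum_split by (auto; lra).
  replace (c O + x * psum (fun k => c (S k)) x - c O) with (x * psum (fun k => c (S k)) x) by ring.
  rewrite Cmod_mult. apply Rmult_le_compat_l; auto using Cmod_ge_0. }
assert (Hom : om ^ N = 1).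
{ apply NNPP; intros Hne.
  assert (Hpos : (0 < Cmod ((om ^ N - 1) * c O))%R).
  { apply Cmod_gt_0, Cmult_neq_0; auto. intros E; apply Hne. replace (om ^ N) with (om ^ N - 1 + 1) by ring. rewrite E; ring. }
  set (eps := Cmod ((om ^ N - 1) * c O)) in *.
  pose (r := Rmin (/ 2) (eps / (2 * M + 1) / 2)%R).
  assert (Hr : (0 < r <= / 2)%R).
  { unfold r; split; [apply Rmin_glb_lt; [lra|]|apply Rmin_l]. assert (0 < eps / (2 * M + 1))%R by (apply Rdiv_lt_0_compat; lra). lra. }
  assert (Hr2 : (r <= eps / (2 * M + 1) / 2)%R) by apply Rmin_r.
  destruct (nome_root_surj r 0) as (tau & Ht & Ex); [lra|].
  assert (Er : Cmod (nome_root tau) = r) by (rewrite Ex, Cmod_mult, Cmod_chi, Cmod_R, Rabs_pos_eq; lra).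
  pose proof (HFG tau Ht) as E1. pose proof (HFG (tau + 1) ltac:(rewrite Im_translate; auto)) as E2.
  rewrite (proj1 (HF tau Ht)), nome_root_T, Cpow_mult_l in E2. fold om in E2.
  assert (E3 : G (om * nome_root tau) = om ^ N * G (nome_root tau)) by (rewrite <- E1, <- E2; ring).
  pose proof (Hest (nome_root tau) ltac:(lra)) as B1. pose proof (Hest (om * nome_root tau)) as B2.
  assert (Hom1 : Cmod om = 1%R) by apply Cmod_chi.
  rewrite Cmod_mult, Hom1, Rmult_1_l, Er in B2. specialize (B2 ltac:(lra)). rewrite Er in B1.
  assert (eps <= 2 * (r * M))%R.
  { unfold eps. replace ((om ^ N - 1) * c O) with ((G (om * nome_root tau) - c O) + - (om ^ N * (G (nome_root tau) - c O))) by (rewrite E3; ring).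
    eapply Rle_trans; [apply Cmod_triangle|]. rewrite Cmod_opp, Cmod_mult, Cmod_pow, Hom1, pow1. lra. }
  assert (r * (2 * M + 1) <= eps / 2)%R.
  { apply (Rmult_le_compat_r (2 * M + 1)) in Hr2; [|lra]. eapply Rle_trans; [exact Hr2|]. right; field; lra. }
  nra. }
exists (N / (2 * n))%nat. pose proof (Nat.div_mod_eq N (2 * n)) as E. set (D := (N / (2 * n))%nat) in *.
pose proof (Nat.mod_upper_bound N (2 * n) ltac:(lia)) as Hm. set (m := (N mod (2 * n))%nat) in *.
destruct (Nat.eq_dec m 0) as [|Hm0]; [lia|]. exfalso.
apply (chi_neq_1 (INR m / INR (2 * n))).
- assert (0 < INR (2 * n))%R by (apply lt_0_INR; lia). split; [apply Rdiv_lt_0_compat; auto; apply lt_0_INR; lia|].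
  apply (Rmult_lt_reg_r (INR (2 * n))); auto. unfold Rdiv. rewrite Rmult_assoc, Rinv_l, Rmult_1_r, Rmult_1_l by lra.
  apply lt_INR; lia.
- unfold om in Hom. rewrite chi_pow, E in Hom. change (chi (INR m / INR (2 * n)) = 1).
  transitivity (chi (INR m / INR (2 * n) + IZR (Z.of_nat D))); [rewrite chi_add, chi_IZR; ring|].
  etransitivity; [|exact Hom]. f_equal. rewrite <- INR_IZR_INZ, plus_INR, !mult_INR. simpl (INR 2). field. lra.
Qed.

Variable g : C -> C.
Hypothesis Hg : int_series0 g 1.
Hypothesis Hgj : forall tau, (0 < Im tau)%R -> cexp (PiI * tau) ^ 2 * jinv tau = g (cexp (PiI * tau)).

Lemma nome_root_pow_n tau : nome_root tau ^ n = cexp (PiI * tau).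
Proof.
unfold nome_root. rewrite <- cexp_nat. f_equal. 
transitivity (PiI * tau * RtoC (INR n * / INR n)); [rewrite RtoC_mult; ring|]. rewrite Rinv_r by lra. ring.
Qed.
Lemma nome_root_neq_0 tau : nome_root tau <> 0. Proof. apply cexp_neq0. Qed.
Lemma nome_root_jinv tau : (0 < Im tau)%R -> nome_root tau ^ (2 * n) * jinv tau = g (1 * nome_root tau ^ n).
Proof. intros Ht. rewrite Nat.mul_comm, Cpow_mult_r, Cmult_1_l, nome_root_pow_n. auto. Qed.
Lemma jinv_modular_inv : modular_inv jinv.
Proof. intros tau Ht; split; [now apply jinv_T|now apply jinv_S]. Qed.

Definition peval (l : list C) (z : C) : C := fold_right (fun a acc => a + z * acc) 0 l.
Lemma peval_app l l' z : peval (l ++ l') z = peval l z + z ^ length l * peval l' z.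
Proof. induction l as [|a l IH]; simpl; [ring|]. rewrite IH; ring. Qed.
Lemma peval_zeros k z : peval (repeat (RtoC 0) k) z = 0.
Proof. induction k as [|k IH]; simpl; [auto|]. rewrite IH; ring. Qed.

(** In X = [nome_root tau], j^D has leading term X^(-2nD) with coefficient 1, so subtracting c_0 j^D
    removes the top polar term without any division. *)
Lemma sub_top N D F G c : modular_inv F -> int_series G c -> N = (2 * n * D)%nat ->
  (forall tau, (0 < Im tau)%R -> nome_root tau ^ N * F tau = G (nome_root tau)) ->
  modular_inv (fun tau => F tau - c O * jinv tau ^ D) /\ exists G' c', int_series G' c' /\ c' O = 0 /\
  forall tau, (0 < Im tau)%R -> nome_root tau ^ N * (F tau - c O * jinv tau ^ D) = G' (nome_root tau).
Proof.
intros HF HG HN HFG. split.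
- intros tau Ht. destruct (HF tau Ht) as [-> ->]. destruct (jinv_modular_inv tau Ht) as [-> ->]. auto.
- assert (HAc : algint (c O)) by (destruct HG as (_ & H & _); auto).
  assert (H0 : int_series0 G (c O)) by (exists c; auto).
  assert (Hgn : int_series0 (fun x => g (1 * x ^ n)) 1) by (apply int_series0_comp; auto using algint_1, Cmod_1).
  pose proof (int_series0_minus _ _ _ _ H0 (int_series0_scal _ _ _ HAc (int_series0_pow _ _ D Hgn))) as (c' & HG' & Hc').
  exists (fun x => G x - c O * g (1 * x ^ n) ^ D), c'. split; auto. split.
  + rewrite Hc', Cpow_1_l; ring.
  + intros tau Ht. rewrite <- HFG, <- nome_root_jinv by auto. rewrite Cpow_mult_l, <- Cpow_mult_r, <- HN. ring.
Qed.

Lemma drop_order N F G c : int_series G c -> c O = 0 ->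
  (forall tau, (0 < Im tau)%R -> nome_root tau ^ S N * F tau = G (nome_root tau)) ->
  exists G' c', int_series G' c' /\ forall tau, (0 < Im tau)%R -> nome_root tau ^ N * F tau = G' (nome_root tau).
Proof.
intros (G1 & G2 & G3) Hc HFG. exists (psum (fun k => c (S k))), (fun k => c (S k)). split.
- split; [now apply pconv_tail|auto].
- intros tau Ht. apply (Cmult_cancel_r (nome_root tau)); [apply nome_root_neq_0|].
  transitivity (nome_root tau ^ S N * F tau); [simpl; ring|]. rewrite HFG, G3, psum_split, Hc by (auto; now apply Cmod_nome_root_lt1). ring.
Qed.

(** Induction on the pole order: a vanishing leading coefficient lowers it directly, otherwise
    [order_divides] provides a power of j to subtract. The base case is Schwarz's lemma. The bound
    on [length l] says that the degree in j is at most N / (2n). *)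
Lemma q_expansion_principle N : forall F G c, modular_inv F -> int_series G c ->
  (forall tau, (0 < Im tau)%R -> nome_root tau ^ N * F tau = G (nome_root tau)) ->
  exists l, List.Forall algint l /\ (2 * n * length l <= N + 2 * n)%nat /\ forall tau, (0 < Im tau)%R -> F tau = peval l (jinv tau).
Proof.
induction N as [|N IH]; intros F G c HF HG HFG.
- destruct (sub_top 0 0 F G c HF HG ltac:(lia) HFG) as (HF2 & G' & c' & HG' & Hc' & HFG').
  exists (c O :: nil). split; [constructor; auto; apply HG|]. split; [simpl; lia|].
  intros tau Ht. assert (E : F tau - c O * jinv tau ^ 0 = 0).
  { apply (schwarz (fun tau => F tau - c O * jinv tau ^ 0) G' c'); auto.
    intros t Htt. rewrite <- HFG' by auto. simpl; ring. }
  simpl in E |- *. transitivity (F tau - c O * 1 + c O); [ring|]. rewrite E; ring.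
- destruct (classic (c O = 0)) as [Hc0|Hc0].
  + destruct (drop_order N F G c HG Hc0 HFG) as (G' & c' & HG' & HFG').
    destruct (IH F G' c' HF HG' HFG') as (l & Hl & Hlen & Hev). exists l; split; auto. split; [lia|auto].
  + destruct (order_divides _ F G c HF HG Hc0 HFG) as [D HD].
    destruct (sub_top (S N) D F G c HF HG HD HFG) as (HF2 & G' & c' & HG' & Hc' & HFG').
    destruct (drop_order N _ G' c' HG' Hc' HFG') as (G2 & c2 & HG2 & HFG2).
    destruct (IH _ G2 c2 HF2 HG2 HFG2) as (l & Hl & Hlen & Hev).
    (* The remainder has pole order below 2 n D, so its polynomial has degree less than D; padding
       with zeros puts [c O] at degree exactly D. *)
    assert (HlD : (length l <= D)%nat) by nia.
    exists (l ++ repeat (RtoC 0) (D - length l) ++ c O :: nil). split; [|split].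
    * apply Forall_app; split; auto. apply Forall_app; split.
      -- apply Forall_forall; intros z Hz. apply repeat_spec in Hz as ->. apply algint_0.
      -- constructor; auto. apply HG.
    * rewrite !length_app, repeat_length. simpl length. nia.
    * intros tau Ht. rewrite !peval_app, peval_zeros, repeat_length, <- Hev by auto.
      simpl peval. transitivity (F tau - c O * jinv tau ^ D + jinv tau ^ (length l + (D - length l)) * c O).
      -- replace (length l + (D - length l))%nat with D by lia. ring.
      -- rewrite Cpow_add_r. ring.
Qed.

(** F is a polynomial in j with leading coefficient u and integral lower coefficients; at a zero of
    F, division by the unit u leaves a monic equation for j. *)
Lemma unit_leading_zero N F G u tau0 : modular_inv F -> int_series0 G u -> u <> 0 -> algint (/ u) ->
  (forall tau, (0 < Im tau)%R -> nome_root tau ^ N * F tau = G (nome_root tau)) ->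
  (0 < Im tau0)%R -> F tau0 = 0 -> algint (jinv tau0).
Proof.
intros HF (c & HG & Hc) Hu HAu HFG Ht0 HF0.
assert (Hc0 : c O <> 0) by congruence.
destruct (order_divides _ F G c HF HG Hc0 HFG) as [D HD].
destruct (sub_top N D F G c HF HG HD HFG) as (HF2 & G' & c' & HG' & Hc' & HFG').
assert (Hl : exists l, List.Forall algint l /\ length l = D /\ F tau0 - c O * jinv tau0 ^ D = peval l (jinv tau0)).
{ destruct N as [|N].
  - exists nil. split; auto. split; [simpl; nia|].
    apply (schwarz (fun tau => F tau - c O * jinv tau ^ D) G' c'); auto.
    intros t Htt. rewrite <- HFG' by auto. simpl; ring.
  - destruct (drop_order N _ G' c' HG' Hc' HFG') as (G2 & c2 & HG2 & HFG2).
    destruct (q_expansion_principle N _ G2 c2 HF2 HG2 HFG2) as (l & Hl & Hlen & Hev).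
    assert (HlD : (length l <= D)%nat) by nia.
    exists (l ++ repeat (RtoC 0) (D - length l)). split; [|split].
    + apply Forall_app; split; auto.
      apply Forall_forall; intros z Hz. apply repeat_spec in Hz as ->. apply algint_0.
    + rewrite length_app, repeat_length. lia.
    + rewrite peval_app, peval_zeros, Hev by auto. ring. }
destruct Hl as (l & Hl & Hlen & Hev). rewrite HF0, Hc in Hev.
apply (algint_root (map (fun a => / u * a) l)).
- apply Forall_map. eapply Forall_impl; [|exact Hl]. intros a Ha. apply algint_mult; auto.
- set (z := jinv tau0) in *.
  assert (E : forall m, fold_right (fun a acc => a + z * acc) 1 (map (fun a => / u * a) m) = z ^ length m + / u * peval m z).
  { induction m as [|a m IH]; simpl; [ring|]. rewrite IH; ring. }
  etransitivity; [apply E|]. rewrite Hlen, <- Hev. field; auto.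
Qed.
End Principle.

(** * Integrality at imaginary quadratic points *)

Definition mat : Type := (Z * Z * Z * Z)%type.
Definition mmul (M N : mat) : mat :=
  let '(a, b, c, d) := M in let '(e, f, g, h) := N in
  (a * e + b * g, a * f + b * h, c * e + d * g, c * f + d * h)%Z.
Definition mdet (M : mat) : Z := let '(a, b, c, d) := M in (a * d - b * c)%Z.
Definition madj (M : mat) : mat := let '(a, b, c, d) := M in (d, - b, - c, a)%Z.
Definition mact (M : mat) (tau : C) : C :=
  let '(a, b, c, d) := M in (RtoC (IZR a) * tau + RtoC (IZR b)) / (RtoC (IZR c) * tau + RtoC (IZR d)).

Lemma mat_eq (a b c d a' b' c' d' : Z) : a = a' -> b = b' -> c = c' -> d = d' -> (a, b, c, d) = (a', b', c', d').
Proof. congruence. Qed.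
Lemma mmul_assoc M N P : mmul M (mmul N P) = mmul (mmul M N) P.
Proof. destruct M as [[[? ?] ?] ?], N as [[[? ?] ?] ?], P as [[[? ?] ?] ?]. apply mat_eq; ring. Qed.
Lemma mdet_mul M N : mdet (mmul M N) = (mdet M * mdet N)%Z.
Proof. destruct M as [[[? ?] ?] ?], N as [[[? ?] ?] ?]. simpl. ring. Qed.
Lemma madj_l M N : mdet M = 1%Z -> mmul (madj M) (mmul M N) = N.
Proof.
destruct M as [[[a b] c] d], N as [[[e f] g] h]. simpl. intros H.
apply mat_eq; [transitivity ((a * d - b * c) * e)%Z|transitivity ((a * d - b * c) * f)%Z|
  transitivity ((a * d - b * c) * g)%Z|transitivity ((a * d - b * c) * h)%Z]; solve [ring | rewrite H; ring].
Qed.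
Lemma madj_r M N : mdet M = 1%Z -> mmul (mmul N M) (madj M) = N.
Proof.
destruct M as [[[a b] c] d], N as [[[e f] g] h]. simpl. intros H.
apply mat_eq; [transitivity ((a * d - b * c) * e)%Z|transitivity ((a * d - b * c) * f)%Z|
  transitivity ((a * d - b * c) * g)%Z|transitivity ((a * d - b * c) * h)%Z]; solve [ring | rewrite H; ring].
Qed.
Lemma mdet_adj M : mdet (madj M) = mdet M.
Proof. destruct M as [[[? ?] ?] ?]. simpl. ring. Qed.

Lemma mact_den (a b c d : Z) tau : (0 < Im tau)%R -> (a * d - b * c)%Z <> 0%Z -> RtoC (IZR c) * tau + RtoC (IZR d) <> 0.
Proof.
intros Ht Hd E. pose proof (f_equal Im E) as E1. rewrite Im_translate, Im_scal_R in E1. change (Im 0) with 0%R in E1.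
assert (Ec : IZR c = 0%R) by nra. apply eq_IZR in Ec. subst c.
rewrite Cmult_0_l, Cplus_0_l in E. apply RtoC_inj, eq_IZR in E. subst d. lia.
Qed.
Lemma mact_im M tau : (0 < Im tau)%R -> (0 < mdet M)%Z -> (0 < Im (mact M tau))%R.
Proof.
destruct M as [[[a b] c] d]. intros Ht Hd. simpl in Hd.
pose proof (mact_den a b c d tau Ht ltac:(lia)) as Hden.
assert (Hdet : (0 < IZR a * IZR d - IZR b * IZR c)%R).
{ rewrite <- !mult_IZR, <- minus_IZR. now apply IZR_lt. }
destruct tau as [x y]. unfold Im in Ht; simpl in Ht.
assert (Hn : (0 < (IZR c * x + IZR d) * (IZR c * x + IZR d) + (IZR c * y) * (IZR c * y))%R).
{ destruct (Req_dec (IZR c) 0) as [E|E].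
  - rewrite E in *. assert (IZR d <> 0)%R by (intros Ed; rewrite Ed in Hdet; lra). nra.
  - assert (IZR c * y <> 0)%R by (apply Rmult_integral_contrapositive_currified; auto; lra). pose proof (Rsqr_pos_lt _ H). pose proof (Rle_0_sqr (IZR c * x + IZR d)). unfold Rsqr in *. lra. }
replace (Im (mact (a, b, c, d) (x, y))) with
  ((IZR a * IZR d - IZR b * IZR c) * y / ((IZR c * x + IZR d) * (IZR c * x + IZR d) + (IZR c * y) * (IZR c * y)))%R.
- apply Rdiv_lt_0_compat; auto. now apply Rmult_lt_0_compat.
- unfold mact, Cdiv, Cinv, Im; simpl. field. nra.
Qed.
Lemma mact_mul M N tau : (0 < Im tau)%R -> (0 < mdet M)%Z -> (0 < mdet N)%Z ->
  mact M (mact N tau) = mact (mmul M N) tau.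
Proof.
intros Ht HM HN.
pose proof (mact_im N tau Ht HN) as HI. pose proof (mdet_mul M N) as HMN.
destruct M as [[[a b] c] d], N as [[[e f] g] h].
pose proof (mact_den e f g h tau Ht ltac:(simpl in HN; lia)) as D1.
pose proof (mact_den a b c d _ HI ltac:(simpl in HM; lia)) as D2.
assert (D3 : RtoC (IZR (c * e + d * g)) * tau + RtoC (IZR (c * f + d * h)) <> 0).
{ apply (mact_den (a * e + b * g) (a * f + b * h)); auto. simpl in HMN, HM, HN. nia. }
unfold mact, mmul in *. rewrite !plus_IZR, !mult_IZR, !RtoC_plus, !RtoC_mult in *.
set (A' := RtoC (IZR a)) in *. set (B' := RtoC (IZR b)) in *. set (C' := RtoC (IZR c)) in *. set (D' := RtoC (IZR d)) in *.
set (E' := RtoC (IZR e)) in *. set (F' := RtoC (IZR f)) in *. set (G' := RtoC (IZR g)) in *. set (H' := RtoC (IZR h)) in *.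
field. repeat split; auto.
Qed.

Definition hnf (r : mat) : Prop := let '(a, b, c, d) := r in (0 < a /\ 0 < d /\ 0 <= b < d /\ c = 0)%Z.

(** The Euclidean algorithm on the first column. Each row operation is a translation or the
    inversion, so equality of the j-values is carried along in the induction. *)
Lemma hermite m : forall M, (let '(a, b, c, d) := M in Z.abs c <= Z.of_nat m)%Z -> (0 < mdet M)%Z ->
  exists g r, mdet g = 1%Z /\ hnf r /\ M = mmul g r /\ forall tau, (0 < Im tau)%R -> jinv (mact M tau) = jinv (mact r tau).
Proof.
pose proof jinv_modular_inv as HJ.
assert (base : forall a b d, (0 < d)%Z -> (0 < a)%Z ->
  exists g r, mdet g = 1%Z /\ hnf r /\ (a, b, 0%Z, d) = mmul g r /\ forall tau, (0 < Im tau)%R -> jinv (mact (a, b, 0%Z, d) tau) = jinv (mact r tau)).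
{ intros a b d Hd Ha. exists (1, b / d, 0, 1)%Z, (a, b mod d, 0, d)%Z. split; [unfold mdet; ring|].
  pose proof (Z.mod_pos_bound b d Hd). pose proof (Z.div_mod b d ltac:(lia)) as E.
  split; [simpl; lia|]. split; [unfold mmul; apply mat_eq; lia|].
  intros tau Ht.
  rewrite <- (modular_inv_Z jinv HJ (b / d) (mact (a, b mod d, 0, d)%Z tau)) by (apply mact_im; simpl; auto; nia).
  f_equal. unfold mact. rewrite E at 1. rewrite plus_IZR, mult_IZR, RtoC_plus, RtoC_mult.
  field. rewrite ?Cmult_0_l, ?Cplus_0_l. intros E0; apply RtoC_inj, eq_IZR in E0; lia. }
induction m as [|m IH]; intros [[[a b] c] d] Hc Hdet; simpl in Hdet.
- assert (c = 0%Z) by lia. subst c. assert (Had : (0 < a * d)%Z) by lia.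
  (* From a d > 0 the two diagonal entries may both be negative; then the matrix -1, which acts
     trivially, is split off. *)
  destruct (Z_lt_dec 0 d) as [Hd|Hd]; [apply base; auto; now apply (Z.mul_pos_cancel_r a d)|].
  assert (Hd' : (d < 0)%Z) by (destruct (Z.eq_dec d 0) as [->|]; lia).
  destruct (base (- a) (- b) (- d))%Z as (g & r & Hg & Hr & E & Hj); [lia|nia|].
  exists (mmul (-1, 0, 0, -1)%Z g), r. split; [now rewrite mdet_mul, Hg|]. split; auto. split.
  + rewrite <- mmul_assoc, <- E. unfold mmul. apply mat_eq; ring.
  + intros tau Ht. rewrite <- Hj by auto. f_equal. unfold mact. rewrite !opp_IZR, !RtoC_opp.
    assert (RtoC (IZR d) <> 0) by (intros E0; apply RtoC_inj, eq_IZR in E0; nia).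
    field. auto.
- destruct (Z.eq_dec c 0) as [->|Hc0]; [apply IH; simpl; lia|].
  pose (k := (a / c)%Z). pose proof (Z.div_mod a c Hc0) as Ea. fold k in Ea.
  assert (Hmod : (Z.abs (a mod c) < Z.abs c)%Z) by (apply Z.mod_bound_abs; auto).
  (* Translation by -k followed by inversion; the factor (-k, 1, -1, 0) below is the inverse of this
     step. *)
  destruct (IH (- c, - d, a mod c, b - k * d)%Z) as (g & r & Hg & Hr & E & Hj); [lia|simpl; nia|].
  exists (mmul (- k, 1, -1, 0)%Z g), r. split; [rewrite mdet_mul, Hg; simpl; ring|]. split; auto. split.
  + rewrite <- mmul_assoc, <- E. unfold mmul. apply mat_eq; lia.
  + intros tau Ht. rewrite <- Hj by auto.
    pose proof (mact_den a b c d tau Ht ltac:(lia)) as D1.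
    pose proof (mact_im (a, b, c, d) tau Ht ltac:(simpl; lia)) as I1.
    set (z := mact (a, b, c, d) tau) in *.
    rewrite <- (modular_inv_Z jinv HJ (- k) z I1).
    assert (I2 : (0 < Im (z + RtoC (IZR (- k))))%R) by (rewrite Im_translate; auto).
    rewrite <- (proj2 (HJ _ I2)). f_equal.
    pose proof (uhp_neq_0 _ I2) as N2.
    assert (E2 : z + RtoC (IZR (- k)) = (RtoC (IZR (a mod c)) * tau + RtoC (IZR (b - k * d))) / (RtoC (IZR c) * tau + RtoC (IZR d))).
    { unfold z, mact. rewrite opp_IZR, minus_IZR, mult_IZR, RtoC_opp, RtoC_minus, RtoC_mult.
      replace (a mod c)%Z with (a - c * k)%Z by lia. rewrite minus_IZR, mult_IZR, RtoC_minus, RtoC_mult.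
      field; auto. }
    rewrite E2 in *. unfold mact. rewrite !opp_IZR, !RtoC_opp. field. split; auto.
    intros E3. apply N2. rewrite E3. unfold Cdiv; ring.
Qed.
(** Positivity forces the diagonal of [g] to be 1, and the off-diagonal entry q satisfies |q d| < d.
    Hence distinct Hermite forms represent distinct left cosets of SL_2(Z). *)
Lemma hnf_unique g r r' : mdet g = 1%Z -> hnf r -> hnf r' -> mmul g r = r' -> r = r'.
Proof.
destruct g as [[[p q] s] t], r as [[[a b] c] d], r' as [[[a' b'] c'] d'].
unfold mdet, hnf, mmul. intros Hg (Ha & Hd & Hb & ->) (Ha' & Hd' & Hb' & ->) E.
injection E as E1 E2 E3 E4.
assert (s = 0%Z) by (apply (Z.mul_reg_r s 0 a); lia). subst s.
assert (Hpt : (p * t = 1)%Z) by lia.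
assert (Hp : (0 < p)%Z) by (apply (Z.mul_pos_cancel_r p a); lia).
assert (p = 1%Z) by (apply Z.eq_mul_1_nonneg with t; lia). subst p.
assert (t = 1%Z) by lia. subst t.
assert (d' = d) by lia. subst d'.
assert (q = 0%Z) by nia. subst q. apply mat_eq; lia.
Qed.

Definition hnfs (n : Z) : list mat :=
  let zs := map Z.of_nat (seq 0 (S (Z.to_nat n))) in
  filter (fun r => let '(a, b, c, d) := r in
     ((0 <? a) && (0 <? d) && (0 <=? b) && (b <? d) && (c =? 0) && (a * d =? n))%Z%bool)
   (list_prod (list_prod (list_prod zs zs) (0%Z :: nil)) zs).
Lemma in_hnfs n r : (0 < n)%Z -> In r (hnfs n) <-> hnf r /\ mdet r = n.
Proof.
intros Hn. destruct r as [[[a b] c] d]. unfold hnfs; cbv zeta. rewrite filter_In; unfold mat. rewrite !in_prod_iff, !in_map_iff.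
rewrite !Bool.andb_true_iff, !Z.ltb_lt, !Z.leb_le, !Z.eqb_eq. simpl hnf; simpl mdet. split.
- intros (_ & H). repeat split; try lia; nia.
- intros ((Ha & Hd & Hb & Hc) & Hdet). subst c.
  assert (a * d = n)%Z by lia.
  split; [|repeat split; try lia].
  split; [split; [split|]|].
  + exists (Z.to_nat a); split; [lia|apply in_seq; nia].
  + exists (Z.to_nat b); split; [lia|apply in_seq; nia].
  + simpl; auto.
  + exists (Z.to_nat d); split; [lia|apply in_seq; nia].
Qed.
Lemma NoDup_hnfs n : NoDup (hnfs n).
Proof.
unfold hnfs; cbv zeta. apply NoDup_filter.
assert (Hz : NoDup (map Z.of_nat (seq 0 (S (Z.to_nat n))))).
{ apply FinFun.Injective_map_NoDup; [intros x y; lia|apply seq_NoDup]. }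
repeat apply NoDup_list_prod; auto. constructor; auto; constructor.
Qed.

(** * The product over Hermite forms of given determinant *)

Definition cprod {I} (f : I -> C) (L : list I) : C := fold_right (fun i a => f i * a) 1 L.
Lemma cprod_perm {I} (f : I -> C) L L' : Permutation L L' -> cprod f L = cprod f L'.
Proof. intros H; induction H; simpl; auto; [now rewrite IHPermutation|ring|congruence]. Qed.
Lemma cprod_map {I J} (f : J -> C) (s : I -> J) L : cprod f (map s L) = cprod (fun i => f (s i)) L.
Proof. induction L as [|a L IH]; simpl; congruence. Qed.
Lemma cprod_ext {I} (f g : I -> C) L : (forall i, In i L -> f i = g i) -> cprod f L = cprod g L.
Proof. induction L as [|a L IH]; simpl; intros H; auto. rewrite H, IH; auto. Qed.
Lemma cprod_zero {I} (f : I -> C) L i : In i L -> f i = 0 -> cprod f L = 0.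
Proof. induction L as [|a L IH]; simpl; intros []; intros H0; [subst; rewrite H0; ring|rewrite IH; auto; ring]. Qed.

Section Hecke.
Variable n : Z.
Hypothesis Hn : (0 < n)%Z.
Definition hecke (tau : C) : C := cprod (fun r => jinv tau - jinv (mact r tau)) (hnfs n).

(** Right multiplication by [g] permutes the left cosets of SL_2(Z) in the matrices of determinant
    n, hence the factors of the product. *)
Lemma hecke_invariant g : mdet g = 1%Z -> (forall tau, (0 < Im tau)%R -> jinv (mact g tau) = jinv tau) ->
  forall tau, (0 < Im tau)%R -> hecke (mact g tau) = hecke tau.
Proof.
intros Hg Hj.
pose (P := fun r r' : mat => In r' (hnfs n) /\ (exists g', mdet g' = 1%Z /\ mmul r g = mmul g' r') /\
  forall tau, (0 < Im tau)%R -> jinv (mact (mmul r g) tau) = jinv (mact r' tau)).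
assert (HP : forall r, In r (hnfs n) -> exists r', P r r').
{ intros r Hr. apply in_hnfs in Hr as [Hr Hd]; auto.
  assert (Hdet : mdet (mmul r g) = n) by (rewrite mdet_mul, Hd, Hg; ring).
  destruct (mmul r g) as [[[a b] c] d] eqn:E.
  destruct (hermite (Z.to_nat (Z.abs c)) (a, b, c, d)) as (g' & r' & Hg' & Hr' & E' & Hj'); [lia|rewrite Hdet; auto|].
  exists r'. split; [|split; [exists g'; split; auto; now rewrite E|now rewrite E]].
  apply in_hnfs; auto. split; auto. rewrite <- Hdet, E', mdet_mul, Hg'. ring. }
(* The Hermite form of [mmul r g]. It is injective by [hnf_unique], hence a permutation of the
   finite list. *)
pose (sg := fun r => epsilon (inhabits r) (P r)).
assert (Hsg : forall r, In r (hnfs n) -> P r (sg r)).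
{ intros r Hr. unfold sg. apply epsilon_spec. auto. }
assert (Hperm : Permutation (map sg (hnfs n)) (hnfs n)).
{ apply NoDup_Permutation_bis.
  - assert (Hinj : forall r r2, In r (hnfs n) -> In r2 (hnfs n) -> sg r = sg r2 -> r = r2).
    { intros r r2 Hr Hr2 E. destruct (Hsg r Hr) as (_ & (g1 & Hg1 & E1) & _). destruct (Hsg r2 Hr2) as (_ & (g2 & Hg2 & E2) & _).
      apply in_hnfs in Hr as [Hr _]; auto. apply in_hnfs in Hr2 as [Hr2 _]; auto.
      apply (hnf_unique (mmul g2 (madj g1))); auto.
      - rewrite mdet_mul, mdet_adj, Hg1, Hg2; reflexivity.
      - rewrite <- (madj_r g (mmul (mmul g2 (madj g1)) r) Hg), <- (madj_r g r2 Hg). f_equal.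
        rewrite <- !mmul_assoc, E1, madj_l by auto. rewrite E, E2. reflexivity. }
    assert (Hsub : forall L, incl L (hnfs n) -> NoDup L -> NoDup (map sg L)).
    { induction L as [|r L IH]; intros Hi HL; simpl; [constructor|]. inversion HL; subst. constructor.
      - intros Hin. apply in_map_iff in Hin as (r2 & E & Hr2). apply H1.
        rewrite <- (Hinj r2 r); auto; apply Hi; simpl; auto.
      - apply IH; auto. intros x Hx; apply Hi; simpl; auto. }
    apply Hsub; [apply incl_refl|apply NoDup_hnfs].
  - rewrite length_map. auto.
  - intros r' Hr'. apply in_map_iff in Hr' as (r & <- & Hr). apply (Hsg r Hr). }
intros tau Ht. unfold hecke. transitivity (cprod (fun r => jinv tau - jinv (mact r tau)) (map sg (hnfs n))); [|now apply cprod_perm].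
rewrite cprod_map.
apply cprod_ext. intros r Hr. destruct (Hsg r Hr) as (_ & _ & Hjr). apply in_hnfs in Hr as [_ Hd]; auto.
rewrite Hj, mact_mul, Hjr; auto; lia.
Qed.
Lemma hecke_modular : modular_inv hecke.
Proof.
pose proof jinv_modular_inv as HJ.
assert (ET : forall tau, mact (1, 1, 0, 1)%Z tau = tau + 1).
{ intros tau. unfold mact. field. }
assert (ES : forall tau, (0 < Im tau)%R -> mact (0, -1, 1, 0)%Z tau = - / tau).
{ intros tau Ht. unfold mact. pose proof (uhp_neq_0 tau Ht).
  replace (RtoC (-1)) with (- RtoC 1) by (rewrite <- RtoC_opp; reflexivity). field.
  replace (1 * tau + 0) with tau by ring. auto. }
intros tau Ht. split.
- rewrite <- ET. apply hecke_invariant; auto. intros t Htt. rewrite ET. apply (proj1 (HJ t Htt)).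
- rewrite <- ES by auto. apply hecke_invariant; auto. intros t Htt. rewrite ES by auto. apply (proj2 (HJ t Htt)).
Qed.

Variable g : C -> C.
Hypothesis Hg : int_series0 g 1.
Hypothesis Hgj : forall tau, (0 < Im tau)%R -> cexp (PiI * tau) ^ 2 * jinv tau = g (cexp (PiI * tau)).
Hypothesis nonsquare : forall a, (a * a)%Z <> n.
Let m := Z.to_nat n.
Let Hm : (0 < m)%nat. Proof. unfold m; lia. Qed.
Let HmR : INR m = IZR n. Proof. unfold m. rewrite INR_IZR_INZ, Z2Nat.id; auto; lia. Qed.

Lemma unit_pow_mul (a b : C) : (a <> 0 /\ algint (/ a)) -> (b <> 0 /\ algint (/ b)) -> a * b <> 0 /\ algint (/ (a * b)).
Proof.
intros [Ha Ha'] [Hb Hb']. split; [now apply Cmult_neq_0|].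
replace (/ (a * b)) with (/ a * / b) by (field; auto). now apply algint_mult.
Qed.

(* The leading coefficient is 1 if a < d and minus an even power of a root of unity if a > d; a = d would make n a square. *)
Lemma hecke_factor r : In r (hnfs n) -> exists K G u, int_series0 G u /\ u <> 0 /\ algint (/ u) /\
  forall tau, (0 < Im tau)%R -> nome_root m tau ^ K * (jinv tau - jinv (mact r tau)) = G (nome_root m tau).
Proof.
intros Hr. apply in_hnfs in Hr as [Hr Hd]; auto. destruct r as [[[a b] c] d].
destruct Hr as (Ha & Hdp & Hb & ->). simpl in Hd.
assert (Had : (a * d = n)%Z) by lia. clear Hd.
assert (Hdz : IZR d <> 0%R) by (intros E; apply eq_IZR in E; lia).
assert (Hnz : IZR n <> 0%R) by (intros E; apply eq_IZR in E; lia).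
pose (zeta := cexp (PiI * RtoC (IZR b / IZR d))).
assert (Hz1 : Cmod zeta = 1%R).
{ unfold zeta. rewrite Cmod_cexp, <- exp_0. f_equal. unfold PiI; simpl. ring. }
assert (Hzn : zeta ^ (2 * Z.to_nat d) = 1).
{ unfold zeta. rewrite <- cexp_nat, mult_INR, (INR_IZR_INZ (Z.to_nat d)), Z2Nat.id by lia.
  rewrite <- (cexp_Z b (2 * PiI)) by apply cexp_2PiI. f_equal.
  replace (IZR b) with (IZR b / IZR d * IZR d)%R at 2 by (field; auto). rewrite !RtoC_mult. simpl (INR 2).
  replace (RtoC (1 + 1)) with (RtoC 2) by (f_equal; ring). ring. }
assert (Hz0 : zeta <> 0) by apply cexp_neq0.
assert (HzA : algint zeta) by (apply (algint_root_of_unity (2 * Z.to_nat d)); auto; lia).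
assert (HziA : algint (/ zeta)).
{ apply (algint_root_of_unity (2 * Z.to_nat d)); [lia|]. rewrite Cpow_inv, Hzn by auto. field. }
pose (a2 := Z.to_nat (a * a)).
assert (Ha2 : (0 < a2)%nat) by (unfold a2; nia).
assert (Hjr : forall tau, (0 < Im tau)%R ->
   nome_root m tau ^ (2 * a2) * jinv (mact (a, b, 0%Z, d) tau) = (/ zeta) ^ 2 * g (zeta * nome_root m tau ^ a2)).
{ intros tau Ht. set (t' := mact (a, b, 0%Z, d) tau).
  assert (Ht' : (0 < Im t')%R) by (apply mact_im; auto; simpl; lia).
  (* Because n = a d, the slope a / d equals a^2 / n. *)
  assert (E : cexp (PiI * t') = zeta * nome_root m tau ^ a2).
  { unfold zeta, nome_root. rewrite <- cexp_nat, <- cexp_plus. f_equal. unfold a2. rewrite INR_IZR_INZ, Z2Nat.id by nia.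
    rewrite HmR, <- Had. unfold t', mact. rewrite !mult_IZR, RtoC_mult.
    assert (Haz : IZR a <> 0%R) by (intros E; apply eq_IZR in E; lia).
    rewrite RtoC_div, RtoC_inv, RtoC_mult by (auto; apply Rmult_integral_contrapositive; auto).
    assert (RtoC (IZR a) <> 0) by now apply RtoC_neq_0. assert (RtoC (IZR d) <> 0) by now apply RtoC_neq_0.
    field. auto. }
  rewrite <- E, <- Hgj, E by auto. rewrite Nat.mul_comm, Cpow_mult_r. field. auto. }
assert (Hjt : forall tau, (0 < Im tau)%R -> nome_root m tau ^ (2 * m) * jinv tau = g (1 * nome_root m tau ^ m)).
{ intros tau Ht. apply (nome_root_jinv m Hm g Hgj); auto. }
assert (Hg1 : int_series0 (fun x => g (1 * x ^ m)) 1) by (apply int_series0_comp; auto using algint_1, Cmod_1).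
assert (Hg2 : int_series0 (fun x => (/ zeta) ^ 2 * g (zeta * x ^ a2)) ((/ zeta) ^ 2 * 1)).
{ apply int_series0_scal; [now apply algint_pow|]. now apply int_series0_comp. }
destruct (Z_lt_dec a d) as [Hlt|Hge].
- assert (Hlt2 : (a2 < m)%nat) by (unfold a2, m; nia).
  exists (2 * m)%nat, (fun x => g (1 * x ^ m) - x ^ (2 * (m - a2)) * ((/ zeta) ^ 2 * g (zeta * x ^ a2))), (1 - 0).
  split; [|split; [|split]].
  + apply int_series0_minus; auto. eapply int_series0_shift; [lia|exact Hg2].
  + replace (1 - 0) with (RtoC 1) by ring. apply C1_nz.
  + replace (/ (1 - 0)) with (RtoC 1) by (field; replace (1 - 0) with (RtoC 1) by ring; apply C1_nz). apply algint_1.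
  + intros tau Ht. rewrite <- Hjr, <- Hjt by auto.
    replace (2 * m)%nat with (2 * (m - a2) + 2 * a2)%nat at 1 2 by lia. rewrite Cpow_add_r. ring.
- assert (Hda : (d < a)%Z). { destruct (Z.eq_dec a d) as [->|]; [exfalso; apply (nonsquare d); lia|lia]. }
  assert (Hlt2 : (m < a2)%nat) by (unfold a2, m; nia).
  exists (2 * a2)%nat, (fun x => x ^ (2 * (a2 - m)) * g (1 * x ^ m) - (/ zeta) ^ 2 * g (zeta * x ^ a2)), (0 - (/ zeta) ^ 2 * 1).
  assert (Hne : 0 - (/ zeta) ^ 2 * 1 <> 0).
  { replace (0 - (/ zeta) ^ 2 * 1) with (- (1) * (/ zeta) ^ 2) by ring. apply Cmult_neq_0.
    - intros E. apply C1_nz. replace (RtoC 1) with (- - (1)) by ring. rewrite E; ring.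
    - apply Cpow_nz. intros E. apply C1_nz. rewrite <- (Cinv_l zeta Hz0), E. ring. }
  split; [|split; [|split]]; auto.
  + apply int_series0_minus; auto. eapply int_series0_shift; [lia|exact Hg1].
  + replace (/ (0 - (/ zeta) ^ 2 * 1)) with (- (zeta ^ 2)); [now apply algint_opp, algint_pow|].
    apply (Cmult_cancel_r (0 - (/ zeta) ^ 2 * 1)); auto. rewrite Cinv_l by auto. rewrite Cpow_inv by auto. field. auto.
  + intros tau Ht. rewrite <- Hjr, <- Hjt by auto.
    replace (2 * a2)%nat with (2 * (a2 - m) + 2 * m)%nat by lia. rewrite Cpow_add_r. ring.
Qed.

Lemma hecke_expansion : exists K G u, int_series0 G u /\ u <> 0 /\ algint (/ u) /\
  forall tau, (0 < Im tau)%R -> nome_root m tau ^ K * hecke tau = G (nome_root m tau).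
Proof.
unfold hecke. assert (Hall := hecke_factor). revert Hall. generalize (hnfs n) as L. induction L as [|r L IH]; intros Hall.
- exists O, (fun _ => RtoC 1), (RtoC 1). split; [apply int_series0_const, algint_1|]. split; [apply C1_nz|]. split.
  + replace (/ 1) with (RtoC 1) by (field; apply C1_nz). apply algint_1.
  + intros; simpl; ring.
- destruct IH as (K & G & u & HG & Hu & HAu & E); [intros; apply Hall; simpl; auto|].
  destruct (Hall r (or_introl eq_refl)) as (K' & G' & u' & HG' & Hu' & HAu' & E').
  exists (K' + K)%nat, (fun x => G' x * G x), (u' * u).
  destruct (unit_pow_mul u' u) as [Hn1 Hn2]; auto.
  split; [now apply int_series0_mult|]. split; auto. split; auto.
  intros tau Ht. rewrite <- E, <- E' by auto. rewrite Cpow_add_r. simpl. ring.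
Qed.
End Hecke.

(** A matrix that fixes tau has a Hermite form r with j(r tau) = j(tau), so one factor of the Hecke
    product vanishes at tau and [unit_leading_zero] applies. *)
Lemma jinv_CM tau : in_imag_quadratic_upper tau -> algint (jinv tau).
Proof.
intros (Ht & a & b & c & Ha & E).
assert (HD : (0 < 4 * a * c - b * b)%Z).
{ apply lt_IZR. rewrite minus_IZR, !mult_IZR. destruct tau as [x y]. unfold Im in Ht; simpl in Ht.
  assert (Ha0 : IZR a <> 0%R) by (intros E0; apply eq_IZR in E0; lia).
  pose proof (f_equal Re E) as E1. pose proof (f_equal Im E) as E2. unfold Re, Im in E1, E2; simpl in E1, E2.
  set (a' := IZR a) in *. set (b' := IZR b) in *. set (c' := IZR c) in *.
  assert (Eb : (b' = - 2 * a' * x)%R) by (apply (Rmult_eq_reg_l y); lra).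
  assert (Ec : (c' = a' * (x * x + y * y))%R) by (rewrite Eb in E1; lra).
  rewrite Eb, Ec. replace (4 * a' * (a' * (x * x + y * y)) - -2 * a' * x * (-2 * a' * x))%R with ((2 * a' * y) * (2 * a' * y))%R by ring.
  assert (2 * a' * y <> 0)%R by (repeat apply Rmult_integral_contrapositive_currified; lra). nra. }
set (D := (4 * a * c - b * b)%Z) in *.
(* 4 n = (2 k - b)^2 + D with 0 < D < 2 k - b is not four times a square. *)
pose (k := (D + Z.abs b + 1)%Z). pose (n := (k * k - k * b + a * c)%Z).
assert (H4n : (4 * n = (2 * k - b) * (2 * k - b) + D)%Z) by (unfold n, D; ring).
assert (Ht0 : (D < 2 * k - b)%Z) by (unfold k; lia).
assert (Hn : (0 < n)%Z) by nia.
assert (Hsq : forall s, (s * s)%Z <> n).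
{ intros s Hs. set (t := (2 * k - b)%Z) in *. 
  assert (Hf : ((2 * Z.abs s - t) * (2 * Z.abs s + t) = D)%Z) by (assert (Z.abs s * Z.abs s = s * s)%Z by (rewrite <- Z.abs_mul; lia); lia).
  assert (Hp : (0 < 2 * Z.abs s - t)%Z) by (apply (Z.mul_pos_cancel_r _ (2 * Z.abs s + t)); lia).
  pose proof (Z.mul_le_mono_nonneg_r 1 (2 * Z.abs s - t) (2 * Z.abs s + t) ltac:(lia) ltac:(lia)). lia. }
(* The matrix of multiplication by a tau + k in the basis (tau, 1), with b and c entering through a
   tau^2 = - b tau - c; its determinant n is the norm of a tau + k. *)
pose (M := (k - b, - c, a, k)%Z).
assert (HdM : mdet M = n) by (unfold M, n; simpl; ring).
assert (Hfix : mact M tau = tau).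
{ assert (D1 : RtoC (IZR a) * tau + RtoC (IZR k) <> 0) by (apply (mact_den (k - b) (- c)); auto; simpl in HdM; lia).
  unfold M, mact. rewrite minus_IZR, opp_IZR, RtoC_minus, RtoC_opp.
  apply (Cmult_cancel_r (RtoC (IZR a) * tau + RtoC (IZR k))); auto.
  transitivity ((RtoC (IZR k) - RtoC (IZR b)) * tau + - RtoC (IZR c)); [field; auto|].
  transitivity (tau * (RtoC (IZR a) * tau + RtoC (IZR k)) -
    (RtoC (IZR a) * (tau * tau) + RtoC (IZR b) * tau + RtoC (IZR c))); [ring|]. rewrite E. ring. }
destruct (hermite (Z.to_nat (Z.abs a)) M) as (g' & r & Hg' & Hr & EM & Hj); [unfold M; lia|lia|].
assert (Hrn : In r (hnfs n)).
{ apply in_hnfs; auto. split; auto. rewrite <- HdM, EM, mdet_mul, Hg'. ring. }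
assert (Hz : hecke n tau = 0).
{ apply (cprod_zero _ _ r Hrn). rewrite <- Hj, Hfix by auto. ring. }
destruct jinv_expansion as (g & Hg & Hgj).
destruct (hecke_expansion n Hn g Hg Hgj Hsq) as (K & G & u & HG & Hu & HAu & HE).
apply (unit_leading_zero (Z.to_nat n) ltac:(lia) g Hg Hgj K (hecke n) G u); auto.
now apply hecke_modular.
Qed.

(** * The main theorem *)

Ltac alg_int := repeat first [assumption | apply algint_IZR | apply algint_plus | apply algint_minus | apply algint_mult | apply algint_opp | apply algint_pow].

(** The list expands [torsion_poly] by ascending degree from 0 to 24; the coefficient of x^25 is
    1. *)
Lemma torsion_poly_algint (b x : C) : algint b -> torsion_poly b x = 0 -> algint x.
Proof.
intros Hb H.
apply (algint_root (RtoC (-1) :: RtoC 5 :: RtoC 0 :: -5 * b :: RtoC 50 :: 62 + b ^ 2 :: -35 * b :: -20 * b :: 125 + 10 * b ^ 2 ::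
  RtoC (-105) :: -92 * b - b ^ 3 :: 90 * b :: 300 + 15 * b ^ 2 :: -300 - 15 * b ^ 2 :: -90 * b :: 92 * b + b ^ 3 ::
  RtoC 105 :: -125 - 10 * b ^ 2 :: 20 * b :: 35 * b :: -62 - b ^ 2 :: RtoC (-50) :: 5 * b :: RtoC 0 :: RtoC (-5) :: nil)%list).
- repeat (apply List.Forall_cons; [alg_int|]). apply List.Forall_nil.
- etransitivity; [|exact H]. unfold torsion_poly. simpl fold_right. ring.
Qed.
(** Reflects the symmetry U -> -U, which inverts [Oo / Ee] and preserves the torsion condition. *)
Lemma torsion_poly_inv (b x : C) : x <> 0 -> torsion_poly b (/ x) * x ^ 25 = - torsion_poly b x.
Proof. intros Hx. unfold torsion_poly. field. auto. Qed.
Lemma torsion_poly_unit (b x : C) : algint b -> x <> 0 -> torsion_poly b x = 0 -> is_algebraic_unit x.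
Proof.
intros Hb Hx H. split; auto. split; [now apply (torsion_poly_algint b)|].
apply (torsion_poly_algint b); auto. apply (Cmult_cancel_r (x ^ 25)); [now apply Cpow_nz|].
rewrite torsion_poly_inv, H by auto. ring.
Qed.
Lemma y_algint (j y : C) : algint j -> (y ^ 2 - 16 * y + 256) ^ 3 = j * y ^ 2 * (y - 16) ^ 2 -> algint y.
Proof.
intros Hj H.
apply (algint_root (RtoC 16777216 :: RtoC (-3145728) :: 393216 - 256 * j :: -28672 + 32 * j :: 1536 - j :: RtoC (-48) :: nil)%list).
- repeat (apply List.Forall_cons; [alg_int|]). apply List.Forall_nil.
- apply Ceq_minus in H. etransitivity; [|exact H]. simpl fold_right. ring.
Qed.

Lemma Theta_parity A B : (Re A < 0)%R ->
  Theta A B = Theta (4 * A) (2 * B) + cexp (A + B) * Theta (4 * A) (4 * A + 2 * B).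
Proof.
intros HA. assert (HA4 : (Re (4 * A) < 0)%R) by (rewrite Re_scal_R; lra).
unfold Theta. rewrite (csum_split _ (fun n => 2 * n)%Z (fun n => 2 * n + 1)%Z); try (intros; lia).
- rewrite <- csum_scal by now apply summable_thterm.
  f_equal; apply csum_ext; intros n; unfold thterm; rewrite <- ?cexp_plus; f_equal;
  rewrite ?plus_IZR, mult_IZR, !RtoC_mult, ?RtoC_plus, ?RtoC_mult; ring.
- intros n. destruct (Z.Even_or_Odd n) as [[k Hk]|[k Hk]]; eauto.
- now apply summable_thterm.
Qed.

(** The triple product at U and at U + pi i gives the full and the alternating theta series; split
    by the parity of n, they are [Ee + Oo] and [Ee - Oo], up to the common factor (Q;Q)_infinity. *)
Lemma product_ratio U V : (Re V < 0)%R -> Ee V U <> 0 ->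
  let P := qpoch_inf (- cexp U) (cexp V) * qpoch_inf (- cexp (V - U)) (cexp V) in
  let M := qpoch_inf (cexp U) (cexp V) * qpoch_inf (cexp (V - U)) (cexp V) in
  (P - M) / (P + M) = Oo V U / Ee V U.
Proof.
intros HV HE P M.
set (E := qpoch_inf (cexp V) (cexp V)).
assert (HQ : (Cmod (cexp V) < 1)%R) by now apply Cmod_cexp_lt1.
assert (HE0 : E <> 0) by (apply qpoch_inf_neq_0; auto; intros; now apply small_factor).
assert (N2 : RtoC 2 <> 0) by (apply RtoC_neq_0; lra).
assert (HA : (Re (V / 2) < 0)%R).
{ unfold Cdiv. rewrite Cmult_comm, <- RtoC_inv, Re_scal_R by lra. lra. }
assert (E4 : 4 * (V / 2) = 2 * V) by (field; auto).
assert (EP : E * P = Ee V U + Oo V U).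
{ unfold E, P. rewrite jacobi_triple, Theta_parity by auto. unfold Ee, Oo. rewrite E4.
  replace (2 * (U - V / 2)) with (2 * U - V) by (field; auto).
  replace (V / 2 + (U - V / 2)) with U by ring.
  replace (2 * V + (2 * U - V)) with (2 * U + V) by ring. ring. }
assert (EM : E * M = Ee V U - Oo V U).
{ pose proof (jacobi_triple (U + PiI) V HV) as J.
  replace (- cexp (U + PiI)) with (cexp U) in J by (rewrite cexp_plus, cexp_PiI; ring).
  replace (- cexp (V - (U + PiI))) with (cexp (V - U)) in J.
  2:{ rewrite <- (cexp_period 1 (V - (U + PiI))). replace (V - (U + PiI) + 1 * (2 * PiI)) with (V - U + PiI) by ring.
      rewrite (cexp_plus (V - U)), cexp_PiI; ring. }
  fold E M in J. rewrite J, Theta_parity by auto. unfold Ee, Oo. rewrite E4.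
  replace (2 * (U + PiI - V / 2)) with (2 * U - V + 2 * PiI) by (field; auto).
  replace (V / 2 + (U + PiI - V / 2)) with (U + PiI) by ring.
  replace (2 * V + (2 * U - V + 2 * PiI)) with (2 * U + V + 2 * PiI) by ring.
  rewrite !Theta_period, cexp_plus, cexp_PiI. ring. }
assert (S1' : E * (P + M) = 2 * Ee V U) by (replace (E * (P + M)) with (E * P + E * M) by ring; rewrite EP, EM; ring).
assert (S2' : E * (P - M) = 2 * Oo V U) by (replace (E * (P - M)) with (E * P - E * M) by ring; rewrite EP, EM; ring).
assert (HPM : P + M <> 0).
{ intros E0. rewrite E0, Cmult_0_r in S1'. apply (Cmult_neq_0 2 (Ee V U)); auto. }
apply (Cmult_cancel_r (Ee V U)); auto.
apply (Cmult_cancel_r (2 * (P + M))); [apply Cmult_neq_0; auto|].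
transitivity ((P - M) * (2 * Ee V U)); [field; auto|]. rewrite <- S1'.
transitivity ((E * (P - M)) * (P + M)); [ring|]. rewrite S2'. field. auto.
Qed.

Lemma qnome_cexp tau : qnome tau = cexp (2 * PiI * tau).
Proof.
unfold qnome, cexp. destruct tau as [x y]; unfold PiI, Re, Im; simpl.
f_equal; [f_equal; f_equal; ring|]. f_equal; [f_equal; ring|f_equal; ring].
Qed.

(** The 10 arises because pi i (10 tau) is the logarithm of q^5, the base of the products. *)
Lemma beta_integral tau : in_imag_quadratic_upper tau -> algint (beta (PiI * (10 * tau))).
Proof.
intros (Ht & a & b & c & Ha & E).
assert (Ht1 : (0 < Im (10 * tau))%R) by (rewrite Im_scal_R; lra).
assert (Hj : algint (jinv (10 * tau))).
{ apply jinv_CM. split; auto. exists a, (10 * b)%Z, (100 * c)%Z. split; auto.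
  rewrite !mult_IZR, !RtoC_mult.
  transitivity (100 * (IZR a * (tau * tau) + IZR b * tau + IZR c)); [ring|]. rewrite E. ring. }
pose proof (Re_PiI_neg _ Ht1) as HA.
pose proof (jinv_y _ Ht1) as Hy. apply y_algint in Hy; auto.
assert (HA2 : (Re (2 * (PiI * (10 * tau))) < 0)%R) by (rewrite Re_scal_R; lra).
pose proof (beta_theta (PiI * (10 * tau)) HA) as Hb.
assert (N2 : Theta (2 * (PiI * (10 * tau))) (2 * (PiI * (10 * tau))) <> 0) by now apply Theta_neq_0_edge.
assert (N3 : Theta (2 * (PiI * (10 * tau))) 0 <> 0).
{ apply Theta_neq_0_strip. change (Re 0) with 0%R. rewrite Rabs_R0; lra. }
specialize (Hb N2 N3).
replace (beta (PiI * (10 * tau))) with (beta (PiI * (10 * tau)) + 8 - 8) by ring.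
rewrite Hb. apply algint_minus; [exact Hy|apply algint_IZR].
Qed.

(** The ratio of real parts is 1/5 or 2/5 in the applications; being below 1/2, it keeps 2U - V and
    2U + V in the zero-free strip of the theta function with nome e^(2V). *)
Lemma torsion_point_unit V U : (Re V < 0)%R -> algint (beta V) ->
  (0 < Re U / Re V < / 2)%R -> Ee V (5 * U) = Oo V (5 * U) ->
  Ee V U <> 0 /\ is_algebraic_unit (Oo V U / Ee V U).
Proof.
intros HV Hb HU H5.
assert (HV2 : (Re (2 * V) < 0)%R) by (rewrite Re_scal_R; lra).
assert (HUV : (Re V / 2 < Re U < 0)%R).
{ set (t := (Re U / Re V)%R) in *. assert (E : Re U = (t * Re V)%R) by (unfold t; field; lra). rewrite E. nra. }
assert (HE : Ee V U <> 0).
{ apply Theta_neq_0_strip. rewrite Re_minus, !Re_scal_R. apply Rabs_def1; lra. }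
assert (HO : Oo V U <> 0).
{ apply Cmult_neq_0; [apply cexp_neq0|]. apply Theta_neq_0_strip. rewrite Re_plus, !Re_scal_R. apply Rabs_def1; lra. }
split; auto. apply (torsion_poly_unit (beta V)); auto.
- intros E. apply HO. transitivity (Oo V U / Ee V U * Ee V U); [field; auto|]. rewrite E; ring.
- apply torsion_eq; auto.
  + now apply Theta_neq_0_edge.
  + apply Theta_neq_0_strip. change (Re 0) with 0%R. rewrite Rabs_R0; lra.
  + apply Theta_neq_0_strip. replace (Re PiI) with 0%R by (unfold PiI; simpl; ring). rewrite Rabs_R0; lra.
Qed.

Theorem theorem5p7 (tau : C) :
  in_imag_quadratic_upper tau ->
  is_algebraic_unit (T1 tau) /\ is_algebraic_unit (T2 tau).
Proof.
intros H. assert (Ht : (0 < Im tau)%R) by apply H.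
pose proof (beta_integral tau H) as Hb.
set (U := 2 * PiI * tau). set (V := PiI * (10 * tau)) in *.
assert (EV : V = 5 * U) by (unfold V, U; ring).
assert (HV : (Re V < 0)%R). { unfold V. apply Re_PiI_neg. rewrite Im_scal_R; lra. }
assert (HRe : Re V = (5 * Re U)%R) by (rewrite EV; apply Re_scal_R).
assert (Eq : forall k, qnome tau ^ k = cexp (RtoC (INR k) * U)).
{ intros k. rewrite qnome_cexp, cexp_nat. reflexivity. }
assert (Eq1 : qnome tau = cexp U) by apply qnome_cexp.
assert (Eq2 : qnome tau ^ 2 = cexp (2 * U)) by (rewrite Eq; f_equal; simpl INR; rewrite !RtoC_plus; ring).
(* Writing q^3 and q^4 as q^5 divided by q^2 and q matches the pairs u, Q/u of the triple
   product. *)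
assert (Eq3 : qnome tau ^ 3 = cexp (V - 2 * U)) by (rewrite Eq, EV; f_equal; simpl INR; rewrite !RtoC_plus; ring).
assert (Eq4 : qnome tau ^ 4 = cexp (V - U)) by (rewrite Eq, EV; f_equal; simpl INR; rewrite !RtoC_plus; ring).
assert (Eq5 : qnome tau ^ 5 = cexp V) by (rewrite Eq, EV; f_equal; simpl INR; rewrite !RtoC_plus; ring).
split.
- destruct (torsion_point_unit V U HV Hb) as [HE HU].
  + rewrite HRe. replace (Re U / (5 * Re U))%R with (/ 5)%R by (field; lra). lra.
  + rewrite <- EV. now apply Ee_Oo_V.
  + unfold T1. cbv zeta. rewrite Eq4, Eq5, Eq1. rewrite (product_ratio U V HV HE). exact HU.
- destruct (torsion_point_unit V (2 * U) HV Hb) as [HE HU].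
  + rewrite HRe, Re_scal_R. replace (2 * Re U / (5 * Re U))%R with (2 / 5)%R by (field; lra). lra.
  + replace (5 * (2 * U)) with (2 * V) by (rewrite EV; ring). now apply Ee_Oo_2V.
  + unfold T2. cbv zeta. rewrite Eq2, Eq3, Eq5. rewrite (product_ratio (2 * U) V HV HE). exact HU.
Qed.
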